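(* Let $(\mathfrak h,W)$ be an irreducible finite complex reflection group and $K\lhd W$ a normal subgroup which acts on $\mathfrak h$ (by restriction) as a complex reflection group. Let $\mathbf c:\mathrm{Ref}(K)\to\mathbb C$ be invariant under $W$-conjugation, extended by zero to $\mathrm{Ref}(W)$, and let $\Gamma=W/K$. Let $\Omega_{\mathbf c}(\cdot)^{\mathrm{cusp}}$ be the set of cuspidal Calogero–Moser $\mathbf c$-families and $\Omega_{\mathbf c}(\cdot)^{\mathrm{rigid}}$ the set of Calogero–Moser $\mathbf c$-families containing some $\lambda$ with $L_{\mathbf c}(\lambda)$ rigid. Consider the bijection $\beta:\Omega_{\mathbf c}(W)\to\Omega_{\mathbf c}(K)/\Gamma$ sending $\mathcal F$ to the $\Gamma$-orbit of families of $K$ whose union is $\{\lambda\in\mathrm{Irr}(K)\mid\lambda\subset\mathrm{Res}^W_K\mu\text{ for some }\mu\in\mathcal F\}$. (a) The set $\Omega_{\mathbf c}(K)^{\mathrm{cusp}}$ is $\Gamma$-stable, and (the inverse of) $\beta$ restricts to an embedding $\Omega_{\mathbf c}(K)^{\mathrm{cusp}}/\Gamma\hookrightarrow\Omega_{\mathbf c}(W)^{\mathrm{cusp}}$. (b) The set $\Omega_{\mathbf c}(K)^{\mathrm{rigid}}$ is $\Gamma$-stable, and $\beta$ restricts to a bijection $\Omega_{\mathbf c}(W)^{\mathrm{rigid}}\leftrightarrow\Omega_{\mathbf c}(K)^{\mathrm{rigid}}/\Gamma$.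
   Context: A finite complex reflection group is a pair $(\mathfrak h,W)$ with $\mathfrak h$ a finite-dimensional complex vector space and $W\subset GL(\mathfrak h)$ a non-trivial finite subgroup generated by its set $\mathrm{Ref}(W)$ of reflections (elements $s$ with $\mathrm{Ker}(1-s)$ of codimension one). For $s\in\mathrm{Ref}(W)$ let $\alpha_s\in\mathfrak h^*$ span $\mathrm{Im}(s-1)|_{\mathfrak h^*}$ and $\alpha_s^\vee\in\mathfrak h$ span $\mathrm{Im}(s-1)|_{\mathfrak h}$, with $\alpha_s(\alpha_s^\vee)=2$. For $t\in\mathbb C$ (or $t$ an indeterminate, over $\mathbb C[t]$), $\mathsf H_{t,\mathbf c}(W)$ is the quotient of $T(\mathfrak h\oplus\mathfrak h^* )\rtimes W$ by $[x,x']=[y,y']=0$ and $[y,x]=t(y,x)-\sum_{s}\mathbf c(s)(y,\alpha_s)(\alpha_s^\vee,x)s$ for $x,x'\in\mathfrak h^*$, $y,y'\in\mathfrak h$, where $(y,x)=x(y)$. Put $\mathsf H_{\mathbf c}(W)=\mathsf H_{0,\mathbf c}(W)$, $Z_{\mathbf c}(W)$ its centre, $X_{\mathbf c}(W)=\mathrm{Spec}\,Z_{\mathbf c}(W)$. The subalgebra $D(W)=\mathbb C[\mathfrak h]^W\otimes\mathbb C[\mathfrak h^*]^W$ is central; $\overline{\mathsf H}_{\mathbf c}(W)=\mathsf H_{\mathbf c}(W)/D(W)_+\mathsf H_{\mathbf c}(W)$, where $D(W)_+$ consists of elements with zero constant term. For $\lambda\in\mathrm{Irr}\,W$, $L_{\mathbf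 c}(\lambda)$ is the simple head of the baby Verma module $\overline{\mathsf H}_{\mathbf c}(W)\otimes_{\mathbb C[\mathfrak h^*]^{\mathrm{co}W}\rtimes W}\lambda$, where $\mathbb C[\mathfrak h^*]^{\mathrm{co}W}=\mathbb C[\mathfrak h^*]/\langle\mathbb C[\mathfrak h^*]^W_+\rangle$ acts on $\lambda$ through its augmentation; $\lambda\mapsto L_{\mathbf c}(\lambda)$ is a bijection $\mathrm{Irr}\,W\to\mathrm{Irr}\,\overline{\mathsf H}_{\mathbf c}(W)$. The set $\Omega_{\mathbf c}(W)$ of Calogero–Moser $\mathbf c$-families consists of the classes of $\mathrm{Irr}\,W$ under: $\lambda\sim\mu$ iff $L_{\mathbf c}(\lambda),L_{\mathbf c}(\mu)$ lie in the same block of $\overline{\mathsf H}_{\mathbf c}(W)$; equivalently iff they have the same annihilator (a maximal ideal) in $Z_{\mathbf c}(W)$. $Z_{\mathbf c}(W)$ is a Poisson algebra: lift $z_1,z_2$ to $\hat z_1,\hat z_2\in\mathsf H_{t,\mathbf c}(W)$, $t$ an indeterminate, and let $\{z_1,z_2\}$ be the class of $t^{-1}[\hat z_1,\hat z_2]$ modulo $t$. A family is *cuspidal* if the corresponding closed point of $X_{\mathbf c}(W)$ is a zero-dimensional symplectic leaf, i.e. its maximal ideal is a Poisson ideal. A simple $\mathsf H_{\mathbf c}(W)$-module is *rigid* if it is irreducible as a $W$-module. All notions are defined likewise for $(\mathfrak h,K)$. $\Gamma$ acts on $\mathrm{Irr}(K)$ via conjugation by $W$, and this induces an action on $\Omega_{\mathbf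 c}(K)$. *)

(* Defs.v *)
From HB Require Import structures.
From mathcomp Require Import all_boot all_order all_fingroup all_algebra.
From mathcomp Require Import all_character generic_quotient ring_quotient.
From mathcomp Require Import finmap complex monalg mpoly boolp reals.

Set Implicit Arguments.
Unset Strict Implicit.
Unset Printing Implicit Defensive.

Import GRing.Theory.
Local Open Scope ring_scope.
Local Open Scope quotient_scope.

(* The quotients below may be zero, hence pzRingType and not nzRingType.      *)

Section RingQuotient.
Variables (A : pzRingType) (S : A -> Prop).

Inductive ideal_gen : A -> Prop :=
| IdealGen0 : ideal_gen 0
| IdealGenD a s b x : S s -> ideal_gen x -> ideal_gen (a * s * b + x).

Definition ideal_pred : {pred A} := [pred a | `[< ideal_gen a >]].

Lemma ideal_predP a : reflect (ideal_gen a) (a \in ideal_pred).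
Proof. by rewrite inE; apply: asboolP. Qed.

Fact ideal_pred_zmod_closed : zmod_closed ideal_pred.
Proof.
split=> [|x y /ideal_predP Ix /ideal_predP Iy]; apply/ideal_predP.
  exact: IdealGen0.
elim: Ix => {x} [|a s b x Ss _ IHx]; last by rewrite -addrA; apply: IdealGenD.
rewrite sub0r; elim: Iy => {y} [|a s b y Ss _ IHy].
  by rewrite oppr0; apply: IdealGen0.
by rewrite opprD -!mulNr; apply: IdealGenD.
Qed.

HB.instance Definition _ :=
  GRing.isZmodClosed.Build A ideal_pred ideal_pred_zmod_closed.

Lemma ideal_predM a b x : x \in ideal_pred -> a * x * b \in ideal_pred.
Proof.
move=> /ideal_predP Ix; apply/ideal_predP.
elim: Ix => {x} [|a' s b' x Ss _ IHx]; first by rewrite mulr0 mul0r; left.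
rewrite mulrDr mulrDl; have -> : a * (a' * s * b') * b = (a * a') * s * (b' * b).
  by rewrite !mulrA.
exact: IdealGenD.
Qed.

Definition ring_quot : Type := Quotient.quot ideal_pred.
HB.instance Definition _ := EqQuotient.on ring_quot.
HB.instance Definition _ := GRing.Zmodule.on ring_quot.

Definition ring_proj (a : A) : ring_quot := \pi_(Quotient.quot ideal_pred) a.

Lemma ring_projP a b : ring_proj a = ring_proj b <-> ideal_gen (a - b).
Proof.
split=> [e | /ideal_predP Iab]; last first.
  by apply/eqP; rewrite /ring_proj -Quotient.idealrBE.
by apply/ideal_predP; rewrite Quotient.idealrBE; apply/eqP.
Qed.

Lemma ring_proj_surj (q : ring_quot) : exists a, q = ring_proj a.
Proof. by exists (repr q); rewrite /ring_proj reprK. Qed.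

Fact ring_proj_is_zmod_morphism : zmod_morphism ring_proj.
Proof. by move=> a b; rewrite /ring_proj raddfB. Qed.

HB.instance Definition _ :=
  GRing.isZmodMorphism.Build A ring_quot ring_proj ring_proj_is_zmod_morphism.

Definition ring_quot_one : ring_quot := ring_proj 1.
Definition ring_quot_mul (p q : ring_quot) : ring_quot :=
  ring_proj (repr p * repr q).

Lemma ring_quot_mulE a b :
  ring_quot_mul (ring_proj a) (ring_proj b) = ring_proj (a * b).
Proof.
have reprP x : repr (ring_proj x) - x \in ideal_pred.
  by rewrite Quotient.idealrBE reprK.
apply/ring_projP/ideal_predP; set a' := repr _; set b' := repr _.
have -> : a' * b' - a * b = 1 * (a' - a) * b' + a * (b' - b) * 1.
  by rewrite mul1r mulr1 mulrBl mulrBr addrA subrK.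
by apply: rpredD; apply: ideal_predM; apply: reprP.
Qed.

Fact ring_quot_mulA : associative ring_quot_mul.
Proof.
move=> p q r; case: (ring_proj_surj p) (ring_proj_surj q) (ring_proj_surj r).
by move=> a -> [b ->] [c ->]; rewrite !ring_quot_mulE mulrA.
Qed.

Fact ring_quot_mul1l : left_id ring_quot_one ring_quot_mul.
Proof. by move=> p; have [a ->] := ring_proj_surj p; rewrite ring_quot_mulE mul1r. Qed.

Fact ring_quot_mul1r : right_id ring_quot_one ring_quot_mul.
Proof. by move=> p; have [a ->] := ring_proj_surj p; rewrite ring_quot_mulE mulr1. Qed.

Fact ring_quot_mulDl : left_distributive ring_quot_mul +%R.
Proof.
move=> p q r; case: (ring_proj_surj p) (ring_proj_surj q) (ring_proj_surj r).
by move=> a -> [b ->] [c ->]; rewrite -raddfD !ring_quot_mulE mulrDl raddfD.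
Qed.

Fact ring_quot_mulDr : right_distributive ring_quot_mul +%R.
Proof.
move=> p q r; case: (ring_proj_surj p) (ring_proj_surj q) (ring_proj_surj r).
by move=> a -> [b ->] [c ->]; rewrite -raddfD !ring_quot_mulE mulrDr raddfD.
Qed.

HB.instance Definition _ := GRing.Zmodule_isPzRing.Build ring_quot
  ring_quot_mulA ring_quot_mul1l ring_quot_mul1r ring_quot_mulDl ring_quot_mulDr.

Fact ring_proj_is_monoid_morphism : monoid_morphism ring_proj.
Proof. by split=> // a b; rewrite -ring_quot_mulE. Qed.

HB.instance Definition _ :=
  GRing.isMonoidMorphism.Build A ring_quot ring_proj ring_proj_is_monoid_morphism.

End RingQuotient.

Section ModuleQuotient.
Variables (A : pzRingType) (M : lmodType A) (S : M -> Prop).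

Inductive submod_gen : M -> Prop :=
| SubmodGen0 : submod_gen 0
| SubmodGenD a s x : S s -> submod_gen x -> submod_gen (a *: s + x).

Definition submod_pred : {pred M} := [pred v | `[< submod_gen v >]].

Lemma submod_predP v : reflect (submod_gen v) (v \in submod_pred).
Proof. by rewrite inE; apply: asboolP. Qed.

Fact submod_pred_zmod_closed : zmod_closed submod_pred.
Proof.
split=> [|x y /submod_predP Ix /submod_predP Iy]; apply/submod_predP.
  exact: SubmodGen0.
elim: Ix => {x} [|a s x Ss _ IHx]; last by rewrite -addrA; apply: SubmodGenD.
rewrite sub0r; elim: Iy => {y} [|a s y Ss _ IHy].
  by rewrite oppr0; apply: SubmodGen0.
by rewrite opprD -scaleNr; apply: SubmodGenD.
Qed.

HB.instance Definition _ :=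
  GRing.isZmodClosed.Build M submod_pred submod_pred_zmod_closed.

Lemma submod_predZ a x : x \in submod_pred -> a *: x \in submod_pred.
Proof.
move=> /submod_predP Ix; apply/submod_predP.
elim: Ix => {x} [|b s x Ss _ IHx]; first by rewrite scaler0; left.
by rewrite scalerDr scalerA; apply: SubmodGenD.
Qed.

Definition mod_quot : Type := Quotient.quot submod_pred.
HB.instance Definition _ := EqQuotient.on mod_quot.
HB.instance Definition _ := GRing.Zmodule.on mod_quot.

Definition mod_proj (v : M) : mod_quot := \pi_(Quotient.quot submod_pred) v.

Lemma mod_projP u v : mod_proj u = mod_proj v <-> submod_gen (u - v).
Proof.
split=> [e | /submod_predP Iuv]; last first.
  by apply/eqP; rewrite /mod_proj -Quotient.idealrBE.
by apply/submod_predP; rewrite Quotient.idealrBE; apply/eqP.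
Qed.

Lemma mod_proj_surj (q : mod_quot) : exists v, q = mod_proj v.
Proof. by exists (repr q); rewrite /mod_proj reprK. Qed.

Fact mod_proj_is_zmod_morphism : zmod_morphism mod_proj.
Proof. by move=> u v; rewrite /mod_proj raddfB. Qed.

HB.instance Definition _ :=
  GRing.isZmodMorphism.Build M mod_quot mod_proj mod_proj_is_zmod_morphism.

Definition mod_quot_scale (a : A) (q : mod_quot) : mod_quot :=
  mod_proj (a *: repr q).

Lemma mod_quot_scaleE a v : mod_quot_scale a (mod_proj v) = mod_proj (a *: v).
Proof.
apply/mod_projP/submod_predP; rewrite -scalerBr; apply: submod_predZ.
by rewrite Quotient.idealrBE reprK.
Qed.

Fact mod_quot_scaleA a b v :
  mod_quot_scale a (mod_quot_scale b v) = mod_quot_scale (a * b) v.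
Proof. by have [u ->] := mod_proj_surj v; rewrite !mod_quot_scaleE scalerA. Qed.

Fact mod_quot_scale1 : left_id 1 mod_quot_scale.
Proof. by move=> v; have [u ->] := mod_proj_surj v; rewrite mod_quot_scaleE scale1r. Qed.

Fact mod_quot_scaleDr : right_distributive mod_quot_scale +%R.
Proof.
move=> a v w; case: (mod_proj_surj v) (mod_proj_surj w) => u -> [u' ->].
by rewrite -raddfD !mod_quot_scaleE scalerDr raddfD.
Qed.

Fact mod_quot_scaleDl v : {morph mod_quot_scale^~ v : a b / a + b}.
Proof.
by move=> a b; have [u ->] := mod_proj_surj v; rewrite !mod_quot_scaleE scalerDl raddfD.
Qed.

HB.instance Definition _ := GRing.Zmodule_isLmodule.Build A mod_quot
  mod_quot_scaleA mod_quot_scale1 mod_quot_scaleDr mod_quot_scaleDl.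

End ModuleQuotient.

Section Modules.
Variables (A : pzRingType) (M : lmodType A).

(* B is meant to be a subring of A *)
Definition submodule_over (B : A -> Prop) (N : M -> Prop) : Prop :=
  [/\ N 0, forall u v, N u -> N v -> N (u + v)
    & forall a v, B a -> N v -> N (a *: v)].

Definition irreducible_over (B : A -> Prop) : Prop :=
  (exists v : M, v <> 0) /\
  forall N, submodule_over B N -> (forall v, N v -> v = 0) \/ (forall v, N v).

Definition submodule : (M -> Prop) -> Prop := submodule_over (fun=> True).

Definition maximal_submodule (N : M -> Prop) : Prop :=
  [/\ submodule N, exists v, ~ N v
    & forall N', submodule N' -> (forall v, N v -> N' v) ->
        (forall v, N' v -> N v) \/ (forall v, N' v)].

Definition radical (v : M) : Prop := forall N, maximal_submodule N -> N v.

Definition mod_head : lmodType A := mod_quot radical.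

End Modules.

Section Blocks.
Variable A : pzRingType.

Definition central (z : A) : Prop := forall a, z * a = a * z.

Definition central_idempotent (e : A) : Prop := central e /\ e * e = e.

Definition primitive_central_idempotent (e : A) : Prop :=
  [/\ central_idempotent e, e <> 0
    & forall f, central_idempotent f -> f * e = f -> f = 0 \/ f = e].

(* L and L' belong to the block A e for some primitive central idempotent e *)
Definition same_block (L L' : lmodType A) : Prop :=
  exists e, [/\ primitive_central_idempotent e,
                forall v : L, e *: v = v & forall v : L', e *: v = v].

End Blocks.

(* A representation rG of G is a right action on row vectors in MathComp; we  *)
(* turn it into the left action g.y = y *m rG g^-1 on 'rV_n.  With            *)
(* h = 'rV_n, the dual h^* is 'cV_n with g.x = rG g *m x and (y, x) = y *m x. *)

Section ReflectionGroups.
Variables (F : fieldType) (gT : finGroupType) (G : {group gT}) (n : nat).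
Variable rG : mx_representation F G n.

Definition reflections : {set gT} :=
  [set s in G | (\rank (kermx (1%:M - rG s^-1%g))).+1 == n].

Definition complex_reflection_group : Prop :=
  [/\ mx_faithful rG, G :!=: 1%g & <<reflections>>%g = G].

Definition pairing (y : 'rV[F]_n) (x : 'cV[F]_n) : F := (y *m x) 0 0.

Definition root_coroot (s : gT) (a : 'cV[F]_n) (av : 'rV[F]_n) : Prop :=
  [/\ (a^T == (rG s - 1%:M)^T)%MS, (av == rG s^-1%g - 1%:M)%MS
    & pairing av a = 2].

Definition extend_by_zero (c : gT -> F) (s : gT) : F :=
  if s \in reflections then c s else 0.

(* f is invariant under the substitution of \sum_j A i j 'X_j for 'X_i *)
Definition subst_invariant (A : 'M[F]_n) (f : mpoly n F) : Prop :=
  f \mPo [tuple \sum_j A i j *: 'X_j | i < n] = f.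

(* F[h]^G, where 'X_i stands for the i-th vector of the basis of h^* = 'cV_n *)
Definition invariant_on_h (f : mpoly n F) : Prop :=
  forall g, g \in G -> subst_invariant (rG g)^T f.

(* F[h^*]^G, where 'X_i stands for the i-th vector of the basis of h = 'rV_n *)
Definition invariant_on_dual (f : mpoly n F) : Prop :=
  forall g, g \in G -> subst_invariant (rG g^-1%g) f.

End ReflectionGroups.

Section Cherednik.
Variables (F : fieldType) (gT : finGroupType) (G : {group gT}) (n : nat).
Variable rG : mx_representation F G n.
Variables (alpha : gT -> 'cV[F]_n) (alphav : gT -> 'rV[F]_n) (c : gT -> F).

(* generators h, h^* and G of T(h (+) h^* ) ><| G *)
Definition cherednik_gen : choiceType := ('rV[F]_n + 'cV[F]_n + subg_of G)%type.

Definition cherednik_free (k : comNzRingType) : nzRingType :=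
  {malg k[{fmonom cherednik_gen}]}.

Section Relations.
Variables (k : comNzRingType) (phi : {rmorphism F -> k}) (t : k).

Local Notation Free := {malg k[{fmonom cherednik_gen}]}.
Let Y (y : 'rV[F]_n) : Free := << fmu (inl (inl y) : cherednik_gen) >>.
Let X (x : 'cV[F]_n) : Free := << fmu (inl (inr x) : cherednik_gen) >>.
Let T (g : gT) : Free := << fmu (inr (subg G g) : cherednik_gen) >>.

(* Up to RelTX the relations present T(h (+) h^* ) ><| G, with scalars        *)
(* extended to k along phi; the last three ones define H_{t,c}(G).            *)
Inductive cherednik_rel : cherednik_free k -> Prop :=
| RelYlin a y y' : cherednik_rel (Y (a *: y + y') - (phi a *: Y y + Y y'))
| RelXlin a x x' : cherednik_rel (X (a *: x + x') - (phi a *: X x + X x'))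
| RelT1 : cherednik_rel (T 1%g - 1)
| RelTM g g' : g \in G -> g' \in G -> cherednik_rel (T g * T g' - T (g * g')%g)
| RelTY g y : g \in G -> cherednik_rel (T g * Y y - Y (y *m rG g^-1%g) * T g)
| RelTX g x : g \in G -> cherednik_rel (T g * X x - X (rG g *m x) * T g)
| RelXX x x' : cherednik_rel (X x * X x' - X x' * X x)
| RelYY y y' : cherednik_rel (Y y * Y y' - Y y' * Y y)
| RelYX y x : cherednik_rel
    ((Y y * X x - X x * Y y) -
     ((t * phi (pairing y x)) *: 1 -
      \sum_(s in reflections rG)
         phi (c s * pairing y (alpha s) * pairing (alphav s) x) *: T s)).

Definition cherednik : pzRingType := ring_quot cherednik_rel.

Definition ch_proj : cherednik_free k -> cherednik := ring_proj cherednik_rel.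
Definition ch_scal (a : k) : cherednik := ch_proj (a *: (1 : Free)).
Definition ch_Y (y : 'rV[F]_n) : cherednik := ch_proj (Y y).
Definition ch_X (x : 'cV[F]_n) : cherednik := ch_proj (X x).
Definition ch_T (g : gT) : cherednik := ch_proj (T g).

End Relations.

(* Ht is over F[t] with t = 'X, and Hc is over F with t = 0 *)
Definition Ht : pzRingType := cherednik polyC 'X.
Definition Hc : pzRingType := cherednik idfun 0.

Local Notation hscal := (ch_scal idfun 0).
Local Notation hX := (ch_X idfun 0).
Local Notation hY := (ch_Y idfun 0).
Local Notation hT := (ch_T idfun 0).

(* u in H_{t,c} lifts z in H_c: z is the class of u modulo t *)
Definition lifts (u : Ht) (z : Hc) : Prop :=
  exists a : {malg {poly F}[{fmonom cherednik_gen}]},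
    u = ch_proj polyC 'X a /\
    z = ch_proj idfun 0 (\sum_(m <- enum_fset (monalg.msupp a)) << (monalg.mcoeff m a).[0] *g m >>).

(* the graph of the Poisson bracket: z is the class of t^-1 [u1, u2] modulo t *)
Definition poisson_bracket (z1 z2 z : Hc) : Prop :=
  exists u1 u2 u : Ht,
    [/\ lifts u1 z1, lifts u2 z2, lifts u z
      & u1 * u2 - u2 * u1 = ch_scal polyC 'X 'X * u].

Definition poisson_ideal (I : Hc -> Prop) : Prop :=
  forall z1 z2 z, central z1 -> I z2 -> poisson_bracket z1 z2 z -> I z.

Definition eval_with (v : 'I_n -> Hc) (f : mpoly n F) : Hc :=
  \sum_(m <- msupp f) hscal f@_m * \prod_(i < n) v i ^+ m i.

(* F[h] and F[h^*] in H_c, with the variables of invariant_on_h and           *)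
(* invariant_on_dual                                                          *)
Definition evalX : mpoly n F -> Hc := eval_with (fun i => hX (delta_mx i 0)).
Definition evalY : mpoly n F -> Hc := eval_with (fun i => hY (delta_mx 0 i)).

(* The element \sum f (x) g of F[h]^G (x) F[h^*]^G, given by the list of the  *)
(* pairs (f, g), has constant term \sum f(0) g(0).                            *)
Definition D_plus (d : Hc) : Prop :=
  exists s : seq (mpoly n F * mpoly n F),
    [/\ forall fg, fg \in s ->
          invariant_on_h rG fg.1 /\ invariant_on_dual rG fg.2,
        \sum_(fg <- s) fg.1@_0%MM * fg.2@_0%MM = 0
      & d = \sum_(fg <- s) evalX fg.1 * evalY fg.2].

(* As D_plus is central, the two-sided ideal it generates is D_plus * Hc. *)
Definition Hbar : pzRingType := ring_quot D_plus.

Definition bar : Hc -> Hbar := ring_proj D_plus.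

(* G-submodules are subspaces, hence submodules over the image of F[G] *)
Inductive group_subalgebra : Hbar -> Prop :=
| GsScal a : group_subalgebra (bar (hscal a))
| GsT g : g \in G -> group_subalgebra (bar (hT g))
| GsD b b' : group_subalgebra b -> group_subalgebra b' -> group_subalgebra (b + b')
| GsM b b' : group_subalgebra b -> group_subalgebra b' -> group_subalgebra (b * b').

Section Representation.
Variables (d : nat) (rho : mx_representation F G d).

(* verma_action b m: the element b of the subalgebra F[h^*]^{co G} ><| G of   *)
(* Hbar acts on 'rV_d by v |-> v *m m, where h acts by zero (the augmentation *)
(* of F[h^*]^{co G}) and G acts through rho.                                  *)
Inductive verma_action : Hbar -> 'M[F]_d -> Prop :=
| VaScal a : verma_action (bar (hscal a)) a%:M
| VaT g : g \in G -> verma_action (bar (hT g)) (rho g^-1%g)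
| VaY y : verma_action (bar (hY y)) 0
| VaD b b' m m' : verma_action b m -> verma_action b' m' ->
    verma_action (b + b') (m + m')
| VaM b b' m m' : verma_action b m -> verma_action b' m' ->
    verma_action (b * b') (m' *m m).

(* a (x) v in Hbar (x)_F 'rV[F]_d = 'rV[Hbar]_d *)
Definition pure_tensor (a : Hbar) (v : 'rV[F]_d) : 'rV[Hbar]_d :=
  map_mx (fun r => a * bar (hscal r)) v.

Definition balanced_rel (u : 'rV[Hbar]_d) : Prop :=
  exists a b m v, verma_action b m /\
    u = pure_tensor (a * b) v - pure_tensor a (v *m m).

Definition baby_verma : lmodType Hbar := mod_quot balanced_rel.

Definition simple_head : lmodType Hbar := mod_head baby_verma.

Definition annihilator (z : Hc) : Prop :=
  central z /\ forall v : simple_head, bar z *: v = 0.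

Definition rigid : Prop := irreducible_over simple_head group_subalgebra.

End Representation.

End Cherednik.

Arguments simple_head {F gT G n} rG alpha alphav c {d} rho.
Arguments annihilator {F gT G n} rG alpha alphav c {d} rho z.
Arguments rigid {F gT G n} rG alpha alphav c {d} rho.

Definition Irr (F : decFieldType) (gT : finGroupType) (G : {group gT}) :
  irrType F G := DecSocleType (regular_repr F G).

Section Families.
Variables (F : decFieldType) (gT : finGroupType) (G : {group gT}) (n : nat).
Variable rG : mx_representation F G n.
Variables (alpha : gT -> 'cV[F]_n) (alphav : gT -> 'rV[F]_n) (c : gT -> F).

Definition L (i : Irr F G) : lmodType (Hbar rG alpha alphav c) :=
  simple_head rG alpha alphav c (irr_repr i).

Definition families : {set {set Irr F G}} :=
  equivalence_partition (fun i j => `[< same_block (L i) (L j) >]) [set: Irr F G].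

Definition cuspidal_families : {set {set Irr F G}} :=
  [set X in families | `[< exists2 i, i \in X &
     poisson_ideal (annihilator rG alpha alphav c (irr_repr i)) >]].

Definition rigid_families : {set {set Irr F G}} :=
  [set X in families | `[< exists2 i, i \in X &
     rigid rG alpha alphav c (irr_repr i) >]].

End Families.

Section Clifford.
Variables (F : decFieldType) (gT : finGroupType) (W K : {group gT}).
Hypothesis sKW : K \subset W.

(* The W-action on Irr K is given by (w.i)(k) = i(w^-1 k w); K acts           *)
(* trivially, so W-orbits and W-stable sets are those of W / K.               *)
Definition conj_irr (w : gT) (i j : Irr F K) : Prop :=
  exists B : 'M[F]_(irr_degree i, irr_degree j),
    [/\ row_free B, row_full B
      & forall k, k \in K -> irr_repr i (k ^ w)%g *m B = B *m irr_repr j k].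

Definition conj_family (w : gT) (X : {set Irr F K}) : {set Irr F K} :=
  [set j | `[< exists2 i, i \in X & conj_irr w i j >]].

Definition stable_families (Om : {set {set Irr F K}}) : Prop :=
  forall w X, w \in W -> X \in Om -> conj_family w X \in Om.

Definition family_orbits (Om : {set {set Irr F K}}) : {set {set {set Irr F K}}} :=
  [set [set conj_family w X | w in W] | X in Om].

Definition in_restriction (j : Irr F K) (i : Irr F W) : Prop :=
  exists (U : 'M[F]_(irr_degree i))
         (modU : mxmodule (subg_repr (irr_repr i) sKW) U),
    mx_rsim (irr_repr j) (submod_repr modU).

Definition restriction_constituents (X : {set Irr F W}) : {set Irr F K} :=
  [set j | `[< exists2 i, i \in X & in_restriction j i >]].

(* The default value set0 is irrelevant: the theorem asserts that the orbit   *)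
(* exists for every family X of W.                                            *)
Definition beta (OmK : {set {set Irr F K}}) (X : {set Irr F W}) :
    {set {set Irr F K}} :=
  odflt set0
    [pick O in family_orbits OmK | cover O == restriction_constituents X].

End Clifford.

Definition bijection_onto (T U : finType) (f : T -> U) (A : {set T}) (B : {set U}) :=
  {in A &, injective f} /\ f @: A = B.

(* Main.v *)
(** By PBW the algebra of W is free over the algebra of K, with basis given by W / K, since c vanishes
    off K.  Whether an element of the centre kills L(lambda), by which scalar 0 or 1 a central
    idempotent of the restricted algebra acts on L(lambda), and whether L(lambda) is rigid can all be
    read off the action on lambda of an element of the group algebra, for central elements the
    constant term.  Constant terms are compatible with the inclusion of K in W, so the
    modules L(lambda) for W and K are compared through Clifford theory for lambda alone.

    If e commutes, modulo terms of high order, with the K-invariant polynomials f on h, then the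
    coefficient e_w of w in e satisfies (f - w f) e_w = 0 modulo high order.  Taking for f the
    coefficients of prod_(k in K) (T - k x) and T = w x, with x a generic linear form, gives
    prod_(k in K) (w x - k x) e_w = 0, hence e_w = 0 modulo high order when w is not in K.  So the
    centre for W, and the central idempotents of the restricted algebra for W (after lifting them
    modulo a high power of D_+), come from K.  Conversely the boolean union of the W-conjugates of a
    central idempotent for K is central for W.  Hence families of W correspond to W-orbits of families
    of K.  As t is torsion free in the generic algebra, the Poisson bracket of central elements for W
    is the bracket computed for K, which carries Poisson ideals from K to W. *)

Require Import Defs.
From HB Require Import structures.
From mathcomp Require Import all_boot all_order all_fingroup all_algebra.
From mathcomp Require Import all_character generic_quotient ring_quotient.
From mathcomp Require Import finmap complex monalg mpoly boolp reals.
From mathcomp Require Import ring.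
From mathcomp Require Import pgroup.

Set Implicit Arguments.
Unset Strict Implicit.
Unset Printing Implicit Defensive.

Import GRing.Theory.
Local Open Scope ring_scope.

(** * Free algebras and the universal property of the Cherednik algebra *)

(** At t = 0 the usual Dunkl representation on functions on h is not faithful. PBW is therefore
    proved on functions from the group to polynomials on both h and its dual, which is the left
    regular module written in normally ordered coordinates. The scalars may be any domain receiving
    F, so the same proof serves F with t = 0 and F[t] with t = 'X.

    The restricted algebra of K need not embed in that of W, because D(W)_+ may generate a smaller
    ideal than D(K)_+. The common measure is the order of PBW coordinates, which are the same
    polynomials for K and for W: the m-th power of either ideal has order at least m, and a large
    enough order forces membership in the ideal. Idempotents of K are thus lifted modulo a high
    power before they are moved to W. In the other direction, keeping only the coordinates on K is
    linear over the algebra of K and brings the ideal of W back into that of K. Division by #|K|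
    linear forms costs #|K| orders, hence the size of the power used for W. *)

Section MalgMonomials.
Variables (K : monomType) (k : comNzRingType).
Local Notation A := {malg k[K]}.

Lemma malgUM (a b : k) (m m' : K) :
  << a *g m >> * << b *g m' >> = << a * b *g mmul m m' >> :> A.
Proof.
by rewrite (malgMEw monalg.msuppU_le monalg.msuppU_le) !big_seq_fset1 !mcoeffUU.
Qed.

Lemma malgZ1 (a : k) : a *: 1 = << a *g mone >> :> A.
Proof. by rewrite -(mul_malgC a (1 : A)) mulr1. Qed.

Lemma malg_ind (Q : A -> Prop) : (forall a m, Q << a *g m >>) ->
  (forall x y, Q x -> Q y -> Q (x + y)) -> forall x, Q x.
Proof.
move=> QU QD x; rewrite (monalgEw (fsubset_refl (monalg.msupp x))).
by elim/big_ind: _ => //; rewrite -(monalgU0 mone).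
Qed.

Lemma malg_scaleAr (a : k) (x : A) : x * (a *: 1) = a *: x.
Proof.
rewrite malgZ1 -(mul_malgC a x); elim/malg_ind: x => [b m|x y ex ey].
  by rewrite !malgUM mulm1 mul1m mulrC.
by rewrite mulrDl mulrDr ex ey.
Qed.

Lemma malgU_scale (a : k) m : << a *g m >> = (a *: 1) * << m >> :> A.
Proof. by rewrite malgZ1 malgUM mulr1 mul1m. Qed.

End MalgMonomials.

Section FreeExtension.
Variables (I : choiceType) (k : comNzRingType) (B : pzRingType).
Variables (f : {rmorphism k -> B}) (v : I -> B).

Local Notation Free := {malg k[{fmonom I}]}.

Definition fm_ext (m : {fmonom I}) : B := \prod_(x <- (m : seq I)) v x.

Definition free_ext (a : Free) : B :=
  \sum_(m <- enum_fset (monalg.msupp a)) f (monalg.mcoeff m a) * fm_ext m.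

Lemma fm_ext1 : fm_ext mone = 1.
Proof. by rewrite /fm_ext fm1 big_nil. Qed.

Lemma fm_extM m m' : fm_ext (mmul m m') = fm_ext m * fm_ext m'.
Proof. by rewrite /fm_ext fmM big_cat. Qed.

Lemma fm_extU i : fm_ext (fmu i) = v i.
Proof. by rewrite /fm_ext fmU big_seq1. Qed.

Lemma free_extEw (d : {fset {fmonom I}}) a : (monalg.msupp a `<=` d)%fset ->
  free_ext a = \sum_(m <- d) f (monalg.mcoeff m a) * fm_ext m.
Proof.
move=> le; rewrite /free_ext (big_fset_incl _ le) => //= x xd /mcoeff_outdom ->.
by rewrite rmorph0 mul0r.
Qed.

Fact free_ext_is_zmod_morphism : zmod_morphism free_ext.
Proof.
move=> a b /=; set d := (monalg.msupp a `|` monalg.msupp b)%fset.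
have sab : (monalg.msupp (a - b) `<=` d)%fset by apply: monalg.msuppB_le.
rewrite !(@free_extEw d) ?fsubsetUl ?fsubsetUr // -sumrB.
by apply: eq_bigr => m _; rewrite monalg.mcoeffB rmorphB mulrBl.
Qed.

HB.instance Definition _ :=
  GRing.isZmodMorphism.Build Free B free_ext free_ext_is_zmod_morphism.

Lemma free_extU a m : free_ext << a *g m >> = f a * fm_ext m.
Proof. by rewrite (free_extEw monalg.msuppU_le) big_seq_fset1 mcoeffUU. Qed.

Lemma free_ext_gen i : free_ext << fmu i >> = v i.
Proof. by rewrite free_extU rmorph1 mul1r fm_extU. Qed.

Hypothesis comm_fv : forall a i, f a * v i = v i * f a.

Lemma comm_fm_ext a m : f a * fm_ext m = fm_ext m * f a.
Proof.
rewrite /fm_ext; elim: (m : seq I) => [|x s IHs]; first by rewrite big_nil mulr1 mul1r.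
by rewrite big_cons mulrA comm_fv -mulrA IHs mulrA.
Qed.

Lemma free_ext_is_monoid_morphism : monoid_morphism free_ext.
Proof.
split=> [|a b]; first by rewrite free_extU rmorph1 mul1r fm_ext1.
rewrite malgME raddf_sum /= mulr_suml; apply: eq_bigr => i _.
rewrite raddf_sum /= mulr_sumr; apply: eq_bigr => j _.
by rewrite free_extU rmorphM fm_extM -!mulrA; congr (_ * _); rewrite !mulrA comm_fm_ext.
Qed.

Lemma free_extZ a x : free_ext (a *: x) = f a * free_ext x.
Proof.
have [M1 MM] := free_ext_is_monoid_morphism.
by rewrite -mul_malgC MM /= free_extU fm_ext1 mulr1.
Qed.

End FreeExtension.

Lemma free_ind (I : choiceType) (k : comNzRingType)
    (Q : {malg k[{fmonom I}]} -> Prop) :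
  (forall a, Q (a *: 1)) -> (forall i, Q << fmu i >>) ->
  (forall x y, Q x -> Q y -> Q (x + y)) -> (forall x y, Q x -> Q y -> Q (x * y)) ->
  forall x, Q x.
Proof.
move=> QC QU QD QM; apply: malg_ind QD => a m.
rewrite malgU_scale; apply: (QM) => //; case: m => s.
elim: s => [|i s IHs].
  have -> : FMonom [::] = mone :> {fmonom I} by rewrite -fmoneE.
  by rewrite -malgZ1; apply: QC.
have -> : FMonom (i :: s) = mmul (fmu i) (FMonom s) :> {fmonom I}.
  by apply/eqP; rewrite fmP fmM fmU.
by rewrite -[X in mkmalgU _ X](mulr1 1) -malgUM; apply: QM.
Qed.

(** * Generators, relations and the universal property of the Cherednik algebra *)

Section Action.
Variables (F : fieldType) (gT : finGroupType) (G : {group gT}) (n : nat).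
Variable rG : mx_representation F G n.
Variables (alpha : gT -> 'cV[F]_n) (alphav : gT -> 'rV[F]_n) (c : gT -> F).
Variables (k : comNzRingType) (phi : {rmorphism F -> k}) (t : k).

(** The target is a bare ring and not an algebra over [k], so that the commutation of scalars with
    the images of the generators has to be listed among the relations. *)
Record ch_action (B : pzRingType) (sc : k -> B) (fY : 'rV[F]_n -> B)
    (fX : 'cV[F]_n -> B) (fT : gT -> B) : Prop := ChAction {
  ca_Yl : forall a y y', fY (a *: y + y') = sc (phi a) * fY y + fY y';
  ca_Xl : forall a x x', fX (a *: x + x') = sc (phi a) * fX x + fX x';
  ca_T1 : fT 1%g = 1;
  ca_TM : forall g h, g \in G -> h \in G -> fT (g * h)%g = fT g * fT h;
  ca_TY : forall g y, g \in G -> fT g * fY y = fY (y *m rG g^-1%g) * fT g;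
  ca_TX : forall g x, g \in G -> fT g * fX x = fX (rG g *m x) * fT g;
  ca_XX : forall x x', fX x * fX x' = fX x' * fX x;
  ca_YY : forall y y', fY y * fY y' = fY y' * fY y;
  ca_YX : forall y x, fY y * fX x - fX x * fY y = sc (t * phi (pairing y x)) -
    \sum_(s in reflections rG)
       sc (phi (c s * pairing y (alpha s) * pairing (alphav s) x)) * fT s;
  ca_scY : forall a y, sc a * fY y = fY y * sc a;
  ca_scX : forall a x, sc a * fX x = fX x * sc a;
  ca_scT : forall a g, g \in G -> sc a * fT g = fT g * sc a }.

Local Notation H := (cherednik rG alpha alphav c phi t).
Local Notation scal := (ch_scal rG alpha alphav c phi t).
Local Notation hY := (ch_Y rG alpha alphav c phi t).
Local Notation hX := (ch_X rG alpha alphav c phi t).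
Local Notation hT := (ch_T rG alpha alphav c phi t).
Local Notation proj := (ch_proj rG alpha alphav c phi t).
Local Notation Free := {malg k[{fmonom (cherednik_gen F G n)}]}.

Lemma ch_projP (a b : Free) :
  cherednik_rel rG alpha alphav c phi t (a - b) -> proj a = proj b.
Proof.
move=> r; apply/ring_projP; rewrite -[a - b]addr0 -[X in X + 0]mulr1 -[X in X * 1 + 0]mul1r.
exact: (IdealGenD _ _ r (IdealGen0 _)).
Qed.

Lemma ch_proj_scale a x : proj (a *: x) = scal a * proj x.
Proof. by rewrite /ch_scal /ch_proj -rmorphM mulr_algl. Qed.

Lemma ch_proj_subsum (x : Free) (A : {set gT}) (f : gT -> Free) :
  proj (x - \sum_(s in A) f s) = proj x - \sum_(s in A) proj (f s).
Proof.
have pB : zmod_morphism proj by move=> u v; rewrite /ch_proj raddfB.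
have p0 : proj 0 = 0 by have := pB 0 0; rewrite !subrr.
rewrite pB; congr (_ - _); apply: (big_morph proj) => // u v.
by rewrite -[in LHS](opprK v) pB -(sub0r v) pB p0 sub0r opprK.
Qed.

Fact ch_scal_is_zmod_morphism : zmod_morphism scal.
Proof. by move=> a b; rewrite /ch_scal scalerBl /ch_proj raddfB. Qed.

HB.instance Definition _ := GRing.isZmodMorphism.Build k H scal ch_scal_is_zmod_morphism.

Fact ch_scal_is_monoid_morphism : monoid_morphism scal.
Proof.
split=> [|a b]; first by rewrite /ch_scal scale1r /ch_proj rmorph1.
by rewrite {1}/ch_scal -scalerA ch_proj_scale.
Qed.

HB.instance Definition _ := GRing.isMonoidMorphism.Build k H scal ch_scal_is_monoid_morphism.

Lemma ch_scalC a (h : H) : scal a * h = h * scal a.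
Proof.
have [x ->] := ring_proj_surj h.
rewrite /ch_scal /ch_proj -!rmorphM mulr_algl; congr (ring_proj _ _).
by rewrite malg_scaleAr.
Qed.

Lemma ch_ind (Q : H -> Prop) :
  (forall a, Q (scal a)) -> (forall y, Q (hY y)) -> (forall x, Q (hX x)) ->
  (forall g, g \in G -> Q (hT g)) ->
  (forall x y, Q x -> Q y -> Q (x + y)) -> (forall x y, Q x -> Q y -> Q (x * y)) ->
  forall h, Q h.
Proof.
move=> Qs QY QX QT QD QM h; have [x ->] := ring_proj_surj h.
elim/free_ind: x => [a|[[y|x]|g]|x y|x y].
- exact: Qs.
- exact: QY.
- exact: QX.
- by have := QT (sgval g) (subgP g); rewrite /ch_T sgvalK.
- by rewrite raddfD; apply: QD.
- by rewrite rmorphM; apply: QM.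
Qed.

Lemma ch_actionP : ch_action scal hY hX hT.
Proof.
have subE (a b : H) : a - b = 0 -> a = b by move/eqP; rewrite subr_eq0 => /eqP.
split.
- move=> a y y'; rewrite -ch_proj_scale /ch_Y /ch_proj -raddfD.
  exact/ch_projP/RelYlin.
- move=> a y y'; rewrite -ch_proj_scale /ch_X /ch_proj -raddfD.
  exact/ch_projP/RelXlin.
- rewrite -(rmorph1 (ring_proj _)); exact/ch_projP/RelT1.
- move=> g h Gg Gh; rewrite /ch_T /ch_proj -rmorphM; symmetry.
  exact/ch_projP/RelTM.
- move=> g y Gg; rewrite /ch_T /ch_Y /ch_proj -!rmorphM.
  exact/ch_projP/RelTY.
- move=> g y Gg; rewrite /ch_T /ch_X /ch_proj -!rmorphM.
  exact/ch_projP/RelTX.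
- move=> x x'; rewrite /ch_X /ch_proj -!rmorphM; exact/ch_projP/RelXX.
- move=> x x'; rewrite /ch_Y /ch_proj -!rmorphM; exact/ch_projP/RelYY.
- move=> y x; rewrite /ch_X /ch_Y /ch_proj -!rmorphM -raddfB.
  apply: etrans (ch_projP (RelYX rG alpha alphav c phi t y x)) _.
  by rewrite ch_proj_subsum; congr (_ - _); apply: eq_bigr => s _; rewrite ch_proj_scale.
- by move=> *; apply: ch_scalC.
- by move=> *; apply: ch_scalC.
- by move=> *; apply: ch_scalC.
Qed.

Section Lift.
Variables (B : pzRingType) (sc : {rmorphism k -> B}).
Variables (fY : 'rV[F]_n -> B) (fX : 'cV[F]_n -> B) (fT : gT -> B).
Hypothesis actB : ch_action sc fY fX fT.

Definition gen_map (i : cherednik_gen F G n) : B :=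
  match i with inl (inl y) => fY y | inl (inr x) => fX x | inr g => fT (sgval g) end.

Lemma free_lift_rel x : cherednik_rel rG alpha alphav c phi t x -> free_ext sc gen_map x = 0.
Proof.
have cfv a i : sc a * gen_map i = gen_map i * sc a.
  case: i => [[y|z]|g] /=; [exact: (ca_scY actB) | exact: (ca_scX actB) |].
  exact/(ca_scT actB)/subgP.
have [M1 MM] := free_ext_is_monoid_morphism cfv.
have mZ := free_extZ cfv.
have mB a b : free_ext sc gen_map (a - b) = free_ext sc gen_map a - free_ext sc gen_map b.
  by rewrite raddfB.
have mD a b : free_ext sc gen_map (a + b) = free_ext sc gen_map a + free_ext sc gen_map b.
  by rewrite raddfD.
have mS (A : {set gT}) (f : gT -> Free) :
    free_ext sc gen_map (\sum_(s in A) f s) = \sum_(s in A) free_ext sc gen_map (f s).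
  exact: raddf_sum.
have mT g : g \in G -> sgval (subg G g) = g by move=> Gg; rewrite subgK.
have mG i : free_ext sc gen_map << fmu i >> = gen_map i by apply: free_ext_gen.
have mGG i j : free_ext sc gen_map (<< fmu i >> * << fmu j >>) = gen_map i * gen_map j.
  by rewrite MM !mG.
move: (free_ext sc gen_map) mB mD mS mG mZ M1 mGG => fe mB mD mS mG mZ M1 mGG.
have mBE a b : fe a = fe b -> fe (a - b) = 0 by rewrite mB => ->; rewrite subrr.
case=> [a y y'|a y y'||g h Gg Gh|g y Gg|g y Gg|y y'|y y'|y z].
- by rewrite mB mD mZ !mG /= (ca_Yl actB) subrr.
- by rewrite mB mD mZ !mG /= (ca_Xl actB) subrr.
- by rewrite mB M1 mG /= mT // (ca_T1 actB) subrr.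
- by rewrite mB mGG mG /= !mT ?groupM // (ca_TM actB) // subrr.
- by apply: mBE; do 2?[apply: etrans (mGG _ _) (esym _)]; rewrite /gen_map mT // (ca_TY actB) //.
- by apply: mBE; do 2?[apply: etrans (mGG _ _) (esym _)]; rewrite /gen_map mT // (ca_TX actB) //.
- by apply: mBE; do 2?[apply: etrans (mGG _ _) (esym _)]; rewrite /gen_map (ca_XX actB).
- by apply: mBE; do 2?[apply: etrans (mGG _ _) (esym _)]; rewrite /gen_map (ca_YY actB).
- apply: mBE; apply: etrans (mB _ _) _.
  apply: etrans (congr2 (fun u v => u - v) (mGG _ _) (mGG _ _)) _.
  rewrite /gen_map (ca_YX actB); apply: esym; apply: etrans (mB _ _) _; congr (_ - _).
    by apply: etrans (mZ _ _) _; rewrite M1 mulr1.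
  apply: etrans (mS _ _) _; apply: eq_bigr => s; rewrite inE => /andP[Gs _].
  by apply: etrans (mZ _ _) _; rewrite mG /gen_map mT.
Qed.

(** A chosen representative is evaluated in the free algebra; the choice is harmless because
    [free_lift_rel] kills the relations. *)
Definition ch_lift (h : H) : B := free_ext sc gen_map (repr h).

Lemma ch_liftE x : ch_lift (proj x) = free_ext sc gen_map x.
Proof.
have cfv a i : sc a * gen_map i = gen_map i * sc a.
  case: i => [[y|z]|g] /=; [exact: (ca_scY actB) | exact: (ca_scX actB) |].
  exact/(ca_scT actB)/subgP.
have [M1 MM] := free_ext_is_monoid_morphism cfv.
apply/eqP; rewrite -subr_eq0 /ch_lift -raddfB /=.
have : ideal_gen (cherednik_rel rG alpha alphav c phi t) (repr (proj x) - x).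
  by apply/ring_projP; rewrite /ch_proj /ring_proj reprK.
elim=> [|a s b y Ss _ IH]; first by rewrite raddf0.
by rewrite raddfD /= !MM (free_lift_rel Ss) mulr0 mul0r add0r.
Qed.

Fact ch_lift_is_zmod_morphism : zmod_morphism ch_lift.
Proof.
move=> a b; have [x ->] := ring_proj_surj a; have [y ->] := ring_proj_surj b.
by rewrite -raddfB !ch_liftE raddfB.
Qed.
Fact ch_lift_is_monoid_morphism : monoid_morphism ch_lift.
Proof.
have cfv a i : sc a * gen_map i = gen_map i * sc a.
  case: i => [[y|z]|g] /=; [exact: (ca_scY actB) | exact: (ca_scX actB) |].
  exact/(ca_scT actB)/subgP.
have [M1 MM] := free_ext_is_monoid_morphism cfv.
split=> [|a b]; first by rewrite -(rmorph1 (ring_proj _)) ch_liftE.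
have [x ->] := ring_proj_surj a; have [y ->] := ring_proj_surj b.
by rewrite -rmorphM !ch_liftE MM.
Qed.

Lemma ch_lift_exists : exists f : {rmorphism H -> B},
  [/\ forall a, f (scal a) = sc a, forall y, f (hY y) = fY y,
      forall x, f (hX x) = fX x & forall g, g \in G -> f (hT g) = fT g].
Proof.
pose m1 := GRing.isZmodMorphism.Build H B ch_lift ch_lift_is_zmod_morphism.
pose m2 := GRing.isMonoidMorphism.Build H B ch_lift ch_lift_is_monoid_morphism.
pose f : {rmorphism H -> B} := HB.pack ch_lift m1 m2.
have cfv a i : sc a * gen_map i = gen_map i * sc a.
  case: i => [[y|z]|g] /=; [exact: (ca_scY actB) | exact: (ca_scX actB) |].
  exact/(ca_scT actB)/subgP.
exists f; split=> [a|y|x|g Gg] /=; rewrite ch_liftE ?free_ext_gen //.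
  by rewrite free_extZ // (free_ext_is_monoid_morphism cfv).1 mulr1.
by rewrite /= subgK.
Qed.

End Lift.

End Action.

(** * The Dunkl representation *)

Section Endomorphisms.
Variable V : zmodType.

(** Only additivity is imposed: scalars enter as the operators [opS], and the universal property is
    applied with this bare ring as target. *)
Record endo := Endo { endo_fun :> V -> V; endo_additive : zmod_morphism endo_fun }.

Lemma endoP (f g : endo) : f =1 g -> f = g.
Proof.
case: f g => f fB [g gB] /= /funext e; rewrite e in fB *.
by congr Endo; apply: Prop_irrelevance.
Qed.

HB.instance Definition _ := gen_eqMixin endo.
HB.instance Definition _ := gen_choiceMixin endo.

Lemma endoB (f : endo) u v : f (u - v) = f u - f v.
Proof. exact: endo_additive. Qed.
Lemma endo0 (f : endo) : f 0 = 0.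
Proof. by have := endoB f 0 0; rewrite !subrr. Qed.
Lemma endoN (f : endo) u : f (- u) = - f u.
Proof. by rewrite -(sub0r u) endoB endo0 sub0r. Qed.
Lemma endoD (f : endo) u v : f (u + v) = f u + f v.
Proof. by rewrite -[v in LHS]opprK endoB endoN opprK. Qed.

Fact endo_zero_subproof : zmod_morphism (fun _ : V => 0 : V).
Proof. by move=> u v; rewrite subrr. Qed.
Fact endo_add_subproof (f g : endo) : zmod_morphism (fun v => f v + g v).
Proof. by move=> u v; rewrite /= !endoB opprD addrACA. Qed.
Fact endo_opp_subproof (f : endo) : zmod_morphism (fun v => - f v).
Proof. by move=> u v /=; rewrite endoB opprD. Qed.
Fact endo_one_subproof : zmod_morphism (@id V).
Proof. by []. Qed.
Fact endo_mul_subproof (f g : endo) : zmod_morphism (fun v => f (g v)).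
Proof. by move=> u v /=; rewrite !endoB. Qed.

Definition endo_zero := Endo endo_zero_subproof.
Definition endo_add f g := Endo (endo_add_subproof f g).
Definition endo_opp f := Endo (endo_opp_subproof f).
Definition endo_one := Endo endo_one_subproof.
Definition endo_mul f g := Endo (endo_mul_subproof f g).

Fact endo_addA : associative endo_add.
Proof. by move=> f g h; apply: endoP => v /=; rewrite addrA. Qed.
Fact endo_addC : commutative endo_add.
Proof. by move=> f g; apply: endoP => v /=; rewrite addrC. Qed.
Fact endo_add0 : left_id endo_zero endo_add.
Proof. by move=> f; apply: endoP => v /=; rewrite add0r. Qed.
Fact endo_addN : left_inverse endo_zero endo_opp endo_add.
Proof. by move=> f; apply: endoP => v /=; rewrite addNr. Qed.
HB.instance Definition _ := GRing.isZmodule.Build endo endo_addA endo_addC endo_add0 endo_addN.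

Fact endo_mulA : associative endo_mul.
Proof. by move=> f g h; apply: endoP. Qed.
Fact endo_mul1 : left_id endo_one endo_mul.
Proof. by move=> f; apply: endoP. Qed.
Fact endo_mulr1 : right_id endo_one endo_mul.
Proof. by move=> f; apply: endoP. Qed.
Fact endo_mulDl : left_distributive endo_mul endo_add.
Proof. by move=> f g h; apply: endoP. Qed.
Fact endo_mulDr : right_distributive endo_mul endo_add.
Proof. by move=> f g h; apply: endoP => v /=; rewrite endoD. Qed.
HB.instance Definition _ :=
  GRing.Zmodule_isPzRing.Build endo endo_mulA endo_mul1 endo_mulr1 endo_mulDl endo_mulDr.

Lemma endoDE (f g : endo) v : (f + g) v = f v + g v. Proof. by []. Qed.
Lemma endoBE (f g : endo) v : (f - g) v = f v - g v. Proof. by []. Qed.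
Lemma endoME (f g : endo) v : (f * g) v = f (g v). Proof. by []. Qed.
Lemma endo_sumE (I : Type) (r : seq I) (P : pred I) (f : I -> endo) v :
  (\sum_(i <- r | P i) f i) v = \sum_(i <- r | P i) f i v.
Proof. by apply: (big_morph (fun f : endo => f v)). Qed.

End Endomorphisms.

(** * Polynomials on h and its dual: linear forms, substitutions, derivatives *)

Section PhaseSpace.
Variables (F : fieldType) (k : comNzRingType) (phi : {rmorphism F -> k}) (n : nat).

(* The coordinates on h come first, those on the dual of h last. *)
Local Notation P := (mpoly (n + n) k).

Definition LX (x : 'cV[F]_n) : P := \sum_i phi (x i 0) *: 'X_(lshift n i).
Definition LY (y : 'rV[F]_n) : P := \sum_i phi (y 0 i) *: 'X_(rshift n i).

Lemma LX_lin a x x' : LX (a *: x + x') = phi a *: LX x + LX x'.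
Proof.
rewrite /LX scaler_sumr -big_split; apply: eq_bigr => i _ /=.
by rewrite !mxE rmorphD rmorphM scalerDl scalerA.
Qed.

Lemma LY_lin a x x' : LY (a *: x + x') = phi a *: LY x + LY x'.
Proof.
rewrite /LY scaler_sumr -big_split; apply: eq_bigr => i _ /=.
by rewrite !mxE rmorphD rmorphM scalerDl scalerA.
Qed.

Lemma LX_delta i : LX (delta_mx i 0) = 'X_(lshift n i).
Proof.
rewrite /LX (bigD1 i) //= mxE !eqxx rmorph1 scale1r big1 ?addr0 // => j ji.
by rewrite mxE (negPf ji) rmorph0 scale0r.
Qed.

Lemma LY_delta i : LY (delta_mx 0 i) = 'X_(rshift n i).
Proof.
rewrite /LY (bigD1 i) //= mxE !eqxx rmorph1 scale1r big1 ?addr0 // => j ji.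
by rewrite mxE (negPf ji) rmorph0 scale0r.
Qed.

Lemma LXD x x' : LX (x + x') = LX x + LX x'.
Proof. by rewrite -[x in LHS]scale1r LX_lin rmorph1 scale1r. Qed.
Lemma LX0 : LX 0 = 0.
Proof. by rewrite /LX big1 // => i _; rewrite mxE rmorph0 scale0r. Qed.
Lemma LXZ a x : LX (a *: x) = phi a *: LX x.
Proof. by rewrite -[_ *: x]addr0 LX_lin LX0 addr0. Qed.
Lemma LX_sum (I : Type) (r : seq I) (Q : pred I) f :
  LX (\sum_(i <- r | Q i) f i) = \sum_(i <- r | Q i) LX (f i).
Proof. exact: (big_morph LX LXD LX0). Qed.
Lemma LYD x x' : LY (x + x') = LY x + LY x'.
Proof. by rewrite -[x in LHS]scale1r LY_lin rmorph1 scale1r. Qed.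
Lemma LY0 : LY 0 = 0.
Proof. by rewrite /LY big1 // => i _; rewrite mxE rmorph0 scale0r. Qed.
Lemma LYZ a x : LY (a *: x) = phi a *: LY x.
Proof. by rewrite -[_ *: x]addr0 LY_lin LY0 addr0. Qed.

Lemma mpoly_ind (N : nat) (R : comNzRingType) (Q : mpoly N R -> Prop) :
  (forall a, Q a%:MP) -> (forall p q, Q p -> Q q -> Q (p + q)) ->
  (forall i p, Q p -> Q ('X_i * p)) -> forall p, Q p.
Proof.
move=> QC QD QX p; rewrite (mpolyE p); elim/big_ind: _ => [|//|m _].
  by rewrite -(mpolyC0 N R).
move: (p@_m) => a; move: {2}(mdeg m) (leqnn (mdeg m)) => d.
elim: d m => [|d IHd] m.
  by rewrite leqn0 mdeg_eq0 => /eqP->; rewrite mpolyX0 -mul_mpolyC mulr1.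
have [/eqP|m_neq0] := posnP (mdeg m).
  by rewrite mdeg_eq0 => /eqP-> _; rewrite mpolyX0 -mul_mpolyC mulr1.
have [i mi] : exists i, (0 < m i)%N.
  case: (pickP (fun i => 0 < m i)%N) => [i mi|z]; first by exists i.
  by move: m_neq0; rewrite mdegE big1 // => i _; apply/eqP; rewrite -leqn0 leqNgt z.
have -> : m = (U_(i) + (m - U_(i)))%MM.
  by rewrite addmC submK //; apply/mnm_lepP => j; rewrite mnm1E; case: eqP => // <-.
rewrite mdegD mdeg1 add1n ltnS => /IHd; rewrite mpolyXD scalerAr; exact: QX.
Qed.

Inductive Yonly : P -> Prop :=
| YonlyC a : Yonly a%:MP
| YonlyD p q : Yonly p -> Yonly q -> Yonly (p + q)
| YonlyM i p : Yonly p -> Yonly ('X_(rshift n i) * p).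

(** The two kinds of variables are separated because the Dunkl operators for Y act by plain
    multiplication on polynomials in Y alone, whereas they pass each X by a commutation rule. *)
Lemma phase_ind2 (Q : P -> Prop) :
  (forall p, Yonly p -> Q p) -> (forall p q, Q p -> Q q -> Q (p + q)) ->
  (forall i p, Q p -> Q ('X_(lshift n i) * p)) -> forall p, Q p.
Proof.
move=> QY QD QX p.
(* The statement is strengthened by a factor in Y alone, in which the Y variables met during the
   induction are collected. *)
pose Qc (r : P) := forall q, Yonly q -> Q (r * q).
suff: Qc p by move/(_ 1 (YonlyC _)); rewrite mulr1.
elim/mpoly_ind: p => [a|p q Qp Qq|i p Qp] r Yr.
- apply: QY; elim: Yr => [b|p q _ IHp _ IHq|i p _ IHp].
  + by rewrite -mpolyCM; apply: YonlyC.
  + by rewrite mulrDr; apply: YonlyD.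
  + by rewrite mulrCA; apply: YonlyM.
- by rewrite mulrDl; apply: QD; [apply: Qp | apply: Qq].
- case: (split_ordP i) => j ->; first by rewrite -mulrA; apply/QX/Qp.
  by rewrite mulrAC mulrC; apply: Qp; apply: YonlyM.
Qed.

Lemma phase_ind (Q : P -> Prop) :
  (forall a, Q a%:MP) -> (forall p q, Q p -> Q q -> Q (p + q)) ->
  (forall x p, Q p -> Q (LX x * p)) -> (forall y p, Q p -> Q (LY y * p)) ->
  forall p, Q p.
Proof.
move=> QC QD QX QY; apply: mpoly_ind => // i p Qp.
by case: (split_ordP i) => j ->; rewrite -?LX_delta -?LY_delta; [apply: QX|apply: QY].
Qed.

Definition psub_var (A B : 'M[F]_n) (i : 'I_(n + n)) : P :=
  match split i with inl j => LX (col j A) | inr j => LY (row j B) end.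

Fact psub_subproof (A B : 'M[F]_n) : {f : {rmorphism P -> P} |
  [/\ forall a, f a%:MP = a%:MP, forall x, f (LX x) = LX (A *m x)
    & forall y, f (LY y) = LY (y *m B)]}.
Proof.
pose f : {rmorphism P -> P} := mpoly.mmap (@mpolyC _ k) (psub_var A B).
have fC a : f a%:MP = a%:MP by apply: mmapC.
have fZ a p : f (a *: p) = a *: f p by rewrite -!mul_mpolyC rmorphM fC.
have fV i : f 'X_i = psub_var A B i by rewrite /f /= mmapX mmap1U.
exists f; split=> // [x|y].
  have -> : A *m x = \sum_i x i 0 *: col i A.
    apply/colP => i; rewrite mxE summxE; apply: eq_bigr => j _.
    by rewrite !mxE mulrC.
  rewrite LX_sum (rmorph_sum f); apply: eq_bigr => i _.
  rewrite fZ LXZ fV /psub_var; case: split_ordP => j e; first by rewrite (lshift_inj e).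
  by have := @eq_lrshift n n i j; rewrite e eqxx.
have -> : y *m B = \sum_i y 0 i *: row i B.
  by apply/rowP => i; rewrite mxE summxE; apply: eq_bigr => j _; rewrite !mxE.
rewrite (big_morph LY LYD LY0) (rmorph_sum f); apply: eq_bigr => i _.
rewrite fZ LYZ fV /psub_var; case: split_ordP => j e; last by rewrite (rshift_inj e).
by have := @eq_rlshift n n i j; rewrite e eqxx.
Qed.

Definition psub (A B : 'M[F]_n) : {rmorphism P -> P} := sval (psub_subproof A B).

Lemma psubC A B a : psub A B a%:MP = a%:MP.
Proof. by case: (svalP (psub_subproof A B)). Qed.
Lemma psubX A B x : psub A B (LX x) = LX (A *m x).
Proof. by case: (svalP (psub_subproof A B)). Qed.
Lemma psubY A B y : psub A B (LY y) = LY (y *m B).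
Proof. by case: (svalP (psub_subproof A B)). Qed.

Lemma psubD A B p q : psub A B (p + q) = psub A B p + psub A B q.
Proof. exact: rmorphD. Qed.
Lemma psubM A B p q : psub A B (p * q) = psub A B p * psub A B q.
Proof. exact: rmorphM. Qed.
Lemma psubB A B p q : psub A B (p - q) = psub A B p - psub A B q.
Proof. exact: rmorphB. Qed.
Lemma psub0 A B : psub A B 0 = 0.
Proof. exact: rmorph0. Qed.

Lemma psub_sum A B (I : Type) (r : seq I) (Q : pred I) f :
  psub A B (\sum_(i <- r | Q i) f i) = \sum_(i <- r | Q i) psub A B (f i).
Proof. exact: rmorph_sum. Qed.

Lemma psub_comp A B A' B' p : psub A B (psub A' B' p) = psub (A *m A') (B' *m B) p.
Proof.
elim/phase_ind: p => [a|p q ep eq|x p ep|y p ep].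
- by rewrite !psubC.
- by rewrite !psubD ep eq.
- by rewrite !psubM !psubX ep mulmxA.
- by rewrite !psubM !psubY ep mulmxA.
Qed.

Lemma psub_id p : psub 1%:M 1%:M p = p.
Proof.
elim/phase_ind: p => [a|p q ep eq|x p ep|y p ep].
- by rewrite !psubC.
- by rewrite !psubD ep eq.
- by rewrite !psubM !psubX ep mul1mx.
- by rewrite !psubM !psubY ep mulmx1.
Qed.

Definition dX (y : 'rV[F]_n) (p : P) : P := \sum_i phi (y 0 i) *: p^`M(lshift n i).

Lemma dXD y p q : dX y (p + q) = dX y p + dX y q.
Proof.
by rewrite /dX -big_split; apply: eq_bigr => i _; rewrite mderivD scalerDr.
Qed.

Lemma dX_lin a y y' p : dX (a *: y + y') p = phi a *: dX y p + dX y' p.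
Proof.
rewrite /dX scaler_sumr -big_split; apply: eq_bigr => i _ /=.
by rewrite !mxE rmorphD rmorphM scalerDl scalerA.
Qed.

Lemma dXC y a : dX y a%:MP = 0.
Proof. by rewrite /dX big1 // => i _; rewrite mderivC scaler0. Qed.

Lemma dXM y p q : dX y (p * q) = dX y p * q + p * dX y q.
Proof.
rewrite /dX mulr_suml mulr_sumr -big_split; apply: eq_bigr => i _ /=.
by rewrite mderivM scalerDr scalerAl scalerAr.
Qed.

Lemma dXZ y a p : dX y (a *: p) = a *: dX y p.
Proof. by rewrite -!mul_mpolyC dXM dXC mul0r add0r. Qed.

Lemma dXB y p q : dX y (p - q) = dX y p - dX y q.
Proof. by rewrite dXD -scaleN1r dXZ scaleN1r. Qed.

Lemma dX_var y i : dX y 'X_(lshift n i) = (phi (y 0 i))%:MP.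
Proof.
rewrite /dX (bigD1 i) //= big1 ?addr0 => [|j ji].
  have -> : (U_(lshift n i) = 0 + U_(lshift n i))%MM by rewrite add0m.
  by rewrite mderivX mnmDE mnm0E mnm1E eqxx addmK mpolyX0 scale1r -mul_mpolyC mulr1.
rewrite mderivX mnm1E (inj_eq (@lshift_inj _ _)) eq_sym (negPf ji).
by rewrite scale0r scaler0.
Qed.

Lemma dX_LX y x : dX y (LX x) = (phi (pairing y x))%:MP.
Proof.
rewrite /LX; rewrite (big_morph (dX y) (dXD y) (_ : dX y 0 = 0)); last first.
  by rewrite -mpolyC0 dXC.
rewrite /pairing mxE rmorph_sum (rmorph_sum (@mpolyC _ k)).
by apply: eq_bigr => i _; rewrite dXZ dX_var -mul_mpolyC -mpolyCM rmorphM mulrC.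
Qed.

Lemma dX_LY y z : dX y (LY z) = 0.
Proof.
rewrite /LY (big_morph (dX y) (dXD y) (_ : dX y 0 = 0)); last first.
  by rewrite -mpolyC0 dXC.
rewrite big1 // => i _; rewrite dXZ /dX big1 ?scaler0 // => j _.
by rewrite mderivX mnm1E eq_rlshift scale0r scaler0.
Qed.

Lemma psub_dX A B y p : B *m A = 1%:M -> psub A B (dX y p) = dX (y *m B) (psub A B p).
Proof.
move=> BA; elim/phase_ind: p => [a|p q ep eq|x p ep|z p ep].
- by rewrite psubC !dXC psub0.
- by rewrite !(psubD, dXD) ep eq.
- rewrite !(dXM, psubD, psubM, psubX, dX_LX, psubC) ep; congr (_%:MP * _ + _).
  by rewrite /pairing mulmxA -(mulmxA y) BA mulmx1.
- by rewrite !(dXM, psubD, psubM, psubY, dX_LY, psub0, mul0r, add0r) ep.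
Qed.

Lemma dX_Yonly y p : Yonly p -> dX y p = 0.
Proof.
elim=> [a|q r _ eq _ er|i q _ eq]; first exact: dXC.
  by rewrite dXD eq er addr0.
by rewrite dXM -LY_delta dX_LY eq mul0r mulr0 addr0.
Qed.

Lemma YonlyMC a p : Yonly p -> Yonly (a%:MP * p).
Proof.
elim=> [b|q r _ Yq _ Yr|i q _ Yq]; first by rewrite -mpolyCM; apply: YonlyC.
  by rewrite mulrDr; apply: YonlyD.
by rewrite mulrCA; apply: YonlyM.
Qed.

Lemma Yonly0 : Yonly 0.
Proof. by rewrite -(mpolyC0 _ k); apply: YonlyC. Qed.

Lemma YonlyM_LY y p : Yonly p -> Yonly (LY y * p).
Proof.
move=> Yp; rewrite /LY mulr_suml; elim/big_ind: _ => [|q r|i _]; first exact: Yonly0.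
  exact: YonlyD.
by rewrite -scalerAl -mul_mpolyC; apply/YonlyMC/YonlyM.
Qed.

Lemma psub_Yonly A B p : Yonly p -> psub A B p = psub 1%:M B p.
Proof.
elim=> [a|q r _ eq _ er|i q _ eq]; first by rewrite !psubC.
  by rewrite !psubD eq er.
by rewrite !psubM eq -LY_delta !psubY.
Qed.

End PhaseSpace.

(** * Roots and coroots of reflections, and their conjugates *)

Section Roots.
Variables (F : fieldType) (gT : finGroupType) (G : {group gT}) (n : nat).
Variable rG : mx_representation F G n.
Hypothesis two_neq0 : 2 != 0 :> F.

Lemma pairing_mulmx (y : 'rV[F]_n) (a : 'cV[F]_n) (b : 'rV[F]_n) (x : 'cV[F]_n) :
  pairing y a * pairing b x = (y *m (a *m b) *m x) 0 0.
Proof.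
rewrite /pairing mulmxA -mulmxA [X in _ = X]mxE big_ord1 //.
Qed.

(** The column space of s - 1 is spanned by a, so s - 1 = a D^T. Then s^-1 - 1 = -(s^-1 a) D^T, and
    comparison with its row space shows that D^T is a nonzero multiple of av. *)
Lemma root_coroot_reflection s (a : 'cV[F]_n) (av : 'rV[F]_n) :
  s \in G -> root_coroot rG s a av ->
  exists2 kappa, kappa != 0 & rG s = 1%:M + kappa *: (a *m av).
Proof.
move=> Gs [/andP[_ /submxP[D eD]] /andP[/submxP[u eu] _] pa].
have eD' : rG s - 1%:M = a *m D^T by rewrite -[LHS]trmxK eD trmx_mul trmxK.
have eV : rG s^-1%g - 1%:M = - (rG s^-1%g *m a) *m D^T.
  by rewrite mulNmx -mulmxA -eD' mulmxBr mulmx1 -repr_mxM ?groupV // mulVg repr_mx1 opprB.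
have av_neq0 : av != 0.
  by apply: contra_neq two_neq0 => e; rewrite -pa e /pairing mul0mx mxE.
move: eu; rewrite eV mulmxA; set l := u *m _ => eu.
have el : l = (l 0 0)%:M by rewrite [LHS]mx11_scalar.
rewrite el mul_scalar_mx in eu.
have l0 : l 0 0 != 0 by apply: contra_neq av_neq0 => e; rewrite eu e scale0r.
exists (l 0 0)^-1; first by rewrite invr_eq0.
by rewrite eu -scalemxAr scalerA mulVf // scale1r -eD' addrC subrK.
Qed.

(** For a reflection this is (zeta - 1) / 2 with zeta the nontrivial eigenvalue; written as a trace,
    it is visibly invariant under conjugation. *)
Definition root_factor (s : gT) : F := \tr (rG s - 1%:M) / 2.

Lemma root_factorE s (a : 'cV[F]_n) (av : 'rV[F]_n) :
  s \in G -> root_coroot rG s a av ->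
  root_factor s != 0 /\ rG s = 1%:M + root_factor s *: (a *m av).
Proof.
move=> Gs ra; have [_ _ pa] := ra.
have [kp kp0 e] := root_coroot_reflection Gs ra.
suff -> : root_factor s = kp by [].
rewrite /root_factor e addrC addKr mxtraceZ mxtrace_mulC.
by rewrite /mxtrace big_ord1 -/(pairing av a) pa mulfK.
Qed.

Lemma root_factorJ s g : s \in G -> g \in G -> root_factor (s ^ g)%g = root_factor s.
Proof.
move=> Gs Gg; rewrite /root_factor; congr (_ / _); rewrite !raddfB /=; congr (_ - _).
by rewrite conjgE !repr_mxM ?groupM ?groupV // mxtrace_mulC -mulmxA -repr_mxM ?groupV // mulgV repr_mx1 mulmx1.
Qed.

(* The matrix a *m av of a reflection s is determined by s, unlike a and av. *)
Lemma root_matrixJ s g (a b : 'cV[F]_n) (av bv : 'rV[F]_n) : s \in G -> g \in G ->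
  root_coroot rG s a av -> root_coroot rG (s ^ g)%g b bv ->
  b *m bv = rG g^-1%g *m (a *m av) *m rG g.
Proof.
move=> Gs Gg ra rb; have [k0 ea] := root_factorE Gs ra.
have [_ eb] := root_factorE (groupJ Gs Gg) rb.
rewrite root_factorJ // in eb.
have: rG (s ^ g)%g = rG g^-1%g *m rG s *m rG g.
  by rewrite conjgE !repr_mxM ?groupM ?groupV // mulmxA.
rewrite eb {1}ea mulmxDr mulmxDl mulmx1 -repr_mxM ?groupV // mulVg repr_mx1.
move/addrI; rewrite -scalemxAr -scalemxAl; exact: scalerI.
Qed.

(** The vector g^-1 a is an eigenvector, for the eigenvalue 2, of the rank one matrix [b *m bv],
    whose image is spanned by b. *)
Lemma rootJ s g (a b : 'cV[F]_n) (av bv : 'rV[F]_n) : s \in G -> g \in G ->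
  root_coroot rG s a av -> root_coroot rG (s ^ g)%g b bv ->
  exists l, rG g^-1%g *m a = l *: b.
Proof.
move=> Gs Gg ra rb; have [_ _ pa] := ra.
have e := root_matrixJ Gs Gg ra rb.
have: b *m bv *m (rG g^-1%g *m a) = 2 *: (rG g^-1%g *m a).
  rewrite e -!mulmxA (mulmxA (rG g)) -repr_mxM ?groupV // mulgV repr_mx1 mul1mx.
  by rewrite [av *m a]mx11_scalar -/(pairing av a) pa mul_mx_scalar scalemxAr.
rewrite -mulmxA [bv *m _]mx11_scalar mul_mx_scalar => e2.
exists (2^-1 * (bv *m (rG g^-1%g *m a)) 0 0).
by rewrite -scalerA e2 scalerA mulVf // scale1r.
Qed.

Lemma reflection_rankJ s g : s \in G -> g \in G ->
  \rank (kermx (1%:M - rG (s ^ g)^-1%g)) = \rank (kermx (1%:M - rG s^-1%g)).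
Proof.
move=> Gs Gg; rewrite !mxrank_ker; congr (_ - _)%N.
have -> : 1%:M - rG (s ^ g)^-1%g = rG g^-1%g *m (1%:M - rG s^-1%g) *m rG g.
  rewrite mulmxBr mulmxBl mulmx1 -repr_mxM ?groupV // mulVg repr_mx1 -conjVg conjgE.
  by rewrite !repr_mxM ?groupM ?groupV // mulmxA.
rewrite mxrankMfree ?row_free_unit ?repr_mx_unit //.
by rewrite eqmxMfull // row_full_unit repr_mx_unit ?groupV.
Qed.

Lemma reflectionsJ s g : s \in reflections rG -> g \in G -> (s ^ g)%g \in reflections rG.
Proof.
rewrite !inE => /andP[Gs rs] Gg; rewrite groupJ //= reflection_rankJ //.
Qed.

End Roots.

(** * Divided differences and Dunkl operators *)

Section Dunkl.
Variables (F : fieldType) (gT : finGroupType) (G : {group gT}) (n : nat).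
Variable rG : mx_representation F G n.
Variables (alpha : gT -> 'cV[F]_n) (alphav : gT -> 'rV[F]_n) (c : gT -> F).
Variables (k : idomainType) (phi : {rmorphism F -> k}) (t : k).
Hypothesis two_neq0 : 2 != 0 :> F.
Hypothesis rootP : forall s, s \in reflections rG -> root_coroot rG s (alpha s) (alphav s).
Hypothesis cJ : forall s g, s \in reflections rG -> g \in G -> c (s ^ g)%g = c s.

Local Notation P := (mpoly (n + n) k).
Local Notation LX := (LX phi).
Local Notation LY := (LY phi).
Local Notation dX := (dX phi).
Local Notation psub := (psub phi).

Definition gsub (g : gT) := psub (rG g) (rG g^-1%g).
Definition ysub (g : gT) := psub 1%:M (rG g^-1%g).
(** The numerator vanishes where alpha s = 0, since s moves a linear form in X by a multiple of
    alpha s. The factor [root_factor] is chosen so that the quotient for a linear form x is the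
    pairing of the coroot with x. *)
Definition dem_spec s p q : Prop :=
  (phi (root_factor rG s))%:MP * LX (alpha s) * q = gsub s p - ysub s p.

Let refG s : s \in reflections rG -> s \in G.
Proof. by rewrite inE => /andP[]. Qed.

Lemma LX_eq0 (x : 'cV[F]_n) : LX x = 0 -> x = 0.
Proof.
move=> e; apply/colP => i; rewrite mxE; apply/eqP; rewrite -(fmorph_eq0 phi).
have := congr1 (mcoeff U_(lshift n i)) e; rewrite mcoeff0 /LX raddf_sum /=.
rewrite (bigD1 i) //= mcoeffZ mcoeffXU eqxx mulr1 big1 ?addr0 => [->//|j ji].
by rewrite mcoeffZ mcoeffXU (inj_eq (@lshift_inj _ _)) (negPf ji) mulr0.
Qed.

Lemma alpha_neq0 s : s \in reflections rG -> alpha s != 0.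
Proof.
move=> /rootP [_ _ pa]; apply: contra_neq two_neq0 => e.
by rewrite -pa e /pairing mulmx0 mxE.
Qed.

Lemma gsub_LX s x : s \in reflections rG ->
  gsub s (LX x) = LX x + (phi (root_factor rG s * pairing (alphav s) x))%:MP * LX (alpha s).
Proof.
move=> Rs; have [_ e] := root_factorE two_neq0 (refG Rs) (rootP Rs).
rewrite /gsub psubX e mulmxDl mul1mx LXD; congr (_ + _).
rewrite -scalemxAl -mulmxA [alphav s *m x]mx11_scalar mul_mx_scalar scalerA LXZ.
by rewrite mul_mpolyC.
Qed.

Lemma dem_ex s p : s \in reflections rG -> exists q, dem_spec s p q.
Proof.
move=> Rs; rewrite /dem_spec.
elim/(@phase_ind _ _ phi): p => [a|p q [p' ep] [q' eq]|x p [q e]|y p [q e]].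
- by exists 0; rewrite mulr0 /gsub /ysub !psubC subrr.
- by exists (p' + q'); rewrite mulrDr ep eq /gsub /ysub !psubD; ring.
- exists (LX x * q + (phi (pairing (alphav s) x))%:MP * gsub s p).
  rewrite mulrDr mulrCA e /gsub /ysub !psubM -/(gsub s p) -/(ysub s p) -/(gsub s (LX x)).
  rewrite gsub_LX // psubX mul1mx mulrBr mulrDl -!addrA; congr (_ + _).
  by rewrite rmorphM rmorphM /= addrC; congr (_ - _); ring.
- exists (LY (y *m rG s^-1%g) * q); rewrite mulrCA e mulrBr.
  by rewrite /gsub /ysub !psubM !psubY.
Qed.

Fact dem_subproof : {f : gT -> P -> P |
  forall s p, s \in reflections rG -> dem_spec s p (f s p)}.
Proof.
apply: cid.
(* The value 0 is a default; for reflections a quotient exists by [dem_ex]. *)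
exists (fun s p => if pselect (exists q, dem_spec s p q) is left e then sval (cid e) else 0).
by move=> s p Rs; case: pselect => [e|[]]; [apply: svalP|apply: dem_ex].
Qed.

(* The divided difference (s - 1) / alpha_s in the coordinates of h, composed
   with the action of s on the coordinates of the dual. *)
Definition dem : gT -> P -> P := sval dem_subproof.

Lemma demP s p : s \in reflections rG ->
  (phi (root_factor rG s))%:MP * LX (alpha s) * dem s p = gsub s p - ysub s p.
Proof. exact: (svalP dem_subproof). Qed.

Lemma demI s q q' : s \in reflections rG ->
  (phi (root_factor rG s))%:MP * LX (alpha s) * q =
  (phi (root_factor rG s))%:MP * LX (alpha s) * q' -> q = q'.
Proof.
move=> Rs; apply: mulfI; rewrite mulf_neq0 ?mpolyC_eq0 ?fmorph_eq0.
- by [].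
- by case: (root_factorE two_neq0 (refG Rs) (rootP Rs)).
- by apply: contra_neq (alpha_neq0 Rs); apply: LX_eq0.
Qed.

Section OneReflection.
Variable s : gT.
Hypothesis Rs : s \in reflections rG.

Lemma demB p q : dem s (p - q) = dem s p - dem s q.
Proof.
apply: (demI Rs); rewrite demP // mulrBr !demP // /gsub /ysub !psubB.
by ring.
Qed.

Lemma demD p q : dem s (p + q) = dem s p + dem s q.
Proof. by apply: (demI Rs); rewrite demP // mulrDr !demP // /gsub /ysub !psubD; ring. Qed.

Lemma dem_Yonly p : Yonly p -> dem s p = 0.
Proof.
by move=> Yp; apply: (demI Rs); rewrite demP // mulr0 /gsub psub_Yonly // subrr.
Qed.

Lemma dem_MP a p : dem s (a%:MP * p) = a%:MP * dem s p.
Proof.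
apply: (demI Rs); rewrite demP // mulrCA demP // mulrBr.
by rewrite /gsub /ysub !psubM !psubC.
Qed.

Lemma dem_LX x p :
  dem s (LX x * p) = LX x * dem s p + (phi (pairing (alphav s) x))%:MP * gsub s p.
Proof.
apply: (demI Rs); rewrite demP // mulrDr mulrCA demP //.
rewrite /gsub /ysub !psubM -!/(gsub _ _) -!/(ysub _ _).
rewrite gsub_LX // /ysub psubX mul1mx !rmorphM /=; ring.
Qed.

Lemma dem_LY y p : dem s (LY y * p) = LY (y *m rG s^-1%g) * dem s p.
Proof.
apply: (demI Rs); rewrite demP // mulrCA demP // mulrBr.
by rewrite /gsub /ysub !psubM !psubY.
Qed.

(** The root of a conjugate is only proportional to the conjugate of the root. The scalar brought in
    by the divided difference cancels against the one in the pairing with y. *)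
Lemma dem_gsub g y p : g \in G ->
  (phi (pairing y (alpha s)))%:MP * gsub g (dem s p) =
  (phi (pairing (y *m rG g^-1%g) (alpha (s ^ g^-1)%g)))%:MP
     * dem (s ^ g^-1)%g (gsub g p).
Proof.
move=> Gg; set s' := (s ^ _)%g.
have Rs' : s' \in reflections rG by rewrite reflectionsJ ?groupV.
have Gs := refG Rs.
have [l el] : exists l, rG g *m alpha s = l *: alpha s'.
  have gV : g^-1%g \in G by rewrite groupV.
  have [l] := rootJ two_neq0 Gs gV (rootP Rs) (rootP Rs').
  by rewrite invgK => el; exists l.
have ey : pairing y (alpha s) = l * pairing (y *m rG g^-1%g) (alpha s').
  have -> : l * pairing (y *m rG g^-1%g) (alpha s') =
    pairing (y *m rG g^-1%g) (l *: alpha s') by rewrite /pairing -scalemxAr [in RHS]mxE.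
  by rewrite -el /pairing mulmxA -(mulmxA y) -repr_mxM ?groupV // mulVg repr_mx1 mulmx1.
rewrite ey (rmorphM phi) mpolyCM -mulrA mulrCA; congr (_ * _).
apply: (demI Rs'); rewrite demP // root_factorJ ?groupV //.
have -> : (phi (root_factor rG s))%:MP * LX (alpha s') * ((phi l)%:MP * gsub g (dem s p))
   = (phi (root_factor rG s))%:MP * LX (rG g *m alpha s) * gsub g (dem s p).
  by rewrite el LXZ -mul_mpolyC; ring.
have := congr1 (gsub g) (demP p Rs); rewrite /gsub !psubM psubC psubX => ->.
have eg : (s' * g = g * s)%g by rewrite /s' conjgE invgK !mulgA mulgKV.
have Gs' := refG Rs'.
rewrite psubB /ysub !psub_comp mulmx1 mul1mx -!repr_mxM ?groupV //.
by rewrite -!invMg eg -[(g * s)%g]eg.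
Qed.

End OneReflection.

Lemma gsubM g h p : g \in G -> h \in G -> gsub (g * h)%g p = gsub g (gsub h p).
Proof.
by move=> Gg Gh; rewrite /gsub psub_comp invMg !repr_mxM ?groupV.
Qed.

Lemma gsub1 p : gsub 1%g p = p.
Proof. by rewrite /gsub invg1 repr_mx1 psub_id. Qed.

(** Functions supported on the group stand for elements of the algebra: [v g] is the coefficient of
    T g, written with every X to the left of every Y. The operators below are left multiplications
    in these coordinates. *)
Definition dunkl_space : zmodType := {ffun gT -> P}.
Local Notation V := dunkl_space.

Definition opS_fun (a : k) (v : V) : V := [ffun g => a%:MP * v g].
Definition opX_fun x (v : V) : V := [ffun g => LX x * v g].
Definition opT_fun h (v : V) : V := [ffun g => gsub h (v (h^-1 * g)%g)].
Definition dunkl_coef (s : gT) (y : 'rV[F]_n) : P :=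
  (phi (c s * pairing y (alpha s)))%:MP.
Definition opY_fun y (v : V) : V := [ffun g => LY y * v g + t%:MP * dX y (v g) -
  \sum_(s in reflections rG) dunkl_coef s y * dem s (v (s^-1 * g)%g)].

Fact opS_additive a : zmod_morphism (opS_fun a).
Proof. by move=> u v; apply/ffunP => g; rewrite !ffunE mulrBr. Qed.
Fact opX_additive x : zmod_morphism (opX_fun x).
Proof. by move=> u v; apply/ffunP => g; rewrite !ffunE mulrBr. Qed.
Fact opT_additive h : zmod_morphism (opT_fun h).
Proof. by move=> u v; apply/ffunP => g; rewrite !ffunE /gsub psubB. Qed.
Fact opY_additive y : zmod_morphism (opY_fun y).
Proof.
move=> u v; apply/ffunP => g; rewrite !ffunE dXB !mulrBr.
rewrite (eq_bigr (fun s => dunkl_coef s y * dem s (u (s^-1 * g)%g)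
   - dunkl_coef s y * dem s (v (s^-1 * g)%g))); last first.
  by move=> s Rs; rewrite !ffunE demB // mulrBr.
by rewrite sumrB; ring.
Qed.

Definition opS a := Endo (opS_additive a).
Definition opX x := Endo (opX_additive x).
Definition opT h := Endo (opT_additive h).
Definition opY y := Endo (opY_additive y).

Lemma opSE a v g : opS a v g = a%:MP * v g. Proof. by rewrite ffunE. Qed.
Lemma opXE x v g : opX x v g = LX x * v g. Proof. by rewrite ffunE. Qed.
Lemma opTE h v g : opT h v g = gsub h (v (h^-1 * g)%g). Proof. by rewrite ffunE. Qed.
Lemma opYE y v g : opY y v g = LY y * v g + t%:MP * dX y (v g) -
  \sum_(s in reflections rG) dunkl_coef s y * dem s (v (s^-1 * g)%g).
Proof. by rewrite ffunE. Qed.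

Fact opS_is_zmod_morphism : zmod_morphism opS.
Proof. by move=> a b; apply: endoP => v; apply/ffunP => g; rewrite endoBE !ffunE mpolyCB mulrBl. Qed.
Fact opS_is_monoid_morphism : monoid_morphism opS.
Proof.
split=> [|a b]; apply: endoP => v; apply/ffunP => g; rewrite ?endoME !opSE ?mul1r //.
by rewrite mpolyCM mulrA.
Qed.
HB.instance Definition _ := GRing.isZmodMorphism.Build k (endo V) opS opS_is_zmod_morphism.
HB.instance Definition _ := GRing.isMonoidMorphism.Build k (endo V) opS opS_is_monoid_morphism.

Lemma sumV (I : Type) (r : seq I) (Q : pred I) (f : I -> V) g :
  (\sum_(i <- r | Q i) f i) g = \sum_(i <- r | Q i) f i g.
Proof. by apply: (big_morph (fun v : V => v g)) => [u v|]; rewrite ffunE. Qed.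

Lemma VDE (u v : V) g : (u + v) g = u g + v g. Proof. by rewrite ffunE. Qed.
Lemma VBE (u v : V) g : (u - v) g = u g - v g. Proof. by rewrite !ffunE. Qed.

Lemma dunkl_Xl a x x' : opX (a *: x + x') = opS (phi a) * opX x + opX x'.
Proof.
apply: endoP => v; apply/ffunP => g.
by rewrite endoDE endoME VDE opSE !opXE LX_lin mulrDl mulrA mul_mpolyC.
Qed.

Lemma dunkl_coef_lin s a y y' :
  dunkl_coef s (a *: y + y') = (phi a)%:MP * dunkl_coef s y + dunkl_coef s y'.
Proof.
rewrite /dunkl_coef -!mpolyCM -mpolyCD -!rmorphM -rmorphD; congr (phi _)%:MP.
by rewrite /pairing mulmxDl -scalemxAl !mxE; ring.
Qed.

Lemma dunkl_Yl a y y' : opY (a *: y + y') = opS (phi a) * opY y + opY y'.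
Proof.
apply: endoP => v; apply/ffunP => g.
rewrite endoDE endoME VDE opSE !opYE LY_lin dX_lin -!mul_mpolyC.
rewrite (eq_bigr (fun s => (phi a)%:MP * (dunkl_coef s y * dem s (v (s^-1 * g)%g))
   + dunkl_coef s y' * dem s (v (s^-1 * g)%g))); last first.
  by move=> s Rs; rewrite dunkl_coef_lin mulrDl mulrA.
by rewrite big_split -mulr_sumr /=; ring.
Qed.

Lemma dunkl_TM g h : g \in G -> h \in G -> opT (g * h)%g = opT g * opT h.
Proof.
move=> Gg Gh; apply: endoP => v; apply/ffunP => x.
by rewrite endoME !opTE gsubM // invMg mulgA.
Qed.

Lemma dunkl_T1 : opT 1%g = 1.
Proof. by apply: endoP => v; apply/ffunP => x; rewrite opTE gsub1 invg1 mul1g. Qed.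

Lemma dunkl_TX g x : g \in G -> opT g * opX x = opX (rG g *m x) * opT g.
Proof.
move=> Gg; apply: endoP => v; apply/ffunP => h.
by rewrite !endoME !(opTE, opXE) /gsub psubM psubX.
Qed.

Lemma dunkl_TY g y : g \in G -> opT g * opY y = opY (y *m rG g^-1%g) * opT g.
Proof.
move=> Gg; apply: endoP => v; apply/ffunP => h.
rewrite !endoME opTE !opYE opTE /gsub psubB psubD !psubM psubY psubC psub_dX; last first.
  by rewrite -repr_mxM ?groupV // mulVg repr_mx1.
congr (_ - _); rewrite psub_sum [RHS](reindex_inj (conjg_inj g^-1%g)) /=.
apply: eq_big => [s|s Rs]; last first.
  rewrite psubM /dunkl_coef psubC cJ ?groupV // !rmorphM -!mulrA -/(gsub g _) dem_gsub //.
  congr (_ * (_ * dem _ _)); rewrite opTE; congr (gsub _ (v _)).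
  by rewrite conjgE !invMg !invgK !mulgA mulVg mul1g.
apply/idP/idP => [Rs|]; first by rewrite reflectionsJ ?groupV.
by move/reflectionsJ => /(_ g Gg); rewrite -conjgM mulVg conjg1.
Qed.

Definition dunkl_bracket y x : endo V := opS (t * phi (pairing y x)) -
    \sum_(s in reflections rG)
       opS (phi (c s * pairing y (alpha s) * pairing (alphav s) x)) * opT s.

Lemma dunkl_YX y x : opY y * opX x - opX x * opY y = dunkl_bracket y x.
Proof.
apply: endoP => v; apply/ffunP => g.
rewrite !endoBE !endoME !VBE opXE !opYE opXE opSE endo_sumE sumV.
rewrite (eq_bigr (fun s => LX x * (dunkl_coef s y * dem s (v (s^-1 * g)%g)) +
   (opS (phi (c s * pairing y (alpha s) * pairing (alphav s) x)) * opT s) v g)).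
  rewrite big_split -mulr_sumr dXM dX_LX mpolyCM /=; ring.
move=> s Rs; rewrite opXE dem_LX // endoME opSE opTE mulrDr /dunkl_coef.
by rewrite [in RHS]rmorphM mpolyCM; ring.
Qed.

Lemma dunkl_scX a x : opS a * opX x = opX x * opS a.
Proof. by apply: endoP => v; apply/ffunP => g; rewrite !endoME !(opSE, opXE) mulrCA. Qed.
Lemma dunkl_scT a g : g \in G -> opS a * opT g = opT g * opS a.
Proof.
by move=> Gg; apply: endoP => v; apply/ffunP => h; rewrite !endoME !(opSE, opTE) /gsub psubM psubC.
Qed.
Lemma dunkl_scY a y : opS a * opY y = opY y * opS a.
Proof.
apply: endoP => v; apply/ffunP => g; rewrite !endoME opSE !opYE opSE.
rewrite [in RHS](eq_bigr (fun s => a%:MP * (dunkl_coef s y * dem s (v (s^-1 * g)%g)))).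
  by rewrite -mulr_sumr dXM dXC; ring.
by move=> s Rs; rewrite opSE dem_MP // mulrCA.
Qed.
Lemma dunkl_XX x x' : opX x * opX x' = opX x' * opX x.
Proof. by apply: endoP => v; apply/ffunP => g; rewrite !endoME !opXE mulrCA. Qed.

(** The vector y s^-1 - y is the pairing of y with alpha s times a vector independent of y; this
    makes [dunkl_residue] symmetric in y and y'. *)
Lemma dunkl_swap s y : s \in reflections rG ->
  opT s * opY y - opY y * opT s =
  opS (phi (pairing y (alpha s))) *
    (opY (- root_factor rG s *: (alphav s *m rG s^-1%g)) * opT s).
Proof.
move=> Rs; have Gs := refG Rs; have [_ e] := root_factorE two_neq0 Gs (rootP Rs).
rewrite dunkl_TY // mulrA -mulrBl; congr (_ * _).
apply/eqP; rewrite subr_eq; apply/eqP; rewrite -dunkl_Yl; congr (opY _).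
have : (rG s - 1%:M) *m rG s^-1%g = 1%:M - rG s^-1%g.
  by rewrite mulmxBl mul1mx -repr_mxM ?groupV // mulgV repr_mx1.
rewrite {1}e addrC addKr => e2; have -> : rG s^-1%g = 1%:M - (1%:M - rG s^-1%g).
  by rewrite opprB addrC subrK.
rewrite -{1}e2 mulmxBr mulmx1 addrC; congr (_ + _).
rewrite opprB addrC subrK -scalemxAl -!scalemxAr scalerA mulrN -scaleNr -mulNr.
rewrite -!mulmxA (mulmxA y) [y *m alpha s]mx11_scalar mul_scalar_mx scalerA.
by rewrite !mulNr mulrC.
Qed.

Lemma mul_commutator (A : pzRingType) (D D' X R R' : A) :
  D * X - X * D = R -> D' * X - X * D' = R' -> R * D' + D * R' = R' * D + D' * R ->
  (D * D' - D' * D) * X = X * (D * D' - D' * D).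
Proof.
move=> eR eR' E.
have eD : D * X = X * D + R by rewrite -eR addrC subrK.
have eD' : D' * X = X * D' + R' by rewrite -eR' addrC subrK.
rewrite mulrBl mulrBr -!mulrA eD eD' !mulrDr !mulrA eD eD' !mulrDl -(addrA (X * D * D')) E.
by rewrite -(addrA (X * D' * D)) opprD addrACA subrr addr0.
Qed.

Definition dunkl_residue y y' x : endo V := \sum_(s in reflections rG)
  opS (phi (c s * pairing y (alpha s) * pairing (alphav s) x * pairing y' (alpha s))) *
    (opY (- root_factor rG s *: (alphav s *m rG s^-1%g)) * opT s).

Lemma dunkl_residueC y y' x : dunkl_residue y y' x = dunkl_residue y' y x.
Proof.
apply: eq_bigr => s _; congr (opS (phi _) * _).
by rewrite -!mulrA; congr (_ * _); ring.
Qed.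

Lemma dunkl_bracket_Y y y' x :
  dunkl_bracket y x * opY y' = opY y' * dunkl_bracket y x - dunkl_residue y y' x.
Proof.
rewrite /dunkl_bracket mulrBl mulrBr dunkl_scY -addrA; congr (_ + _).
rewrite -opprD; congr (- _); rewrite mulr_suml mulr_sumr -big_split.
apply: eq_bigr => s Rs /=.
have SM a b : opS (phi (a * b)) = opS (phi a) * opS (phi b).
  by rewrite (rmorphM phi) (rmorphM opS).
rewrite (SM _ (pairing y' (alpha s))) -(mulrA (opS _)) -dunkl_swap // mulrBr !mulrA dunkl_scY.
by rewrite addrC subrK.
Qed.

(** By the Jacobi identity it is enough that [[Y y, X x], Y y'] be symmetric in y and y'; it equals
    minus [dunkl_residue], which is. *)
Lemma dunkl_commutator_X y y' x :
  (opY y * opY y' - opY y' * opY y) * opX x = opX x * (opY y * opY y' - opY y' * opY y).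
Proof.
apply: mul_commutator (dunkl_YX y x) (dunkl_YX y' x) _.
have swap (A : zmodType) (a b m : A) : a - m + b = b - m + a.
  by rewrite addrAC [RHS]addrAC (addrC a).
rewrite !dunkl_bracket_Y (dunkl_residueC y'); exact: swap.
Qed.

Definition single (g : gT) (p : P) : V := [ffun h => if h == g then p else 0].

Lemma singleE g p h : single g p h = if h == g then p else 0.
Proof. by rewrite ffunE. Qed.

Lemma V_single (v : V) : v = \sum_g single g (v g).
Proof.
apply/ffunP => h; rewrite sumV (bigD1 h) //= singleE eqxx big1 ?addr0 // => g gh.
by rewrite singleE eq_sym (negPf gh).
Qed.

Lemma singleD g p q : single g (p + q) = single g p + single g q.
Proof. by apply/ffunP => h; rewrite VDE !singleE; case: ifP => // _; rewrite addr0. Qed.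

Lemma opX_single x g p : opX x (single g p) = single g (LX x * p).
Proof. by apply/ffunP => h; rewrite opXE !singleE; case: ifP => // _; rewrite mulr0. Qed.

Lemma opS_single a g p : opS a (single g p) = single g (a%:MP * p).
Proof. by apply/ffunP => h; rewrite opSE !singleE; case: ifP => // _; rewrite mulr0. Qed.

Lemma opY_single y g p : Yonly p -> opY y (single g p) = single g (LY y * p).
Proof.
have Y0 := Yonly0 k n.
move=> Yp; apply/ffunP => h; rewrite opYE big1 => [|s Rs]; last first.
  by rewrite dem_Yonly ?mulr0 // singleE; case: ifP.
rewrite subr0 !singleE; case: ifP => _; rewrite dX_Yonly ?mulr0 ?addr0 //.
Qed.

(** The commutator commutes with every X, and on polynomials in Y alone both operators are
    multiplications. Such polynomials generate the space under X, so the commutator vanishes. *)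
Lemma dunkl_YY y y' : opY y * opY y' = opY y' * opY y.
Proof.
apply/eqP; rewrite -subr_eq0; apply/eqP.
set C := opY y * opY y' - _.
have C1 g p : C (single g p) = 0.
  elim/(@phase_ind2 k n): p => [p Yp|p q ep eq|i p ep].
  - have Y1 := YonlyM_LY phi y Yp; have Y2 := YonlyM_LY phi y' Yp.
    rewrite /C endoBE !endoME (opY_single y g Yp) (opY_single y' g Yp).
    by rewrite (opY_single y g Y2) (opY_single y' g Y1) mulrCA subrr.
  - by rewrite (singleD g p q) endoD ep eq addr0.
  - rewrite -(LX_delta phi) -opX_single -endoME /C dunkl_commutator_X endoME -/C ep.
    exact: endo0.
apply: endoP => v; rewrite [v]V_single.
by apply: (big_ind (fun v => C v = 0)) => [|u w eu ew|g _ //]; rewrite ?endo0 ?endoD ?eu ?ew ?addr0.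
Qed.

Lemma dunkl_action :
  ch_action rG alpha alphav c phi t opS opY opX opT.
Proof.
split; [exact: dunkl_Yl|exact: dunkl_Xl|exact: dunkl_T1|exact: dunkl_TM|exact: dunkl_TY|
  exact: dunkl_TX|exact: dunkl_XX|exact: dunkl_YY|exact: dunkl_YX|
  exact: dunkl_scY|exact: dunkl_scX|exact: dunkl_scT].
Qed.

End Dunkl.

(** * The PBW theorem *)

Section LinearExtension.
Variables (N : nat) (k : comNzRingType) (B : pzRingType) (sc : {rmorphism k -> B}).
Variable u : 'X_{1..N} -> B.

Definition mlin (p : mpoly N k) : B := \sum_(m <- msupp p) sc p@_m * u m.

Lemma mlinEw (s : seq 'X_{1..N}) p : uniq s -> {subset msupp p <= s} ->
  mlin p = \sum_(m <- s) sc p@_m * u m.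
Proof.
move=> us sp; rewrite [RHS](bigID (mem (msupp p))) /= [X in _ + X]big1_seq; last first.
  by move=> m /andP[/memN_msupp_eq0-> _]; rewrite rmorph0 mul0r.
rewrite addr0 -big_filter; apply: perm_big; apply: uniq_perm.
- exact: msupp_uniq.
- exact: filter_uniq.
- by move=> m; rewrite mem_filter /=; case: (boolP (m \in msupp p)) => // /sp ->.
Qed.

Fact mlin_is_zmod_morphism : zmod_morphism mlin.
Proof.
move=> p q; pose s := undup (msupp p ++ msupp q ++ msupp (p - q)).
have us : uniq s by apply: undup_uniq.
rewrite !(@mlinEw s) //; first last.
- by move=> m; rewrite mem_undup !mem_cat => ->; rewrite !orbT.
- by move=> m; rewrite mem_undup !mem_cat => ->.
- by move=> m; rewrite mem_undup !mem_cat => ->; rewrite !orbT.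
by rewrite -sumrB; apply: eq_bigr => m _; rewrite mcoeffB rmorphB mulrBl.
Qed.
HB.instance Definition _ := GRing.isZmodMorphism.Build (mpoly N k) B mlin mlin_is_zmod_morphism.

Lemma mlinZX a m : mlin (a *: 'X_[m]) = sc a * u m.
Proof.
have sub : {subset msupp (a *: 'X_[m] : mpoly N k) <= [:: m]}.
  by move=> m' /msuppZ_le; rewrite msuppX.
by rewrite (mlinEw _ sub) // big_seq1 mcoeffZ mcoeffX eqxx mulr1.
Qed.

Lemma mlinC a : mlin a%:MP = sc a * u 0%MM.
Proof. by rewrite -mlinZX mpolyX0 -mul_mpolyC mulr1. Qed.

Lemma mlinD p q : mlin (p + q) = mlin p + mlin q.
Proof. exact: raddfD. Qed.

Lemma mlin0 : mlin 0 = 0.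
Proof. exact: raddf0. Qed.

Lemma mlin_ext (f g : mpoly N k -> B) : f 0 = g 0 ->
  {morph f : p q / p + q} -> {morph g : p q / p + q} ->
  (forall a m, f (a *: 'X_[m]) = g (a *: 'X_[m])) -> f =1 g.
Proof.
move=> fg0 fD gD fg p; rewrite (mpolyE p).
by apply: (big_ind (fun p => f p = g p)) => [//|q r eq er|m _]; rewrite ?fg // fD gD eq er.
Qed.

Lemma mlin_Xl i w p : (forall a, sc a * w = w * sc a) ->
  (forall m, w * u m = u (U_(i) + m)%MM) -> mlin ('X_i * p) = w * mlin p.
Proof.
move=> scw wu; apply: (mlin_ext (f := fun p => mlin ('X_i * p)) (g := fun p => w * mlin p)) => [|q r|q r|a m].
- by rewrite mulr0 mlin0 mulr0.
- by rewrite mulrDr mlinD.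
- by rewrite mlinD mulrDr.
- by rewrite -scalerAr -mpolyXD !mlinZX mulrA -scw -mulrA wu.
Qed.

Lemma mlin_Xr i w p :
  (forall m, u m * w = u (U_(i) + m)%MM) -> mlin ('X_i * p) = mlin p * w.
Proof.
move=> wu; apply: (mlin_ext (f := fun p => mlin ('X_i * p)) (g := fun p => mlin p * w)) => [|q r|q r|a m].
- by rewrite mulr0 mlin0 mul0r.
- by rewrite mulrDr mlinD.
- by rewrite mlinD mulrDl.
- by rewrite -scalerAr -mpolyXD !mlinZX -wu mulrA.
Qed.

Lemma mlin_MC a p : mlin (a%:MP * p) = sc a * mlin p.
Proof.
apply: (mlin_ext (f := fun p => mlin (a%:MP * p)) (g := fun p => sc a * mlin p)) => [|q r|q r|b m].
- by rewrite mulr0 mlin0 mulr0.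
- by rewrite mulrDr mlinD.
- by rewrite mlinD mulrDr.
- by rewrite mul_mpolyC scalerA !mlinZX rmorphM mulrA.
Qed.

End LinearExtension.

(** * Polynomials evaluated at commuting elements of a ring *)

Section Word.
Variables (N : nat) (B : pzRingType) (v : 'I_N -> B).
Hypothesis vC : forall i j, v i * v j = v j * v i.

Lemma word_comm (r : seq 'I_N) (e : 'I_N -> nat) (w : B) : (forall i, w * v i = v i * w) ->
  w * (\prod_(i <- r) v i ^+ e i) = (\prod_(i <- r) v i ^+ e i) * w.
Proof.
move=> wv; elim/big_ind: _ => [|x y ex ey|i _]; first by rewrite mulr1 mul1r.
  by rewrite mulrA ex -mulrA ey mulrA.
by elim: (e i) => [|d IHd]; rewrite ?expr0 ?mulr1 ?mul1r // exprS mulrA wv -!mulrA IHd.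
Qed.

Lemma wordU i (m : 'X_{1..N}) :
  v i * (\prod_(j < N) v j ^+ m j) = \prod_(j < N) v j ^+ (U_(i) + m)%MM j.
Proof.
suff H (r : seq 'I_N) : uniq r -> i \in r ->
    v i * (\prod_(j <- r) v j ^+ m j) = \prod_(j <- r) v j ^+ (U_(i) + m)%MM j.
  by apply: H; rewrite ?index_enum_uniq ?mem_index_enum.
elim: r => // j r IHr /= /andP[jr ur]; rewrite inE !big_cons => /predU1P[->|ir].
  rewrite mnmDE mnm1E eqxx exprS -!mulrA; congr (_ * (_ * _)).
  apply: eq_big_seq => l lr; rewrite mnmDE mnm1E; case: eqP => // e.
  by rewrite e lr in jr.
have ij : i != j by apply: contraNneq jr => <-.
rewrite mnmDE mnm1E (negPf ij) add0n -IHr // !mulrA; congr (_ * _).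
by elim: (m j) => [|d IHd]; rewrite ?expr0 ?mulr1 ?mul1r // exprS mulrA vC -!mulrA IHd.
Qed.

Lemma wordU_r i (m : 'X_{1..N}) :
  (\prod_(j < N) v j ^+ m j) * v i = \prod_(j < N) v j ^+ (U_(i) + m)%MM j.
Proof. by rewrite -wordU word_comm. Qed.

Lemma word0 : \prod_(j < N) v j ^+ (0%MM : 'X_{1..N}) j = 1.
Proof. by rewrite big1 // => j _; rewrite mnm0E. Qed.

Variables (k : comNzRingType) (sc : {rmorphism k -> B}).
Hypothesis scv : forall a i, sc a * v i = v i * sc a.

Definition wev : mpoly N k -> B := mlin sc (fun m => \prod_(i < N) v i ^+ m i).

Lemma wevC a : wev a%:MP = sc a.
Proof. by rewrite /wev mlinC word0 mulr1. Qed.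
Lemma wevD p q : wev (p + q) = wev p + wev q.
Proof. exact: mlinD. Qed.
Lemma wevX i p : wev ('X_i * p) = v i * wev p.
Proof. by apply: mlin_Xl => [a|m]; [apply: scv|apply: wordU]. Qed.
Lemma wev_var i : wev 'X_i = v i.
Proof. by rewrite -['X_i]mulr1 wevX -mpolyC1 wevC rmorph1 mulr1. Qed.
Lemma wevM p q : wev (p * q) = wev p * wev q.
Proof.
elim/mpoly_ind: p => [a|p p' ep ep'|i p ep].
- by rewrite wevC; apply: mlin_MC.
- by rewrite mulrDl !wevD ep ep' mulrDl.
- by rewrite -mulrA !wevX ep mulrA.
Qed.
Lemma wevZ a p : wev (a *: p) = sc a * wev p.
Proof. by rewrite -mul_mpolyC; apply: mlin_MC. Qed.
Lemma wev_comm (w : B) p : (forall a, sc a * w = w * sc a) ->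
  (forall i, w * v i = v i * w) -> w * wev p = wev p * w.
Proof.
move=> sw vw; elim/mpoly_ind: p => [a|p p' ep ep'|i p ep].
- by rewrite wevC sw.
- by rewrite wevD mulrDr mulrDl ep ep'.
- by rewrite wevX mulrA vw -mulrA ep mulrA.
Qed.

End Word.

Section Embed.
Variables (N N' : nat) (k : comNzRingType) (h : 'I_N -> 'I_N').
Fact membed_subproof : {f : {rmorphism mpoly N k -> mpoly N' k} |
  (forall a, f a%:MP = a%:MP) /\ (forall i, f 'X_i = 'X_(h i))}.
Proof.
pose f : {rmorphism mpoly N k -> mpoly N' k} := mpoly.mmap (@mpolyC _ k) (fun i => 'X_(h i)).
exists f; split=> [a|i]; first exact: mmapC.
by rewrite /f /= mmapX mmap1U.
Qed.
Definition membed : {rmorphism mpoly N k -> mpoly N' k} := sval membed_subproof.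
Lemma membedC a : membed a%:MP = a%:MP. Proof. by case: (svalP membed_subproof). Qed.
Lemma membedX i : membed 'X_i = 'X_(h i). Proof. by case: (svalP membed_subproof). Qed.
End Embed.

(** * Normal ordering and PBW coordinates *)

Section PBW.
Variables (F : fieldType) (gT : finGroupType) (G : {group gT}) (n : nat).
Variable rG : mx_representation F G n.
Variables (alpha : gT -> 'cV[F]_n) (alphav : gT -> 'rV[F]_n) (c : gT -> F).
Variables (k : idomainType) (phi : {rmorphism F -> k}) (t : k).
Hypothesis two_neq0 : 2 != 0 :> F.
Hypothesis rootP : forall s, s \in reflections rG -> root_coroot rG s (alpha s) (alphav s).

Local Notation P := (mpoly (n + n) k).
Local Notation LX := (LX phi).
Local Notation LY := (LY phi).
Local Notation V := (dunkl_space gT n k).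

Local Notation dem := (dem phi two_neq0 rootP).
Local Notation opY := (opY c phi t two_neq0 rootP).

Lemma refl_mem s : s \in reflections rG -> s \in G.
Proof. by rewrite inE => /andP[]. Qed.

Variables (H : pzRingType) (sc : {rmorphism k -> H}) (hY : 'rV[F]_n -> H)
  (hX : 'cV[F]_n -> H) (hT : gT -> H).
Hypothesis act : ch_action rG alpha alphav c phi t sc hY hX hT.
Hypothesis scC : forall a h, sc a * h = h * sc a.

Lemma hX_lin a x x' : hX (a *: x + x') = sc (phi a) * hX x + hX x'.
Proof. exact: (ca_Xl act). Qed.
Lemma hXD x x' : hX (x + x') = hX x + hX x'.
Proof. by rewrite -[x in LHS]scale1r hX_lin !rmorph1 mul1r. Qed.
Lemma hX0 : hX 0 = 0.
Proof. by have := hXD 0 0; rewrite addr0 -{1}[hX 0]addr0 => /addrI. Qed.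
Lemma hX_sumE x : hX x = \sum_i sc (phi (x i 0)) * hX (delta_mx i 0).
Proof.
have hXZ a y : hX (a *: y) = sc (phi a) * hX y by rewrite -[a *: y]addr0 hX_lin hX0 addr0.
rewrite {1}(matrix_sum_delta x) (big_morph hX hXD hX0).
by apply: eq_bigr => i _; rewrite big_ord1 hXZ.
Qed.
Lemma hYD x x' : hY (x + x') = hY x + hY x'.
Proof. by rewrite -[x in LHS]scale1r (ca_Yl act) !rmorph1 mul1r. Qed.
Lemma hY0 : hY 0 = 0.
Proof. by have := hYD 0 0; rewrite addr0 -{1}[hY 0]addr0 => /addrI. Qed.
Lemma hY_sumE x : hY x = \sum_i sc (phi (x 0 i)) * hY (delta_mx 0 i).
Proof.
have hYZ a y : hY (a *: y) = sc (phi a) * hY y by rewrite -[a *: y]addr0 (ca_Yl act) hY0 addr0.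
rewrite {1}(matrix_sum_delta x) big_ord1 (big_morph hY hYD hY0).
by apply: eq_bigr => i _; rewrite hYZ.
Qed.

(** Normal ordering. It is additive but not multiplicative: apart from scalars, only an X can be
    pulled out to the left and a Y to the right. *)
Definition evp : P -> H := locked (mlin sc (fun m =>
  (\prod_(i < n) hX (delta_mx i 0) ^+ m (lshift n i)) *
  (\prod_(i < n) hY (delta_mx 0 i) ^+ m (rshift n i)))).

Lemma evpD p q : evp (p + q) = evp p + evp q. Proof. by rewrite /evp -lock mlinD. Qed.
Lemma evpB p q : evp (p - q) = evp p - evp q. Proof. by rewrite /evp -lock raddfB. Qed.
Lemma evp0 : evp 0 = 0. Proof. by rewrite /evp -lock mlin0. Qed.
Lemma evpC a : evp a%:MP = sc a.
Proof.
rewrite /evp -lock mlinC !big1 ?mulr1 // => i _; by rewrite mnm0E expr0.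
Qed.
Lemma evpMC a p : evp (a%:MP * p) = sc a * evp p.
Proof. by rewrite /evp -lock mlin_MC. Qed.

Let mX (m : 'X_{1..n + n}) : 'X_{1..n} := [multinom m (lshift n i) | i < n].
Let mY (m : 'X_{1..n + n}) : 'X_{1..n} := [multinom m (rshift n i) | i < n].

Lemma evp_Xl i p : evp ('X_(lshift n i) * p) = hX (delta_mx i 0) * evp p.
Proof.
rewrite /evp -lock; apply: mlin_Xl => [a|m]; first exact: scC.
rewrite mulrA; congr (_ * _).
  have := wordU (v := fun i => hX (delta_mx i 0)) (fun i j => ca_XX act _ _) i (mX m).
  under eq_bigr do rewrite mnmE; move=> ->; apply: eq_bigr => j _.
  by rewrite !mnmDE !mnm1E (inj_eq (@lshift_inj _ _)) mnmE.
by apply: eq_bigr => j _; rewrite mnmDE mnm1E eq_lrshift.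
Qed.

Lemma evp_Yr i p : evp ('X_(rshift n i) * p) = evp p * hY (delta_mx 0 i).
Proof.
rewrite /evp -lock; apply: mlin_Xr => m; rewrite -mulrA; congr (_ * _).
  by apply: eq_bigr => j _; rewrite mnmDE mnm1E eq_rlshift.
have := wordU_r (v := fun i => hY (delta_mx 0 i)) (fun i j => ca_YY act _ _) i (mY m).
under eq_bigr do rewrite mnmE; move=> ->; apply: eq_bigr => j _.
by rewrite !mnmDE !mnm1E (inj_eq (@rshift_inj _ _)) mnmE.
Qed.

Lemma evp_LX x p : evp (LX x * p) = hX x * evp p.
Proof.
rewrite hX_sumE /LX !mulr_suml (big_morph evp evpD evp0); apply: eq_bigr => i _.
by rewrite -scalerAl -mul_mpolyC evpMC evp_Xl mulrA.
Qed.

Lemma evp_LY y p : evp (LY y * p) = evp p * hY y.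
Proof.
rewrite hY_sumE /LY mulr_suml mulr_sumr (big_morph evp evpD evp0); apply: eq_bigr => i _.
by rewrite -scalerAl -mul_mpolyC evpMC evp_Yr mulrA scC -!mulrA scC.
Qed.

Definition ev (v : V) : H := \sum_(g in G) evp (v g) * hT g.

Lemma evD u v : ev (u + v) = ev u + ev v.
Proof.
by rewrite /ev -big_split; apply: eq_bigr => g _; rewrite VDE evpD mulrDl.
Qed.
Lemma ev_single g p : g \in G -> ev (single g p) = evp p * hT g.
Proof.
move=> Gg; rewrite /ev (bigD1 g) //= singleE eqxx big1 ?addr0 // => h /andP[_ hg].
by rewrite singleE (negPf hg) evp0 mul0r.
Qed.

Lemma ev_S a v : sc a * ev v = ev (opS gT n a v).
Proof.
by rewrite /ev mulr_sumr; apply: eq_bigr => g _; rewrite opSE evpMC mulrA.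
Qed.

Lemma ev_X x v : hX x * ev v = ev (opX gT phi x v).
Proof.
by rewrite /ev mulr_sumr; apply: eq_bigr => g _; rewrite opXE evp_LX mulrA.
Qed.

Lemma hT_evp g p : g \in G -> hT g * evp p = evp (gsub rG phi g p) * hT g.
Proof.
move=> Gg; elim/(@phase_ind _ _ phi): p => [a|p q ep eq|x p ep|y p ep].
- by rewrite /gsub psubC evpC scC.
- by rewrite /gsub psubD !evpD mulrDr mulrDl ep eq.
- by rewrite /gsub psubM psubX !evp_LX mulrA (ca_TX act) // -!mulrA ep.
- rewrite /gsub psubM psubY !evp_LY mulrA ep -!mulrA; congr (_ * _).
  by rewrite (ca_TY act).
Qed.

Lemma ev_T g v : g \in G -> hT g * ev v = ev (opT rG phi g v).
Proof.
move=> Gg; rewrite /ev mulr_sumr [RHS](reindex_inj (mulgI g)) /=.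
apply: eq_big => [h|h Gh]; first by rewrite groupMl.
by rewrite mulrA hT_evp // opTE mulKg -mulrA (ca_TM act).
Qed.

(** Moving Y through an X by the defining commutator reproduces term by term the product rules of
    [dX] and [dem], so left multiplication by Y is the Dunkl operator. *)
Lemma evp_Y y p : hY y * evp p = evp (LY y * p + t%:MP * dX phi y p) -
  \sum_(s in reflections rG) evp (dunkl_coef alpha c phi s y * dem s p) * hT s.
Proof.
have coefC s q : evp (dunkl_coef alpha c phi s y * q) =
    sc (phi (c s * pairing y (alpha s))) * evp q by apply: evpMC.
elim/(@phase_ind _ _ phi): p => [a|p q ep eq|x p ep|z p ep].
- rewrite dXC mulr0 addr0 evp_LY evpC scC big1 ?subr0 // => s Rs.
  by rewrite dem_Yonly ?mulr0 ?evp0 ?mul0r //; apply: YonlyC.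
- have shuffle (A : zmodType) (a b s s' : A) : a - s + (b - s') = a + b - (s + s').
    by rewrite addrACA -opprD.
  rewrite evpD mulrDr ep eq shuffle -evpD dXD !mulrDr addrACA; congr (_ - _).
  rewrite -big_split /=; apply: eq_bigr => s Rs.
  by rewrite demD // mulrDr evpD mulrDl.
- have shuffle (A : zmodType) (u a s s' : A) : u - s' + (a - s) = a + u - (s + s').
    by rewrite addrC addrACA -opprD.
  have -> : hY y * evp (LX x * p) = (hY y * hX x - hX x * hY y) * evp p + hX x * (hY y * evp p).
    by rewrite evp_LX mulrBl !mulrA subrK.
  rewrite (ca_YX act) mulrBl ep mulrBr shuffle; congr (_ - _).
    rewrite dXM dX_LX -evp_LX -evpMC -evpD mpolyCM; congr evp; ring.
  rewrite mulr_sumr mulr_suml -big_split /=; apply: eq_bigr => s Rs.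
  rewrite dem_LX // mulrDr evpD mulrDl mulrCA evp_LX; congr (_ + _).
    by rewrite !mulrA.
  rewrite coefC evpMC -[RHS]mulrA -[in RHS]mulrA -hT_evp ?(refl_mem Rs) //.
  by rewrite !(rmorphM sc, rmorphM phi) !mulrA.
- rewrite evp_LY mulrA ep mulrBl [X in _ - X = _]mulr_suml dXM dX_LY mul0r add0r.
  rewrite -evp_LY mulrDr mulrCA (mulrCA (LY z)); congr (_ - _); apply: eq_bigr => s Rs.
  rewrite dem_LY // mulrCA evp_LY -!mulrA; congr (_ * _).
  by rewrite (ca_TY act) ?(refl_mem Rs).
Qed.

Lemma ev_Y y v : hY y * ev v = ev (opY y v).
Proof.
rewrite /ev mulr_sumr.
rewrite (eq_bigr (fun g => evp (LY y * v g + t%:MP * dX phi y (v g)) * hT g -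
  \sum_(s in reflections rG) evp (dunkl_coef alpha c phi s y * dem s (v g)) * hT (s * g)%g)).
  rewrite sumrB exchange_big /=.
  rewrite [RHS](eq_bigr (fun g => evp (LY y * v g + t%:MP * dX phi y (v g)) * hT g -
    \sum_(s in reflections rG) evp (dunkl_coef alpha c phi s y * dem s (v (s^-1 * g)%g)) * hT g)).
    rewrite sumrB [in RHS]exchange_big /=; congr (_ - _); apply: eq_bigr => s Rs.
    rewrite [RHS](reindex_inj (mulgI s)) /=; apply: eq_big => [g|g _].
      by rewrite groupMl ?(refl_mem Rs).
    by rewrite mulKg.
  move=> g Gg; rewrite opYE -mulr_suml -mulrBl; congr (_ * _).
  by rewrite evpB (big_morph evp evpD evp0).
move=> g Gg; rewrite mulrA evp_Y mulrBl [X in _ - X = _]mulr_suml; congr (_ - _).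
by apply: eq_bigr => s Rs; rewrite -mulrA (ca_TM act) ?(refl_mem Rs).
Qed.

Hypothesis H_ind : forall Q : H -> Prop,
  (forall a, Q (sc a)) -> (forall y, Q (hY y)) -> (forall x, Q (hX x)) ->
  (forall g, g \in G -> Q (hT g)) ->
  (forall x y, Q x -> Q y -> Q (x + y)) -> (forall x y, Q x -> Q y -> Q (x * y)) ->
  forall h, Q h.
Variable f : {rmorphism H -> endo V}.
Hypothesis fS : forall a, f (sc a) = opS gT n a.
Hypothesis fY : forall y, f (hY y) = opY y.
Hypothesis fX : forall x, f (hX x) = opX gT phi x.
Hypothesis fT : forall g, g \in G -> f (hT g) = opT rG phi g.

Lemma mul_ev h v : h * ev v = ev (f h v).
Proof.
elim/H_ind: h v => [a|y|x|g Gg|h h' eh eh'|h h' eh eh'] v.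
- by rewrite ev_S fS.
- by rewrite ev_Y fY.
- by rewrite ev_X fX.
- by rewrite ev_T // fT.
- by rewrite (rmorphD f) endoDE evD -eh -eh' mulrDl.
- by rewrite (rmorphM f) endoME -mulrA eh' eh.
Qed.

(** The orbit map of the unit vector. As [ev] is a map of modules, [ev_coord] follows at once and
    says that the normally ordered elements span; [coord_ev] is their linear independence. *)
Definition coord (h : H) : V := f h (single 1%g 1).

Lemma ev_coord h : ev (coord h) = h.
Proof.
by rewrite /coord -mul_ev ev_single ?group1 // (ca_T1 act) -mpolyC1 evpC rmorph1 !mulr1.
Qed.

Fact coord_is_zmod_morphism : zmod_morphism coord.
Proof. by move=> h h'; rewrite /coord (rmorphB f) endoBE. Qed.
HB.instance Definition _ := GRing.isZmodMorphism.Build H V coord coord_is_zmod_morphism.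

(** Vectors are functions on all of [gT], while [ev] sees only their values on [G]; coordinates are
    unique among functions vanishing elsewhere. *)
Definition supported (v : V) := forall g, g \notin G -> v g = 0.

Lemma supported_coord h : supported (coord h).
Proof.
suff S v : supported v -> supported (f h v).
  apply: S => g Gg; rewrite singleE; case: eqP => // e.
  by rewrite e group1 in Gg.
elim/H_ind: h v => [a|y|x|g Gg|h h' eh eh'|h h' eh eh'] v Sv g' Gg'.
- by rewrite fS opSE Sv ?mulr0.
- rewrite fY opYE Sv // mulr0 (dX_Yonly _ _ (Yonly0 k n)) mulr0 addr0 big1 ?subrr // => s Rs.
  rewrite Sv ?(dem_Yonly _ _ _ Rs (Yonly0 k n)) ?mulr0 //.
  by rewrite groupMl // groupV (refl_mem Rs).
- by rewrite fX opXE Sv ?mulr0.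
- by rewrite fT // opTE Sv ?rmorph0 // groupMl // groupV.
- by rewrite (rmorphD f) endoDE VDE eh ?eh' ?addr0.
- by rewrite (rmorphM f) endoME; apply: eh => //; apply: eh'.
Qed.

Lemma f_evp_Yonly g p q : Yonly p -> Yonly q -> f (evp p) (single g q) = single g (p * q).
Proof.
move=> Yp; elim: Yp q => [a|p1 p2 _ e1 _ e2|i p1 _ e1] q Yq.
- by rewrite evpC fS opS_single.
- by rewrite evpD (rmorphD f) endoDE e1 // e2 // mulrDl singleD.
- rewrite evp_Yr (rmorphM f) endoME fY (opY_single _ _ _ _ _ _ _ Yq) LY_delta.
  by rewrite e1; [rewrite mulrCA mulrA | apply: YonlyM].
Qed.

Lemma f_evp_single g p : f (evp p) (single g 1) = single g p.
Proof.
have Y1 : Yonly (1 : P) by rewrite -mpolyC1; apply: YonlyC.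
elim/(@phase_ind2 k n): p => [p Yp|p q ep eq|i p ep].
- by rewrite f_evp_Yonly // mulr1.
- by rewrite (evpD p q) (rmorphD f) endoDE ep eq -(singleD g p q).
- by rewrite evp_Xl (rmorphM f) endoME ep fX opX_single LX_delta.
Qed.

Lemma opT_single g h p : opT rG phi g (single h p) = single (g * h)%g (gsub rG phi g p).
Proof.
apply/ffunP => x; rewrite opTE !singleE.
have -> : ((g^-1 * x)%g == h) = (x == (g * h)%g).
  by apply/eqP/eqP => [<-|->]; rewrite ?mulKVg ?mulKg.
by case: ifP => // _; rewrite rmorph0.
Qed.

Lemma coord_ev v : supported v -> coord (ev v) = v.
Proof.
move=> Sv; rewrite /coord /ev (rmorph_sum f) endo_sumE [RHS]V_single [RHS](bigID (mem G)) /=.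
rewrite [X in _ + X]big1 ?addr0 => [|g Gg]; last first.
  by apply/ffunP => h; rewrite singleE Sv // ffunE if_same.
apply: eq_bigr => g Gg; rewrite (rmorphM f) endoME fT // opT_single mulg1 rmorph1.
exact: f_evp_single.
Qed.

End PBW.

(** * Linear substitutions and commutators with invariant polynomials *)

Section LinearSubstitution.
Variables (n : nat) (k : comNzRingType).

Definition msubst (M : 'M[k]_n) (f : mpoly n k) : mpoly n k :=
  f \mPo [tuple \sum_j M i j *: 'X_j | i < n].

Lemma msubstD M f g : msubst M (f + g) = msubst M f + msubst M g.
Proof. exact: comp_mpolyD. Qed.
Lemma msubstM M f g : msubst M (f * g) = msubst M f * msubst M g.
Proof. by rewrite /msubst rmorphM. Qed.
Lemma msubstC M a : msubst M a%:MP = a%:MP.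
Proof. exact: comp_mpolyC. Qed.
Lemma msubstX M i : msubst M 'X_i = \sum_j M i j *: 'X_j.
Proof. by rewrite /msubst comp_mpolyXU -tnth_nth tnth_mktuple. Qed.
Lemma msubstZ M a f : msubst M (a *: f) = a *: msubst M f.
Proof. exact: comp_mpolyZ. Qed.

End LinearSubstitution.

Section Commutation.
Variables (gT : finGroupType) (n : nat) (k : idomainType) (B : pzRingType).
Variables (sc : {rmorphism k -> B}) (v : 'I_n -> B).
Hypothesis scC : forall a h, sc a * h = h * sc a.
Hypothesis vC : forall i j, v i * v j = v j * v i.

Local Notation wev := (wev v sc).
Let scv a i : sc a * v i = v i * sc a. Proof. exact: scC. Qed.

Lemma wev_subst (M : 'M[k]_n) w f :
  (forall i, w * v i = (\sum_j sc (M i j) * v j) * w) ->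
  w * wev f = wev (msubst M f) * w.
Proof.
move=> wv; elim/mpoly_ind: f => [a|f g ef eg|i f ef].
- by rewrite msubstC !wevC scC.
- by rewrite msubstD !wevD mulrDr mulrDl ef eg.
- rewrite msubstM !(wevM vC scv) msubstX (wev_var vC scv) mulrA wv -!mulrA ef.
  congr (_ * _); rewrite (big_morph wev (@wevD _ _ _ _ _) (mlin0 _ _)).
  by apply: eq_bigr => j _; rewrite wevZ (wev_var vC scv).
Qed.

Variables (A : {set gT}) (T : gT -> B) (y : B) (b : gT -> k).
Variables (be al : gT -> 'I_n -> k) (M : gT -> 'M[k]_n).
Hypothesis Tv : forall s i, s \in A -> T s * v i = (\sum_j sc (M s i j) * v j) * T s.
Hypothesis ME : forall s i j, s \in A -> M s i j = (i == j)%:R + be s i * al s j.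
Hypothesis yv : forall i, y * v i - v i * y = \sum_(s in A) sc (b s * be s i) * T s.

(* Divided differences of polynomials compute the commutator with y. *)
Lemma commutator_wev f : exists q : gT -> mpoly n k,
  (forall s, s \in A -> (\sum_j al s j *: 'X_j) * q s = msubst (M s) f - f) /\
  y * wev f - wev f * y = \sum_(s in A) sc (b s) * wev (q s) * T s.
Proof.
elim/mpoly_ind: f => [a|f g [q [eq1 eq2]] [r [er1 er2]]|i f [q [eq1 eq2]]].
- exists (fun=> 0); split=> [s As|]; first by rewrite mulr0 msubstC subrr.
  rewrite wevC scC subrr big1 // => s _.
  by rewrite /wev mlin0 mulr0 mul0r.
- exists (fun s => q s + r s); split=> [s As|].
    by rewrite mulrDr eq1 // er1 // msubstD; ring.
  rewrite wevD mulrDr mulrDl opprD addrACA eq2 er2 -big_split /=.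
  by apply: eq_bigr => s _; rewrite wevD mulrDr mulrDl.
- exists (fun s => be s i *: msubst (M s) f + 'X_i * q s); split=> [s As|].
    have e : \sum_j M s i j *: 'X_j = 'X_i + be s i *: (\sum_j al s j *: 'X_j) :> mpoly n k.
      rewrite scaler_sumr (bigD1 i) //= [in RHS](bigD1 i) //= addrA ME // eqxx.
      rewrite scalerDl scale1r scalerA; congr (_ + _).
      by apply: eq_bigr => j ji; rewrite ME // eq_sym (negPf ji) add0r scalerA.
    rewrite mulrDr mulrCA eq1 // msubstM msubstX e -!mul_mpolyC; ring.
  have -> : y * wev ('X_i * f) - wev ('X_i * f) * y =
      (y * v i - v i * y) * wev f + v i * (y * wev f - wev f * y).
    by rewrite (wevX vC scv) mulrBl mulrBr !mulrA addrA subrK.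
  rewrite eq2 yv mulr_suml mulr_sumr -big_split /=; apply: eq_bigr => s As.
  rewrite wevD (wevX vC scv) wevZ rmorphM mulrDr mulrDl; congr (_ + _).
    by rewrite -!mulrA (wev_subst f (fun j => Tv j As)) -?mulrA.
  by rewrite !mulrA scC.
Qed.

(** If f is s-invariant, its divided difference along the nonzero linear form [al s] vanishes, as k
    is a domain. The alternative b s = 0 serves parameters that vanish off a subgroup. *)
Lemma invariant_wev_comm f :
  (forall s, s \in A -> b s = 0 \/ msubst (M s) f = f /\ exists j, al s j != 0) ->
  y * wev f = wev f * y.
Proof.
move=> fA; have [q [eq1 eq2]] := commutator_wev f.
apply/eqP; rewrite -subr_eq0 eq2 big1 // => s As.
have [->|[ef [j aj]]] := fA s As; first by rewrite rmorph0 !mul0r.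
have := eq1 s As; rewrite ef subrr => /eqP; rewrite mulf_eq0 => /orP[/eqP e|/eqP->].
  move/(congr1 (mcoeff U_(j))): e; rewrite mcoeff0 raddf_sum (bigD1 j) //=.
  rewrite mcoeffZ mcoeffXU eqxx mulr1 big1 => [|l lj]; first by rewrite addr0 => /eqP; rewrite (negPf aj).
  by rewrite mcoeffZ mcoeffXU (negPf lj) mulr0.
by rewrite /wev mlin0 mulr0 mul0r.
Qed.

End Commutation.

(** * Multiplication rules in PBW coordinates *)

Section PBWRing.
Variables (F : fieldType) (gT : finGroupType) (G : {group gT}) (n : nat).
Variable rG : mx_representation F G n.
Variables (alpha : gT -> 'cV[F]_n) (alphav : gT -> 'rV[F]_n) (c : gT -> F).
Variables (k : idomainType) (phi : {rmorphism F -> k}) (t : k).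

Local Notation P := (mpoly (n + n) k).
Local Notation V := (dunkl_space gT n k).

(** The interface through which later arguments compute in the algebra, shared by both groups and by
    t = 0 and t = 'X; [co] returns the PBW coordinates. *)
Record pbw_ring (H : pzRingType) (sc : {rmorphism k -> H}) (hY : 'rV[F]_n -> H)
    (hX : 'cV[F]_n -> H) (hT : gT -> H) (co : H -> V) : Prop := PbwRing {
  pbw_act : ch_action rG alpha alphav c phi t sc hY hX hT;
  pbw_scC : forall a h, sc a * h = h * sc a;
  pbw_ind : forall Q : H -> Prop,
    (forall a, Q (sc a)) -> (forall y, Q (hY y)) -> (forall x, Q (hX x)) ->
    (forall g, g \in G -> Q (hT g)) ->
    (forall x y, Q x -> Q y -> Q (x + y)) -> (forall x y, Q x -> Q y -> Q (x * y)) ->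
    forall h, Q h;
  pbw_coB : zmod_morphism co;
  pbw_evK : forall h, ev G sc hY hX hT (co h) = h;
  pbw_coK : forall v, supported G v -> co (ev G sc hY hX hT v) = v;
  pbw_supp : forall h, supported G (co h) }.

Lemma cherednik_pbw : 2 != 0 :> F ->
  (forall s, s \in reflections rG -> root_coroot rG s (alpha s) (alphav s)) ->
  (forall s g, s \in reflections rG -> g \in G -> c (s ^ g)%g = c s) ->
  {co : cherednik rG alpha alphav c phi t -> V |
    pbw_ring (ch_scal rG alpha alphav c phi t) (ch_Y rG alpha alphav c phi t)
     (ch_X rG alpha alphav c phi t) (ch_T rG alpha alphav c phi t) co}.
Proof.
move=> n2 rP cJ; apply: cid.
have [f [fS fY fX fT]] := ch_lift_exists (dunkl_action phi t n2 rP cJ).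
have act := ch_actionP rG alpha alphav c phi t.
have scC := ch_scalC (rG := rG) (alpha := alpha) (alphav := alphav) (c := c) (phi := phi) (t := t).
have ind := ch_ind (rG := rG) (alpha := alpha) (alphav := alphav) (c := c) (phi := phi) (t := t).
exists (coord f); split=> //.
- exact: coord_is_zmod_morphism.
- exact: (ev_coord act scC ind fS fY fX fT).
- exact: (coord_ev act scC fS fY fX fT).
- exact: (supported_coord ind fS fY fX fT).
Qed.

Variables (H : pzRingType) (sc : {rmorphism k -> H}) (hY : 'rV[F]_n -> H).
Variables (hX : 'cV[F]_n -> H) (hT : gT -> H) (co : H -> V).
Hypothesis pb : pbw_ring sc hY hX hT co.
Local Notation ev := (ev G sc hY hX hT).
Local Notation evp := (evp sc hY hX).
Let act := pbw_act pb.
Let scC := pbw_scC pb.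

Lemma coB h h' : co (h - h') = co h - co h'. Proof. exact: (pbw_coB pb). Qed.
Lemma co0 : co 0 = 0. Proof. by have := coB 0 0; rewrite !subrr. Qed.
Lemma coN h : co (- h) = - co h. Proof. by rewrite -(sub0r h) coB co0 sub0r. Qed.
Lemma coD h h' : co (h + h') = co h + co h'.
Proof. by rewrite -[h' in LHS]opprK coB coN opprK. Qed.
Lemma co_sum (I : Type) (r : seq I) (Q : pred I) (f : I -> H) :
  co (\sum_(i <- r | Q i) f i) = \sum_(i <- r | Q i) co (f i).
Proof. exact: (big_morph co coD co0). Qed.
Lemma co_inj : injective co.
Proof. by move=> h h' e; rewrite -(pbw_evK pb h) e (pbw_evK pb). Qed.

Lemma co_sc a h g : co (sc a * h) g = a%:MP * co h g.
Proof.
rewrite -{1}(pbw_evK pb h) ev_S // (pbw_coK pb) ?opSE // => g' Gg'.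
by rewrite opSE (pbw_supp pb) ?mulr0.
Qed.

Lemma co_X x h g : co (hX x * h) g = LX phi x * co h g.
Proof.
rewrite -{1}(pbw_evK pb h) (ev_X act scC) (pbw_coK pb) ?opXE // => g' Gg'.
by rewrite opXE (pbw_supp pb) ?mulr0.
Qed.

Lemma co_T g h x : g \in G -> co (hT g * h) x = gsub rG phi g (co h (g^-1 * x)%g).
Proof.
move=> Gg; rewrite -{1}(pbw_evK pb h) (ev_T act scC) // (pbw_coK pb) ?opTE // => g' Gg'.
by rewrite opTE (pbw_supp pb) ?rmorph0 // groupMl ?groupV.
Qed.

Lemma co_1 g : co 1 g = (g == 1%g)%:R.
Proof.
have -> : 1 = ev (single 1%g 1) by rewrite ev_single // (ca_T1 act) -mpolyC1 evpC rmorph1 mulr1.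
rewrite (pbw_coK pb) ?singleE; first by case: eqP.
by move=> h Gh; rewrite singleE; case: eqP => // e; rewrite e group1 in Gh.
Qed.

Lemma ev_right (w : H) (p : gT -> P) (h : H) :
  (forall g q, g \in G -> evp q * hT g * w = evp (q * p g) * hT g) ->
  forall g, co (h * w) g = co h g * p g.
Proof.
move=> ew g; rewrite -{1}(pbw_evK pb h).
have -> : ev (co h) * w = ev [ffun g => co h g * p g].
  by rewrite /ev mulr_suml; apply: eq_bigr => x Gx; rewrite ew // ffunE.
rewrite (pbw_coK pb) ?ffunE // => x Gx.
by rewrite ffunE (pbw_supp pb) ?mul0r.
Qed.

Lemma co_Tr g h x : g \in G -> co (h * hT g) x = co h (x * g^-1)%g.
Proof.
move=> Gg; rewrite -{1}(pbw_evK pb h).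
have -> : ev (co h) * hT g = ev [ffun x => co h (x * g^-1)%g].
  rewrite /ev mulr_suml [RHS](reindex_inj (mulIg g)) /=.
  apply: eq_big => [y|y Gy]; first by rewrite groupMr.
  by rewrite -mulrA (ca_TM act) // ffunE mulgK.
rewrite (pbw_coK pb) ?ffunE // => y Gy.
by rewrite ffunE (pbw_supp pb) // groupMr ?groupV.
Qed.

(** T g Y y = Y (y g^-1) T g, and a Y is absorbed on the right of the normal order. The value 0 off
    [G] is a default, since coordinates vanish there. *)
Lemma co_Yr y h g : co (h * hY y) g = co h g * (if g \in G then LY phi (y *m rG g^-1%g) else 0).
Proof.
apply: (ev_right (p := fun g => if g \in G then _ else 0)) => {}g q Gg.
by rewrite Gg mulrC (evp_LY act scC) -mulrA (ca_TY act) // mulrA.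
Qed.

Let X_ i := hX (delta_mx i 0).
Let Y_ i := hY (delta_mx 0 i).
Let XC i j : X_ i * X_ j = X_ j * X_ i. Proof. exact: (ca_XX act). Qed.
Let YC i j : Y_ i * Y_ j = Y_ j * Y_ i. Proof. exact: (ca_YY act). Qed.
Let scX a i : sc a * X_ i = X_ i * sc a. Proof. exact: scC. Qed.
Let scY a i : sc a * Y_ i = Y_ i * sc a. Proof. exact: scC. Qed.

Definition evX := wev (fun i => hX (delta_mx i 0)) sc.
Definition evY := wev (fun i => hY (delta_mx 0 i)) sc.
Definition pX := membed k (@lshift n n).
Definition pY := membed k (@rshift n n).

Lemma co_evX f h g : co (evX f * h) g = pX f * co h g.
Proof.
rewrite /evX /pX; elim/mpoly_ind: f h => [a|f f' e e'|i f e] h.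
- by rewrite wevC membedC co_sc.
- by rewrite wevD rmorphD mulrDl coD VDE e e' mulrDl.
- by rewrite (wevX XC scX) rmorphM membedX -!mulrA co_X LX_delta e.
Qed.

Lemma evp_mulY f q : evp (q * pY f) = evp q * evY f.
Proof.
rewrite /evY /pY; elim/mpoly_ind: f q => [a|f f' e e'|i f e] q.
- by rewrite wevC membedC mulrC evpMC scC.
- by rewrite wevD rmorphD !mulrDr evpD e e'.
- rewrite (wevX YC scY) rmorphM membedX -/(pY f) mulrA e mulrA; congr (_ * _).
  by rewrite mulrC (evp_Yr act).
Qed.

Lemma hT_evX g f : g \in G -> hT g * evX f = evX (msubst (map_mx phi (rG g)^T) f) * hT g.
Proof.
move=> Gg; apply: wev_subst => // i; rewrite (ca_TX act) //; congr (_ * _).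
rewrite (hX_sumE act); apply: eq_bigr => j _.
by rewrite -colE !mxE.
Qed.

Lemma hT_evY g f : g \in G -> hT g * evY f = evY (msubst (map_mx phi (rG g^-1%g)) f) * hT g.
Proof.
move=> Gg; apply: wev_subst => // i; rewrite (ca_TY act) //; congr (_ * _).
rewrite (hY_sumE act); apply: eq_bigr => j _.
by rewrite -rowE !mxE.
Qed.

Lemma co_evYr f h g : (forall g, g \in G -> msubst (map_mx phi (rG g^-1%g)) f = f) ->
  co (h * evY f) g = co h g * pY f.
Proof.
move=> invf; apply: (ev_right (p := fun=> pY f)) => {}g q Gg.
by rewrite -mulrA hT_evY // invf // mulrA evp_mulY.
Qed.

End PBWRing.

(** * Central ideals and lifting of idempotents *)

Section OrderFiltration.
Variables (N : nat) (k : comNzRingType).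
Implicit Types p q : mpoly N k.

Definition ordge d p := forall m : 'X_{1..N}, (mdeg m < d)%N -> p@_m = 0.
Definition degle d p := forall m : 'X_{1..N}, (d < mdeg m)%N -> p@_m = 0.

Lemma ordge0p p : ordge 0 p. Proof. by []. Qed.
Lemma ordge_0 d : ordge d 0. Proof. by move=> m _; rewrite mcoeff0. Qed.
Lemma ordgeD d p q : ordge d p -> ordge d q -> ordge d (p + q).
Proof. by move=> op oq m md; rewrite mcoeffD op ?oq ?addr0. Qed.
Lemma ordge_sum d (I : Type) (r : seq I) (Q : pred I) (f : I -> mpoly N k) :
  (forall i, Q i -> ordge d (f i)) -> ordge d (\sum_(i <- r | Q i) f i).
Proof. move=> of_; elim/big_ind: _ => //; [exact: ordge_0 | exact: ordgeD]. Qed.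

Lemma ordgeM d d' p q : ordge d p -> ordge d' q -> ordge (d + d') (p * q).
Proof.
move=> op oq m md; rewrite mcoeffM big1 // => -[m1 m2] /= /eqP em.
have lt : (mdeg m1 + mdeg m2 < d + d')%N by rewrite -mdegD -em.
have [lt1|ge1] := ltnP (mdeg m1) d; first by rewrite op ?mul0r.
rewrite [q@__]oq ?mulr0 //; rewrite -(ltn_add2l d).
by apply: leq_ltn_trans lt; rewrite leq_add2r.
Qed.

Lemma degleM d d' p q : degle d p -> degle d' q -> degle (d + d') (p * q).
Proof.
move=> op oq m md; rewrite mcoeffM big1 // => -[m1 m2] /= /eqP em.
have lt : (d + d' < mdeg m1 + mdeg m2)%N by rewrite -mdegD -em.
have [lt1|ge1] := ltnP d (mdeg m1); first by rewrite op ?mul0r.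
rewrite [q@__]oq ?mulr0 //; rewrite -(ltn_add2l d).
by apply: leq_trans lt _; rewrite leq_add2r.
Qed.

Lemma ordge_ind d (Q : mpoly N k -> Prop) : Q 0 ->
  (forall p q, Q p -> Q q -> Q (p + q)) ->
  (forall a m, (d <= mdeg m)%N -> Q (a *: 'X_[m])) -> forall p, ordge d p -> Q p.
Proof.
move=> Q0 QD QX p op; rewrite (mpolyE p).
apply: big_ind => // m _; have [lt|ge] := ltnP (mdeg m) d; last exact: QX.
by rewrite op // scale0r.
Qed.

Lemma ordge1P p : ordge 1 p <-> p@_0%MM = 0.
Proof.
split=> [op|e m]; first by apply: op; rewrite mdeg0.
by rewrite ltnS leqn0 mdeg_eq0 => /eqP->.
Qed.

Lemma mcoeff0_var i p : ('X_i * p)@_0%MM = 0.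
Proof.
apply/ordge1P; rewrite -[1%N]addn0; apply: ordgeM => //.
by apply/ordge1P; rewrite mcoeffX -mdeg_eq0 mdeg1.
Qed.

Lemma mcoeff0M p q : (p * q)@_0%MM = p@_0%MM * q@_0%MM.
Proof.
elim/mpoly_ind: p => [a|p p' ep ep'|i p ep].
- by rewrite mul_mpolyC mcoeffZ mcoeffC eqxx mulr1.
- by rewrite mulrDl !mcoeffD ep ep' mulrDl.
- by rewrite -mulrA !mcoeff0_var mul0r.
Qed.

End OrderFiltration.

(** Let p0 be the part of p below degree d. Then l p0 has degree at most d, but it differs from l p,
    and hence from 0, only in order d + 1 and above. So l p0 = 0, and p0 = 0 in a domain. *)
Lemma ordge_linear (N : nat) (k : idomainType) (l : mpoly N k) d p :
  l != 0 -> ordge 1 l -> degle 1 l -> ordge d.+1 (l * p) -> ordge d p.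
Proof.
move=> l0 ol dl olp.
pose p0 : mpoly N k := \sum_(m <- msupp p | (mdeg m < d)%N) p@_m *: 'X_[m].
have p0E m : p0@_m = if (mdeg m < d)%N then p@_m else 0.
  rewrite /p0 raddf_sum /=; have [mp|/memN_msupp_eq0 e] := boolP (m \in msupp p); last first.
    rewrite e if_same big1_seq // => m' _; rewrite mcoeffZ mcoeffX.
    by case: eqP => [->|_]; rewrite ?e ?mul0r ?mulr0.
  rewrite -big_filter; case: ifP => md.
    rewrite (bigD1_seq m) ?mem_filter ?md ?filter_uniq ?msupp_uniq //=.
    rewrite mcoeffZ mcoeffX eqxx mulr1 big1 ?addr0 // => m' mm'.
    by rewrite mcoeffZ mcoeffX (negPf mm') mulr0.
  rewrite big1_seq // => m'; rewrite mem_filter => /andP[_ /andP[md' _]].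
  rewrite mcoeffZ mcoeffX; case: eqP => [e|_]; last by rewrite mulr0.
  by rewrite e md in md'.
clearbody p0; case: d olp p0E => [|d] olp p0E; first exact: ordge0p.
have d0 : degle d p0 by move=> m dm; rewrite p0E ltnS leqNgt dm.
have e0 : l * p0 = 0.
  apply/mpolyP => m; rewrite mcoeff0.
  have [lt|ge] := ltnP (mdeg m) d.+2; last first.
    by apply: (degleM dl d0); rewrite add1n.
  have -> : l * p0 = l * p - l * (p - p0) by rewrite mulrBr opprB addrC subrK.
  have o2 : ordge d.+2 (l * (p - p0)).
    rewrite -add1n; apply: ordgeM => // m' md; by rewrite mcoeffB p0E md subrr.
  by rewrite mcoeffB olp // o2 // subrr.
move/eqP: e0; rewrite mulf_eq0 (negPf l0) /= => /eqP e0 m md.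
by have := p0E m; rewrite e0 mcoeff0 md.
Qed.

(** * Powers of a centrally generated ideal and idempotents modulo them *)

Section CentralIdeals.
Variables (A : pzRingType) (D : A -> Prop).

Inductive ideal_sum (J : A -> Prop) : A -> Prop :=
| IdealSum0 : ideal_sum J 0
| IdealSumD d h x : D d -> J h -> ideal_sum J x -> ideal_sum J (d * h + x).

(* The powers of the ideal generated by D, when D is central. *)
Fixpoint ipow (m : nat) : A -> Prop :=
  if m is m'.+1 then ideal_sum (ipow m') else fun=> True.

Hypothesis Dc : forall d, D d -> central d.

Lemma ipow0 m : ipow m 0. Proof. by case: m => // m; left. Qed.
Lemma ipowD m x y : ipow m x -> ipow m y -> ipow m (x + y).
Proof.
case: m => // m /= Jx Jy; elim: Jx => [|d h z Dd Jh _ IH]; first by rewrite add0r.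
by rewrite -addrA; apply: IdealSumD.
Qed.
Lemma ipow_gen m d h : D d -> ipow m h -> ipow m.+1 (d * h).
Proof. by move=> Dd Jh; rewrite -[d * h]addr0; apply: IdealSumD => //; left. Qed.
Lemma ipowMl m a x : ipow m x -> ipow m (a * x).
Proof.
elim: m a x => // m IHm a x /= Jx; elim: Jx => [|d h z Dd Jh _ IH]; first by rewrite mulr0; left.
by rewrite mulrDr mulrA -(Dc Dd) -mulrA; apply: IdealSumD => //; apply: IHm.
Qed.
Lemma ipowMr m a x : ipow m x -> ipow m (x * a).
Proof.
elim: m a x => // m IHm a x /= Jx; elim: Jx => [|d h z Dd Jh _ IH]; first by rewrite mul0r; left.
by rewrite mulrDl -mulrA; apply: IdealSumD => //; apply: IHm.
Qed.
Lemma ipowN m x : ipow m x -> ipow m (- x).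
Proof. by rewrite -mulN1r; apply: ipowMl. Qed.
Lemma ipowB m x y : ipow m x -> ipow m y -> ipow m (x - y).
Proof. by move=> Jx Jy; apply/ipowD/ipowN. Qed.
Lemma ipowS m x : ipow m.+1 x -> ipow m x.
Proof.
elim=> [|d h z Dd Jh _ IH]; first exact: ipow0.
by apply: ipowD => //; apply: ipowMl.
Qed.
Lemma ipow_le m m' x : (m <= m')%N -> ipow m' x -> ipow m x.
Proof.
move/subnKC <-; elim: (m' - m)%N => [|d IHd]; first by rewrite addn0.
by rewrite addnS => /ipowS.
Qed.
Lemma ipowM m m' x y : ipow m x -> ipow m' y -> ipow (m + m') (x * y).
Proof.
elim: m x => [|m IHm] x; first by move=> _; apply: ipowMl.
move=> /= Jx Jy; elim: Jx => [|d h z Dd Jh _ IH]; first by rewrite mul0r; left.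
by rewrite mulrDl -mulrA; apply: IdealSumD => //; apply: IHm.
Qed.
Lemma ipowX m x : ipow 1 x -> ipow m (x ^+ m).
Proof.
move=> Jx; elim: m => // m IHm; rewrite exprS -add1n; exact: ipowM.
Qed.

Definition centralmod m e := forall a, ipow m (e * a - a * e).
Definition idemmod m e := ipow m (e * e - e).

Lemma comm_ipow m j e x : centralmod m e -> ipow j x -> ipow (j + m) (e * x - x * e).
Proof.
move=> ce; elim: j x => [|j IHj] x; first by move=> _; apply: ce.
move=> /= Jx; elim: Jx => [|d h z Dd Jh _ IH]; first by rewrite mulr0 mul0r subrr; left.
have -> : e * (d * h + z) - (d * h + z) * e = d * (e * h - h * e) + (e * z - z * e).
  by rewrite mulrDr mulrDl mulrA -(Dc Dd) mulrBr opprD addrACA !mulrA.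
by apply: IdealSumD => //; apply: IHj.
Qed.

(* f a (1 - f) lies in the j-th power and equals its commutator with f. *)
Lemma idem_central j m f : (j.+1 <= m)%N -> (0 < j)%N ->
  idemmod m f -> centralmod j f -> centralmod j.+1 f.
Proof.
move=> jm j0 If cf a; have If' : ipow j.+1 (f * f - f) by apply: ipow_le If.
have ff : ipow j.+1 (f * (1 - f)) by rewrite mulrBr mulr1 -opprB; apply: ipowN.
have ff' : ipow j.+1 ((1 - f) * f) by rewrite mulrBl mul1r -opprB; apply: ipowN.
have le2 : (j.+1 <= j + j)%N by rewrite -addn1 leq_add2l.
have J1 : ipow j.+1 (f * a * (1 - f)).
  set x := f * a * (1 - f).
  have Jx : ipow j x.
    have -> : x = (f * a - a * f) * (1 - f) + a * (f * (1 - f)).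
      by rewrite mulrBl -!mulrA subrK mulrA.
    by apply: ipowD; [apply/ipowMr/cf | apply/ipowMl/ipowS].
  have -> : x = (f * x - x * f) - (f * f - f) * a * (1 - f) + f * a * ((1 - f) * f).
    have -> : (f * f - f) * a * (1 - f) = f * x - x by rewrite !mulrBl /x !mulrA.
    have -> : f * a * ((1 - f) * f) = x * f by rewrite /x !mulrA.
    by rewrite opprB addrAC subrK addrCA subrr addr0.
  apply: ipowD; last exact: ipowMl.
  apply: ipowB; last by do 2!apply: ipowMr.
  by apply: ipow_le (comm_ipow cf Jx).
have J2 : ipow j.+1 ((1 - f) * a * f).
  set x := (1 - f) * a * f.
  have Jx : ipow j x.
    have -> : x = ((1 - f) * f) * a - (1 - f) * (f * a - a * f).
      by rewrite /x mulrBr !mulrA opprB addrCA subrr addr0.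
    by apply: ipowB; [apply/ipowMr/ipowS | apply/ipowMl/cf].
  have -> : x = f * (1 - f) * a * f - (f * x - x * f) - (1 - f) * a * (f * f - f).
    have -> : f * (1 - f) * a * f = f * x by rewrite /x !mulrA.
    have -> : (1 - f) * a * (f * f - f) = x * f - x by rewrite mulrBr /x !mulrA.
    by rewrite !opprB [f * x + _]addrCA subrr addr0 addrCA subrr addr0.
  apply: ipowB; last exact: ipowMl.
  apply: ipowB; first by do 2!apply: ipowMr.
  by apply: ipow_le (comm_ipow cf Jx).
have -> : f * a - a * f = f * a * (1 - f) - (1 - f) * a * f.
  by rewrite mulrBr mulr1 !mulrBl mul1r opprB addrA subrK.
exact: ipowB.
Qed.

Lemma idem_exp_mod x m : ipow 1 (x * x - x) -> ipow 1 (x ^+ m.+1 - x).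
Proof.
move=> Ix; elim: m => [|m IHm]; first by rewrite expr1 subrr; left.
have -> : x ^+ m.+2 - x = x * (x ^+ m.+1 - x) + (x * x - x).
  by rewrite mulrBr -exprS addrA subrK.
by apply: ipowD => //; apply: ipowMl.
Qed.

(** With M = m + 1 and f = 1 - (1 - e^M)^M, f is divisible by e^M and 1 - f by (1 - e)^M, all
    factors being polynomials in e; so f (1 - f) lies in the M-th power. Centrality then improves by
    one power at a time through [idem_central]. *)
Lemma lift_idempotent m e : centralmod 1 e -> idemmod 1 e ->
  exists f, [/\ ipow 1 (f - e), centralmod m.+1 f & idemmod m.+1 f].
Proof.
move=> ce Ie; pose M := m.+1; pose g := 1 - e ^+ M; pose f := 1 - g ^+ M.
have eM : ipow 1 (e ^+ M - e) by apply: idem_exp_mod.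
have gE : ipow 1 (g - (1 - e)) by rewrite /g opprB addrAC addrCA subrr addr0 -opprB; apply: ipowN.
have gI : ipow 1 (g * g - g).
  have -> : g * g - g = (g - (1 - e)) * g - (e * (g - (1 - e)) + (e - e * e)).
    have -> : e * (g - (1 - e)) + (e - e * e) = e * g by rewrite !mulrBr mulr1 subrK.
    have -> : g - (1 - e) = g - 1 + e by rewrite opprB addrA addrAC.
    by rewrite -mulrBl addrK [RHS]mulrBl mul1r.
  apply: ipowB; first exact: ipowMr.
  by apply: ipowD; [apply: ipowMl | rewrite -opprB; apply: ipowN].
have fE : ipow 1 (f - e).
  have -> : f - e = - ((g ^+ M - g) + (g - (1 - e))).
    by rewrite /f [_ + (g - _)]addrA subrK opprB addrAC.
  by apply/ipowN/ipowD => //; apply: idem_exp_mod.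
have If : idemmod M f.
  have cR : GRing.comm e (\sum_(i < M) e ^+ i) by apply: commr_sum => i _; apply: commrX.
  set R := \sum_(i < M) e ^+ i in cR.
  have gR : g = (1 - e) * R by rewrite /g -opprB subrX1 -mulNr opprB.
  have cg : GRing.comm e g by rewrite /g; apply: commrB; [apply: commr1 | apply: commrX].
  pose S := \sum_(i < M) g ^+ i.
  have cS : GRing.comm e S by apply: commr_sum => i _; apply: commrX.
  have fS : f = e ^+ M * S.
    rewrite /f -opprB subrX1 -mulNr opprB /g opprB addrCA subrr addr0 //.
  have c1 : GRing.comm (1 - e) R by apply: commr_sym; apply: commrB; [exact: commr1 | exact: commr_sym].
  have c2 : GRing.comm S (1 - e) by apply: commrB; [exact: commr1 | exact: commr_sym].
  rewrite /idemmod; have -> : f * f - f = - ((e * (1 - e)) ^+ M * (S * R ^+ M)).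
    have idem_opp x : x * x - x = - (x * (1 - x)) by rewrite mulrBr mulr1 opprB.
    rewrite idem_opp.
    have -> : 1 - f = (1 - e) ^+ M * R ^+ M by rewrite /f opprB addrCA subrr addr0 gR exprMn_comm.
    rewrite fS exprMn_comm; last by apply: commrB; [exact: commr1 | exact: commr_refl].
    congr (- _); rewrite -!mulrA; congr (_ * _); rewrite !mulrA; congr (_ * _).
    exact: commrX.
  apply/ipowN/ipowMr/ipowX; rewrite mulrBr mulr1 -opprB; exact: ipowN.
exists f; split=> //.
have cf1 : centralmod 1 f.
  move=> a; have -> : f * a - a * f = (f - e) * a - a * (f - e) + (e * a - a * e).
    by rewrite [(f - e) * a]mulrBl [a * (f - e)]mulrBr opprB addrAC !addrA !subrK.
  by apply: ipowD => //; apply: ipowB; [apply: ipowMr | apply: ipowMl].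
have H j : (j < M)%N -> centralmod j.+1 f.
  elim: j => // j IHj jM; apply: (@idem_central j.+1 M) => //.
  by apply: IHj; apply: ltnW.
exact: H.
Qed.

Lemma ipow1P x : ipow 1 x <-> ideal_gen D x.
Proof.
split; first by elim=> [|d h z Dd _ _ IH]; [left | rewrite -[d]mul1r; right].
elim=> [|a s b z Ds _ IH]; first by left.
by apply: ipowD => //; rewrite -mulrA; apply/ipowMl/ipow_gen.
Qed.

End CentralIdeals.

(* Expand prod_(g in G) (T - x g) at T = x 1. *)
Lemma orbit_poly (gT : finGroupType) (G : {group gT}) (A : comNzRingType) (x : gT -> A) :
  exists e : nat -> A,
  [/\ forall (s : {rmorphism A -> A}) h, h \in G ->
        (forall g, g \in G -> s (x g) = x (h * g)%g) -> forall j, s (e j) = e j,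
      forall (B : comNzRingType) (s : {rmorphism A -> B}),
        (forall g, s (x g) = 0) -> forall j, (j < #|G|)%N -> s (e j) = 0
    & x 1%g ^+ #|G| = \sum_(j < #|G|) e j * x 1%g ^+ j].
Proof.
pose Q : {poly A} := \prod_(g in G) ('X - (x g)%:P).
have sQ : size Q = #|G|.+1 by rewrite /Q -big_enum size_prod_XsubC -cardE.
have mQ : Q \is monic by rewrite /Q -big_enum monic_prod_XsubC.
have rQ : Q.[x 1%g] = 0.
  by rewrite horner_prod (bigD1 1%g) ?group1 //= hornerXsubC subrr mul0r.
exists (fun j => - Q`_j); split=> [s h Gh sx j|B s sx j jG|].
- rewrite rmorphN -coef_map; suff -> : map_poly s Q = Q by [].
  rewrite /Q rmorph_prod [RHS](reindex_inj (mulgI h)) /=.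
  apply: eq_big => [g|g Gg]; first by rewrite groupMl.
  by rewrite rmorphB /= map_polyX map_polyC /= sx.
- rewrite rmorphN -coef_map.
  have -> : map_poly s Q = 'X^#|G|.
    rewrite /Q rmorph_prod /= (eq_bigr (fun=> 'X)) ?prodr_const // => g Gg.
    by rewrite rmorphB /= map_polyX map_polyC /= sx subr0.
  by rewrite coefXn (ltn_eqF jG) oppr0.
- move: rQ; rewrite horner_coef sQ big_ord_recr /=.
  have -> : Q`_#|G| = 1 by move/monicP: mQ; rewrite lead_coefE sQ.
  rewrite mul1r => /eqP; rewrite addrC addr_eq0 => /eqP->.
  by rewrite -sumrN; apply: eq_bigr => j _; rewrite mulNr.
Qed.

(** * Powers of a variable in the ideal of invariants *)

Section InvariantPowers.
Variables (gT : finGroupType) (G : {group gT}) (n : nat) (F : fieldType).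
Variable M : gT -> 'M[F]_n.
Hypothesis MM : forall g h, g \in G -> h \in G -> M g *m M h = M (h * g)%g.
Hypothesis M1 : M 1%g = 1%:M.

Lemma msubst_comp (A B : 'M[F]_n) f : msubst A (msubst B f) = msubst (B *m A) f.
Proof.
elim/mpoly_ind: f => [a|f g ef eg|i f ef].
- by rewrite !msubstC.
- by rewrite !msubstD ef eg.
- rewrite !msubstM ef !msubstX; congr (_ * _).
  rewrite (big_morph (msubst A) (msubstD A) (_ : _ = 0)); last by rewrite -mpolyC0 msubstC.
  under eq_bigr do rewrite msubstZ msubstX scaler_sumr.
  rewrite exchange_big; apply: eq_bigr => j _ /=.
  by rewrite mxE scaler_suml; apply: eq_bigr => l _; rewrite scalerA.
Qed.

Lemma msubst1 f : msubst (1%:M : 'M[F]_n) f = f.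
Proof.
elim/mpoly_ind: f => [a|f g ef eg|i f ef]; first by rewrite msubstC.
  by rewrite msubstD ef eg.
rewrite msubstM ef msubstX (bigD1 i) //= mxE eqxx scale1r big1 ?addr0 // => j ji.
by rewrite mxE eq_sym (negPf ji) scale0r.
Qed.

Lemma msubst_rmorphism (A : 'M[F]_n) :
  exists s : {rmorphism mpoly n F -> mpoly n F}, forall f, s f = msubst A f.
Proof. by exists (comp_mpoly [tuple \sum_l A i l *: 'X_l | i < n]). Qed.

(** The coefficients of prod_(g in G) (T - g X_i) are invariant, and those below the top have no
    constant term because no g X_i has one. Products are reversed in [MM] because substitutions
    compose in the opposite order. *)
Lemma invariant_power (i : 'I_n) : exists e : nat -> mpoly n F,
  [/\ forall j h, h \in G -> msubst (M h) (e j) = e j,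
      forall j, (j < #|G|)%N -> (e j)@_0%MM = 0
    & 'X_i ^+ #|G| = \sum_(j < #|G|) e j * 'X_i ^+ j].
Proof.
have [e [e1 e2 e3]] := orbit_poly G (fun g => msubst (M g) 'X_i : mpoly n F).
rewrite M1 msubst1 in e3; exists e; split=> // [j h Gh|j jG].
  have [s sE] := msubst_rmorphism (M h); rewrite -sE.
  by apply: (e1 s h) => // g Gg; rewrite sE msubst_comp MM.
have /(_ (mcoeff 0%MM : {rmorphism mpoly n F -> F})) := e2 F; apply=> // g.
rewrite msubstX raddf_sum big1 //= => l _.
by rewrite mcoeffZ mcoeffX -mdeg_eq0 mdeg1 mulr0.
Qed.

End InvariantPowers.

(** * The centre at t = 0 and constant terms *)

Section Center.
Variables (F : fieldType) (gT : finGroupType) (G : {group gT}) (n : nat).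
Variable rG : mx_representation F G n.
Variables (alpha : gT -> 'cV[F]_n) (alphav : gT -> 'rV[F]_n) (c : gT -> F).
Hypothesis two_neq0 : 2 != 0 :> F.
Hypothesis rootP : forall s, s \in reflections rG -> root_coroot rG s (alpha s) (alphav s).

Local Notation P := (mpoly (n + n) F).
Local Notation V := (dunkl_space gT n F).
Variables (H : pzRingType) (sc : {rmorphism F -> H}) (hY : 'rV[F]_n -> H).
Variables (hX : 'cV[F]_n -> H) (hT : gT -> H) (co : H -> V).
Hypothesis pb : pbw_ring rG alpha alphav c idfun 0 sc hY hX hT co.
Local Notation ev := (ev G sc hY hX hT).
Local Notation evp := (evp sc hY hX).
Local Notation evX := (evX sc hX).
Local Notation evY := (evY sc hY).
Let act := pbw_act pb.
Let scC := pbw_scC pb.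

Let X_ i := hX (delta_mx i 0).
Let Y_ i := hY (delta_mx 0 i).
Let XC i j : X_ i * X_ j = X_ j * X_ i. Proof. exact: (ca_XX act). Qed.
Let YC i j : Y_ i * Y_ j = Y_ j * Y_ i. Proof. exact: (ca_YY act). Qed.
Let scX a i : sc a * X_ i = X_ i * sc a. Proof. exact: scC. Qed.
Let scY a i : sc a * Y_ i = Y_ i * sc a. Proof. exact: scC. Qed.
Let refG s : s \in reflections rG -> s \in G. Proof. exact: refl_mem. Qed.

Lemma pbw_central w : (forall x, hX x * w = w * hX x) -> (forall y, hY y * w = w * hY y) ->
  (forall g, g \in G -> hT g * w = w * hT g) -> central w.
Proof.
move=> wX wY wT h; elim/(pbw_ind pb): h => [a|y|x|g Gg|h h' e e'|h h' e e'].
- by rewrite scC.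
- by rewrite wY.
- by rewrite wX.
- by rewrite wT.
- by rewrite mulrDr mulrDl e e'.
- by rewrite mulrA e -mulrA e' mulrA.
Qed.

Lemma evX_X f x : evX f * hX x = hX x * evX f.
Proof.
by symmetry; apply: wev_comm => // i; rewrite (ca_XX act).
Qed.

Lemma evY_Y f y : evY f * hY y = hY y * evY f.
Proof.
by symmetry; apply: wev_comm => // i; rewrite (ca_YY act).
Qed.

Lemma pairing_delta (y : 'rV[F]_n) i : pairing y (delta_mx i 0) = y 0 i.
Proof. by rewrite /pairing -colE mxE. Qed.
Lemma pairing_deltal (x : 'cV[F]_n) i : pairing (delta_mx 0 i) x = x i 0.
Proof. by rewrite /pairing -rowE mxE. Qed.

(** Invariance is required only under reflections with nonzero parameter. In the algebra of W, with
    a parameter vanishing off K, this admits polynomials that are invariant under K alone. *)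
Lemma evX_Y f : (forall s, s \in reflections rG -> c s = 0 \/ msubst (rG s)^T f = f) ->
  forall y, hY y * evX f = evX f * hY y.
Proof.
move=> fA y.
apply: (invariant_wev_comm scC XC (A := reflections rG) (T := hT)
  (b := fun s => - (c s * pairing y (alpha s))) (be := fun s i => alphav s 0 i)
  (al := fun s j => root_factor rG s * alpha s j 0) (M := fun s => (rG s)^T)).
- move=> s i Rs; rewrite (ca_TX act) ?refG //; congr (_ * _); rewrite (hX_sumE act).
  by apply: eq_bigr => j _; rewrite -colE !mxE.
- move=> s i j Rs; have [_ e] := root_factorE two_neq0 (refG Rs) (rootP Rs).
  rewrite {1}e !mxE big_ord1 eq_sym; congr (_ + _); ring.
- move=> i; rewrite (ca_YX act) mul0r rmorph0 sub0r -sumrN; apply: eq_bigr => s Rs.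
  by rewrite pairing_delta /= mulNr rmorphN mulNr.
move=> s Rs; have [->|->] := fA s Rs; first by left; rewrite mul0r oppr0.
right; split=> //; have [k0 _] := root_factorE two_neq0 (refG Rs) (rootP Rs).
have := alpha_neq0 two_neq0 rootP Rs; rewrite -(inj_eq (@trmx_inj _ _ _)) trmx0.
case/rV0Pn => j; rewrite mxE => aj; exists j; by rewrite mulf_neq0.
Qed.

Lemma evY_X f : (forall s, s \in reflections rG -> msubst (rG s^-1%g) f = f) ->
  forall x, hX x * evY f = evY f * hX x.
Proof.
move=> fA x.
apply: (invariant_wev_comm scC YC (A := reflections rG) (T := hT)
  (b := fun s => c s * pairing (alphav s) x) (be := fun s i => alpha s i 0)
  (al := fun s j => - root_factor rG s * (alphav s *m rG s^-1%g) 0 j)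
  (M := fun s => rG s^-1%g)).
- move=> s i Rs; rewrite (ca_TY act) ?refG //; congr (_ * _); rewrite (hY_sumE act).
  by apply: eq_bigr => j _; rewrite -rowE !mxE.
- move=> s i j Rs; have [_ e] := root_factorE two_neq0 (refG Rs) (rootP Rs).
  have e1 : (rG s - 1%:M) *m rG s^-1%g = 1%:M - rG s^-1%g.
    by rewrite mulmxBl mul1mx -repr_mxM ?groupV ?refG // mulgV repr_mx1.
  have e2 : rG s - 1%:M = root_factor rG s *: (alpha s *m alphav s).
    by rewrite {1}e addrC addKr.
  have -> : rG s^-1%g i j =
      (1%:M - root_factor rG s *: (alpha s *m (alphav s *m rG s^-1%g))) i j.
    by rewrite mulmxA scalemxAl -e2 e1 opprB addrCA subrr addr0.
  move: (alphav s *m _) => w; rewrite !mxE big_ord1; ring.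
- move=> i; rewrite -opprB (ca_YX act) mul0r rmorph0 sub0r opprK; apply: eq_bigr => s Rs.
  by rewrite pairing_deltal /= mulrAC.
move=> s Rs; right; split; first exact: fA.
have [k0 _] := root_factorE two_neq0 (refG Rs) (rootP Rs).
have: alphav s *m rG s^-1%g != 0.
  have [_ _ pa] := rootP Rs; apply: contra_neq two_neq0 => e.
  have e2 : alphav s = 0.
    by rewrite -[LHS]mulmx1 -(repr_mx1 rG) -(mulVg s) repr_mxM ?groupV ?refG // mulmxA e mul0mx.
  by rewrite -pa e2 /pairing mul0mx mxE.
by case/rV0Pn => j aj; exists j; rewrite mulf_neq0 ?oppr_eq0.
Qed.

Lemma evX_central f : invariant_on_h rG f -> central (evX f).
Proof.
move=> fI; apply: pbw_central => [x|y|g Gg]; first by rewrite evX_X.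
  by apply: evX_Y => s /refG Gs; right; apply: fI.
have e : msubst (rG g)^T f = f := fI g Gg.
by rewrite (hT_evX pb) // map_mx_id // e.
Qed.

Lemma evY_central f : invariant_on_dual rG f -> central (evY f).
Proof.
move=> fI; apply: pbw_central => [x|y|g Gg]; last 1 first.
- have e : msubst (rG g^-1%g) f = f := fI g Gg.
  by rewrite (hT_evY pb) // map_mx_id // e.
- by apply: evY_X => s /refG Gs; apply: fI.
- by rewrite evY_Y.
Qed.

(** The counterpart of [D_plus] in an abstract PBW ring. *)
Definition dplus (d : H) : Prop := exists s : seq (mpoly n F * mpoly n F),
    [/\ forall fg, fg \in s -> invariant_on_h rG fg.1 /\ invariant_on_dual rG fg.2,
        \sum_(fg <- s) fg.1@_0%MM * fg.2@_0%MM = 0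
      & d = \sum_(fg <- s) evX fg.1 * evY fg.2].

Lemma dplus_central d : dplus d -> central d.
Proof.
case=> s [sI _ ->] h; rewrite mulr_suml mulr_sumr !big_seq; apply: eq_bigr => fg /sI[I1 I2].
by rewrite -mulrA (evY_central I2) mulrA (evX_central I1) mulrA.
Qed.

Lemma membed_coef0 (h : 'I_n -> 'I_(n + n)) (f : mpoly n F) : (membed F h f)@_0%MM = f@_0%MM.
Proof.
elim/mpoly_ind: f => [a|f g ef eg|i f ef].
- by rewrite membedC !mcoeffC !eqxx.
- by rewrite rmorphD !mcoeffD ef eg.
- by rewrite rmorphM membedX !mcoeff0_var.
Qed.

(** The X-factor multiplies coordinates on the left. The Y-factor is central, so it can be moved to
    the far right, where its invariance lets it pass every T g. *)
Lemma co_dplus d : dplus d -> exists2 p, ordge 1 p & forall h g, co (d * h) g = p * co h g.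
Proof.
case=> s [sI s0 ->]; exists (\sum_(fg <- s) pX n F fg.1 * pY n F fg.2).
  apply/ordge1P; rewrite raddf_sum /= -[RHS]s0; apply: eq_bigr => fg _.
  by rewrite mcoeff0M !membed_coef0.
move=> h g; rewrite mulr_suml (co_sum pb) sumV mulr_suml !big_seq.
apply: eq_bigr => fg /sI[I1 I2]; rewrite -mulrA (co_evX pb) -mulrA; congr (_ * _).
have inv2 x : x \in G -> msubst (map_mx idfun (rG x^-1%g)) fg.2 = fg.2.
  by move=> Gx; rewrite map_mx_id //; apply: I2.
by rewrite (evY_central I2 h) (co_evYr pb h g inv2); apply: mulrC.
Qed.

Lemma ipow_ord m h : ipow dplus m h -> forall g, ordge m (co h g).
Proof.
elim: m h => [|m IHm] h; first by move=> _ g; apply: ordge0p.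
move=> /= J; elim: J => [|d x z Dd Jx _ IH] g.
  by rewrite (co0 pb) ffunE; apply: ordge_0.
rewrite (coD pb) VDE; apply: ordgeD => //.
have [p op ->] := co_dplus Dd; rewrite -add1n; apply: ordgeM => //; exact: IHm.
Qed.

Lemma X_pow_ipow i : ipow dplus 1 (X_ i ^+ #|G|).
Proof.
have MM g h : g \in G -> h \in G -> (rG g)^T *m (rG h)^T = (rG (h * g)%g)^T.
  by move=> Gg Gh; rewrite -trmx_mul repr_mxM.
have [e [eI e0 eX]] := invariant_power MM (etrans (congr1 trmx (repr_mx1 _)) (trmx1 _ _)) i.
have -> : X_ i ^+ #|G| = evX ('X_i ^+ #|G|).
  rewrite /evX; elim: (#|G|) => [|d IHd]; first by rewrite !expr0 -mpolyC1 wevC rmorph1.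
  by rewrite !exprS (wevX XC scX) IHd.
rewrite eX /evX (big_morph _ (@wevD _ _ _ _ _) (mlin0 _ _)).
apply: big_ind => [|x y|j _]; [exact: ipow0 | exact: ipowD |].
rewrite (wevM XC scX); apply: ipow_gen => //.
exists [:: (e j, 1)]; rewrite !big_seq1 /= e0 // mul0r; split=> // [fg|].
  rewrite inE => /eqP -> /=; split=> g Gg; first exact: eI.
  by rewrite /subst_invariant -mpolyC1 comp_mpolyC.
by rewrite -mpolyC1 /evY wevC rmorph1 mulr1.
Qed.

Lemma Y_pow_ipow i : ipow dplus 1 (Y_ i ^+ #|G|).
Proof.
have MM g h : g \in G -> h \in G -> rG g^-1%g *m rG h^-1%g = rG (h * g)^-1%g.
  by move=> Gg Gh; rewrite -repr_mxM ?groupV // invMg.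
have M1 : rG (1^-1)%g = 1%:M by rewrite invg1 repr_mx1.
have [e [eI e0 eX]] := invariant_power MM M1 i.
have -> : Y_ i ^+ #|G| = evY ('X_i ^+ #|G|).
  rewrite /evY; elim: (#|G|) => [|d IHd]; first by rewrite !expr0 -mpolyC1 wevC rmorph1.
  by rewrite !exprS (wevX YC scY) IHd.
rewrite eX /evY (big_morph _ (@wevD _ _ _ _ _) (mlin0 _ _)).
apply: big_ind => [|x y|j _]; [exact: ipow0 | exact: ipowD |].
rewrite (wevM YC scY); apply: ipow_gen => //.
exists [:: (1, e j)]; rewrite !big_seq1 /= e0 // mulr0; split=> // [fg|].
  rewrite inE => /eqP -> /=; split=> g Gg; last exact: eI.
  by rewrite /subst_invariant -mpolyC1 comp_mpolyC.
by rewrite -mpolyC1 /evX wevC rmorph1 mul1r.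
Qed.

(** By pigeonhole, a monomial of at least this degree in 2n variables has an exponent at least #|G|.
    Thanks to the successor this also holds for n = 0, where the only monomial has degree 0. *)
Definition ord_bound := ((n + n) * #|G|).+1.

Lemma monomial_ipow m : (ord_bound <= mdeg m)%N -> ipow dplus 1 (evp 'X_[m]).
Proof.
move=> dm; have [i mi] : exists i, (#|G| <= m i)%N.
  case: (pickP (fun i => #|G| <= m i)%N) => [i mi|z]; first by exists i.
  move: dm; rewrite mdegE ltnNge -[X in (X * _)%N]card_ord -sum_nat_const leq_sum // => i _.
  by rewrite ltnW // ltnNge z.
have -> : m = (U_(i) *+ #|G| + (m - U_(i) *+ #|G|))%MM.
  rewrite addmC submK //; apply/mnm_lepP => j; rewrite mulmnE mnm1E.
  by case: eqP => [<-|_]; rewrite ?mul1n ?mul0n.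
rewrite mpolyXD -mpolyXn; move: (_ - _)%MM => m'.
have Xl j d q : evp ('X_(lshift n j) ^+ d * q) = X_ j ^+ d * evp q.
  elim: d q => [|d IHd] q; first by rewrite !expr0 !mul1r.
  by rewrite exprSr -mulrA IHd (evp_Xl act scC) mulrA -exprSr.
have Yr j d q : evp ('X_(rshift n j) ^+ d * q) = evp q * Y_ j ^+ d.
  elim: d q => [|d IHd] q; first by rewrite !expr0 mul1r mulr1.
  by rewrite exprS -mulrA (evp_Yr act) IHd -mulrA -exprSr.
case: (split_ordP i) => j ->.
  by rewrite (Xl j #|G| 'X_[m']); exact/ipowMr/X_pow_ipow.
by rewrite (Yr j #|G| 'X_[m']); exact/(ipowMl dplus_central)/Y_pow_ipow.
Qed.

(** A partial converse of [ipow_ord]. As the hypothesis mentions coordinates only, the two together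
    compare the ideals of different groups. *)
Lemma ord_ipow h : (forall g, ordge ord_bound (co h g)) -> ipow dplus 1 h.
Proof.
move=> oh; rewrite -(pbw_evK pb h) /ev.
apply: big_ind => [|x y|g _]; [exact: ipow0 | exact: ipowD |].
apply: ipowMr; apply: (ordge_ind (Q := fun p => ipow dplus 1 (evp p))) (oh g).
- by rewrite evp0; apply: ipow0.
- by move=> p q Jp Jq; rewrite evpD; apply: ipowD.
- move=> a m dm; rewrite -mul_mpolyC evpMC.
  exact/(ipowMl dplus_central)/monomial_ipow.
Qed.

Lemma LX_coef0 x : (LX idfun x : P)@_0%MM = 0.
Proof.
rewrite /LX raddf_sum big1 //= => i _.
by rewrite mcoeffZ mcoeffX -mdeg_eq0 mdeg1 mulr0.
Qed.
Lemma LY_coef0 y : (LY idfun y : P)@_0%MM = 0.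
Proof.
rewrite /LY raddf_sum big1 //= => i _.
by rewrite mcoeffZ mcoeffX -mdeg_eq0 mdeg1 mulr0.
Qed.

(* The image of h modulo X H + H Y, as an element of the group algebra. *)
Definition ct (h : H) (g : gT) : F := (co h g)@_0%MM.

Lemma ctD h h' g : ct (h + h') g = ct h g + ct h' g.
Proof. by rewrite /ct (coD pb) VDE mcoeffD. Qed.
Lemma ctN h g : ct (- h) g = - ct h g.
Proof. by rewrite /ct (coN pb) ffunE mcoeffN. Qed.
Lemma ct_X x h g : ct (hX x * h) g = 0.
Proof.
by rewrite /ct (co_X pb) mcoeff0M LX_coef0 mul0r.
Qed.
Lemma ct_Y y h g : ct (h * hY y) g = 0.
Proof.
rewrite /ct (co_Yr pb) mcoeff0M; case: ifP => _; first by rewrite LY_coef0 mulr0.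
by rewrite mcoeff0 mulr0.
Qed.
Lemma ct_Tr g h x : g \in G -> ct (h * hT g) x = ct h (x * g^-1)%g.
Proof. by move=> Gg; rewrite /ct (co_Tr pb). Qed.
Lemma ct_sc a h g : ct (sc a * h) g = a * ct h g.
Proof. by rewrite /ct (co_sc pb) mul_mpolyC mcoeffZ. Qed.
Lemma gsub_coef0 g (p : P) : (gsub rG idfun g p)@_0%MM = p@_0%MM.
Proof.
elim/(@phase_ind F F idfun n): p => [a|p q ep eq|x p ep|y p ep].
- by rewrite /gsub psubC.
- by rewrite /gsub psubD !mcoeffD ep eq.
- by rewrite /gsub psubM psubX !mcoeff0M !LX_coef0 !mul0r.
- by rewrite /gsub psubM psubY !mcoeff0M !LY_coef0 !mul0r.
Qed.
Lemma ct_T g h x : g \in G -> ct (hT g * h) x = ct h (g^-1 * x)%g.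
Proof. by move=> Gg; rewrite /ct (co_T pb) // gsub_coef0. Qed.
Lemma ct_ipow h g : ipow dplus 1 h -> ct h g = 0.
Proof. by move/ipow_ord/(_ g)/ordge1P. Qed.
Lemma ct_out h g : g \notin G -> ct h g = 0.
Proof. by move=> Gg; rewrite /ct (pbw_supp pb) // mcoeff0. Qed.

(** Modulo the ideal a passes every X, which then stands on the left, while every Y already stands
    on the right; [ct] kills both kinds of terms. *)
Lemma ct_comm_evp a p g : (forall x, ipow dplus 1 (a * hX x - hX x * a)) ->
  ct (a * evp p) g = p@_0%MM * ct a g.
Proof.
move=> aX; elim/(@phase_ind F F idfun n): p => [b|p q ep eq|x p ep|y p ep].
- by rewrite evpC -scC ct_sc mcoeffC eqxx mulr1.
- by rewrite evpD mulrDr ctD ep eq mcoeffD mulrDl.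
- rewrite (evp_LX act scC) mulrA -(subrK (hX x * a) (a * hX x)) mulrDl ctD -mulrA ct_X addr0.
  rewrite (ct_ipow _ (ipowMr _ (aX x))).
  by rewrite mcoeff0M LX_coef0 !mul0r.
- by rewrite (evp_LY act scC) mulrA ct_Y mcoeff0M LY_coef0 !mul0r.
Qed.

Section Character.
Variables (d : nat) (rho : mx_representation F G d).

(* Row vectors carry the left action v |-> v *m rho g^-1, so ctmx reverses products. *)
Definition ctmx (h : H) : 'M[F]_d := \sum_(g in G) ct h g *: rho g^-1%g.

Lemma ctmxD h h' : ctmx (h + h') = ctmx h + ctmx h'.
Proof. by rewrite /ctmx -big_split; apply: eq_bigr => g _; rewrite ctD scalerDl. Qed.
Lemma ctmx0 : ctmx 0 = 0.
Proof. by have := ctmxD 0 0; rewrite addr0 -{1}[ctmx 0]addr0 => /addrI. Qed.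
Lemma ctmxN h : ctmx (- h) = - ctmx h.
Proof. by apply/eqP; rewrite -subr_eq0 opprK -ctmxD addNr ctmx0. Qed.
Lemma ctmx_X x h : ctmx (hX x * h) = 0.
Proof. by rewrite /ctmx big1 // => g _; rewrite ct_X scale0r. Qed.
Lemma ctmx_Y y h : ctmx (h * hY y) = 0.
Proof. by rewrite /ctmx big1 // => g _; rewrite ct_Y scale0r. Qed.
Lemma ctmx_sc a h : ctmx (sc a * h) = a *: ctmx h.
Proof. by rewrite /ctmx scaler_sumr; apply: eq_bigr => g _; rewrite ct_sc scalerA. Qed.
Lemma ctmx_Tr g h : g \in G -> ctmx (h * hT g) = rho g^-1%g *m ctmx h.
Proof.
move=> Gg; rewrite /ctmx mulmx_sumr (reindex_inj (mulIg g)) /=.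
apply: eq_big => [x|x Gx]; first by rewrite groupMr.
have Gx' : x \in G by rewrite -(groupMr x Gg).
by rewrite ct_Tr // mulgK invMg repr_mxM ?groupV // scalemxAr.
Qed.
Lemma ctmx_T g h : g \in G -> ctmx (hT g * h) = ctmx h *m rho g^-1%g.
Proof.
move=> Gg; rewrite /ctmx mulmx_suml (reindex_inj (mulgI g)) /=.
apply: eq_big => [x|x Gx]; first by rewrite groupMl.
have Gx' : x \in G by rewrite -(groupMl x Gg).
by rewrite ct_T // mulKg invMg repr_mxM ?groupV // scalemxAl.
Qed.
Lemma ctmx1 : ctmx 1 = 1%:M.
Proof.
rewrite /ctmx (bigD1 1%g) ?group1 //= big1 => [|g /andP[_ g1]].
  by rewrite /ct (co_1 pb) eqxx mcoeff1 eqxx scale1r invg1 repr_mx1 addr0.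
by rewrite /ct (co_1 pb) (negPf g1) mcoeff0 scale0r.
Qed.
Lemma ctmx_ipow h : ipow dplus 1 h -> ctmx h = 0.
Proof. by move=> Jh; rewrite /ctmx big1 // => g _; rewrite ct_ipow // scale0r. Qed.

Lemma ctmx_comm a b : (forall x, ipow dplus 1 (a * hX x - hX x * a)) ->
  ctmx (a * b) = ctmx b *m ctmx a.
Proof.
move=> aX; rewrite -{1}(pbw_evK pb b) /ev mulr_sumr (big_morph ctmx ctmxD ctmx0).
rewrite [ctmx b]/ctmx mulmx_suml; apply: eq_bigr => g Gg.
rewrite mulrA ctmx_Tr // -scalemxAl scalemxAr; congr (_ *m _).
rewrite /ctmx scaler_sumr; apply: eq_bigr => x Gx.
by rewrite ct_comm_evp // scalerA.
Qed.

End Character.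

End Center.

(** * Simple heads, blocks and rigidity *)

Section Simple.
Variables (F : fieldType) (gT : finGroupType) (G : {group gT}) (n : nat).
Variable rG : mx_representation F G n.
Variables (alpha : gT -> 'cV[F]_n) (alphav : gT -> 'rV[F]_n) (c : gT -> F).
Hypothesis two_neq0 : 2 != 0 :> F.
Hypothesis rootP : forall s, s \in reflections rG -> root_coroot rG s (alpha s) (alphav s).

Variables (H : pzRingType) (sc : {rmorphism F -> H}) (hY : 'rV[F]_n -> H).
Variables (hX : 'cV[F]_n -> H) (hT : gT -> H) (co : H -> dunkl_space gT n F).
Hypothesis pb : pbw_ring rG alpha alphav c idfun 0 sc hY hX hT co.
Let act := pbw_act pb.
Let scC := pbw_scC pb.
Local Notation dplus := (dplus rG sc hY hX).

Variables (B : pzRingType) (pi : {rmorphism H -> B}).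
Hypothesis pi_surj : forall b, exists h, b = pi h.
Hypothesis pi_ker : forall h, pi h = 0 <-> ipow dplus 1 h.

Variables (d : nat) (rho : mx_representation F G d).
Local Notation ctmx := (ctmx co rho).
Hypothesis irr_rho : mx_irreducible rho.

Fact epsB_subproof : {e : B -> 'M[F]_d | forall h, e (pi h) = ctmx h}.
Proof.
apply: cid; exists (fun b => ctmx (sval (cid (pi_surj b)))) => h.
set h' := sval _; have e : pi h = pi h' by apply: (svalP (cid (pi_surj (pi h)))).
apply/eqP; rewrite -subr_eq0 -(ctmxN pb) -(ctmxD pb); apply/eqP.
apply: (ctmx_ipow two_neq0 rootP pb); apply/pi_ker.
by rewrite rmorphD rmorphN e subrr.
Qed.
Definition epsB : B -> 'M[F]_d := sval epsB_subproof.
Lemma epsBE h : epsB (pi h) = ctmx h. Proof. exact: (svalP epsB_subproof). Qed.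

Lemma epsBD a b : epsB (a + b) = epsB a + epsB b.
Proof.
have [h ->] := pi_surj a; have [h' ->] := pi_surj b.
by rewrite -rmorphD !epsBE (ctmxD pb).
Qed.
Lemma epsB0 : epsB 0 = 0. Proof. by rewrite -(rmorph0 pi) epsBE (ctmx0 pb). Qed.
Lemma epsBN a : epsB (- a) = - epsB a.
Proof. by apply/eqP; rewrite -subr_eq0 opprK -epsBD addNr epsB0. Qed.
Lemma epsB_T g b : g \in G -> epsB (pi (hT g) * b) = epsB b *m rho g^-1%g.
Proof. by move=> Gg; have [h ->] := pi_surj b; rewrite -rmorphM !epsBE (ctmx_T pb). Qed.
Lemma epsB_Tr g b : g \in G -> epsB (b * pi (hT g)) = rho g^-1%g *m epsB b.
Proof. by move=> Gg; have [h ->] := pi_surj b; rewrite -rmorphM !epsBE (ctmx_Tr pb). Qed.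
Lemma epsB_X x b : epsB (pi (hX x) * b) = 0.
Proof. by have [h ->] := pi_surj b; rewrite -rmorphM !epsBE (ctmx_X pb). Qed.
Lemma epsB_Yr y b : epsB (b * pi (hY y)) = 0.
Proof. by have [h ->] := pi_surj b; rewrite -rmorphM !epsBE (ctmx_Y pb). Qed.
Lemma epsB_sc a b : epsB (pi (sc a) * b) = a *: epsB b.
Proof. by have [h ->] := pi_surj b; rewrite -rmorphM !epsBE (ctmx_sc pb). Qed.
Lemma pi_scC a b : pi (sc a) * b = b * pi (sc a).
Proof. by have [h ->] := pi_surj b; rewrite -!rmorphM scC. Qed.
Lemma epsB_scr a b : epsB (b * pi (sc a)) = a *: epsB b.
Proof. by rewrite -pi_scC epsB_sc. Qed.
Lemma epsB1 : epsB 1 = 1%:M.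
Proof. by rewrite -(rmorph1 pi) epsBE (ctmx1 pb). Qed.
Lemma epsB_comm a b : (forall x, a * pi (hX x) = pi (hX x) * a) ->
  epsB (a * b) = epsB b *m epsB a.
Proof.
have [h ->] := pi_surj a; have [h' ->] := pi_surj b => hXC.
rewrite -rmorphM !epsBE (ctmx_comm two_neq0 rootP pb) // => x.
by apply/pi_ker; rewrite rmorphB !rmorphM hXC subrr.
Qed.

Definition epsB_mulr (b : B) (m : 'M[F]_d) := forall a, epsB (a * b) = m *m epsB a.
Lemma epsB_mulrD b b' m m' : epsB_mulr b m -> epsB_mulr b' m' -> epsB_mulr (b + b') (m + m').
Proof. by move=> e e' a; rewrite mulrDr epsBD e e' mulmxDl. Qed.
Lemma epsB_mulrM b b' m m' : epsB_mulr b m -> epsB_mulr b' m' -> epsB_mulr (b * b') (m' *m m).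
Proof. by move=> e e' a; rewrite mulrA e' e mulmxA. Qed.

Local Notation M := 'rV[B]_d.
(** The projection of the baby Verma module onto its copy of rho in degree zero, defined before the
    balanced relations are divided out. *)
Definition eps (u : M) : 'rV[F]_d := \sum_i row i (epsB (u 0 i)).

Lemma epsD u v : eps (u + v) = eps u + eps v.
Proof.
by rewrite /eps -big_split; apply: eq_bigr => i _; rewrite mxE epsBD raddfD.
Qed.
Lemma eps0 : eps 0 = 0.
Proof. by rewrite /eps big1 // => i _; rewrite mxE epsB0 row0. Qed.
Lemma epsN u : eps (- u) = - eps u.
Proof. by apply/eqP; rewrite -subr_eq0 opprK -epsD addNr eps0. Qed.
Lemma eps_sub u v : eps (u - v) = eps u - eps v.
Proof. by rewrite epsD epsN. Qed.
Lemma eps_T g u : g \in G -> eps (pi (hT g) *: u) = eps u *m rho g^-1%g.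
Proof.
move=> Gg; rewrite /eps mulmx_suml; apply: eq_bigr => i _.
by rewrite mxE epsB_T // row_mul.
Qed.
Lemma eps_X x u : eps (pi (hX x) *: u) = 0.
Proof. by rewrite /eps big1 // => i _; rewrite mxE epsB_X row0. Qed.
Lemma eps_sc a u : eps (pi (sc a) *: u) = a *: eps u.
Proof. by rewrite /eps scaler_sumr; apply: eq_bigr => i _; rewrite mxE epsB_sc linearZ. Qed.
Lemma eps_comm a u : (forall x, a * pi (hX x) = pi (hX x) * a) ->
  eps (a *: u) = eps u *m epsB a.
Proof.
move=> aX; rewrite /eps mulmx_suml; apply: eq_bigr => i _.
by rewrite mxE epsB_comm // row_mul.
Qed.

Definition ptens (a : B) (v : 'rV[F]_d) : M := map_mx (fun r => a * pi (sc r)) v.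

Lemma eps_ptens a v : eps (ptens a v) = v *m epsB a.
Proof.
rewrite /eps mulmx_sum_row; apply: eq_bigr => i _.
by rewrite mxE epsB_scr linearZ.
Qed.
Lemma ptensDl a b v : ptens (a + b) v = ptens a v + ptens b v.
Proof. by apply/rowP => i; rewrite !mxE mulrDl. Qed.
Lemma ptens0l v : ptens 0 v = 0.
Proof. by apply/rowP => i; rewrite !mxE mul0r. Qed.
Lemma ptensDr a v w : ptens a (v + w) = ptens a v + ptens a w.
Proof. by apply/rowP => i; rewrite !mxE !rmorphD mulrDr. Qed.
Lemma ptens0r a : ptens a 0 = 0.
Proof. by apply/rowP => i; rewrite !mxE !rmorph0 mulr0. Qed.
Lemma ptensZ a b v : a *: ptens b v = ptens (a * b) v.
Proof. by apply/rowP => i; rewrite !mxE mulrA. Qed.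
Lemma ptens_sc a b v : ptens (a * pi (sc b)) v = ptens a (b *: v).
Proof. by apply/rowP => i; rewrite !mxE !rmorphM !mulrA. Qed.
Lemma M_ptens (u : M) : u = \sum_i ptens (u 0 i) (delta_mx 0 i).
Proof.
apply/rowP => j; rewrite summxE (bigD1 j) //= big1 => [|i ij].
  by rewrite !mxE !eqxx !rmorph1 mulr1 addr0.
by rewrite !mxE eq_sym (negPf ij) !rmorph0 mulr0.
Qed.

Variable Va : B -> 'M[F]_d -> Prop.
Hypothesis Va_T : forall g, g \in G -> Va (pi (hT g)) (rho g^-1%g).
Hypothesis Va_Y : forall y, Va (pi (hY y)) 0.
Hypothesis Va_eps : forall b m, Va b m -> forall a, epsB (a * b) = m *m epsB a.

Definition balanced (u : M) : Prop := exists a b m v, Va b m /\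
    u = ptens (a * b) v - ptens a (v *m m).
Definition verma : lmodType B := mod_quot balanced.
Definition head : lmodType B := mod_head verma.

Local Notation pv := (@mod_proj B M balanced).
Local Notation ph := (@mod_proj B verma (@radical B verma)).

Lemma pvD u v : pv (u + v) = pv u + pv v. Proof. exact: raddfD. Qed.
Lemma pvB u v : pv (u - v) = pv u - pv v. Proof. exact: raddfB. Qed.
Lemma pv0 : pv 0 = 0. Proof. exact: raddf0. Qed.
Lemma pvZ a u : pv (a *: u) = a *: pv u.
Proof. by rewrite -[RHS]/(mod_quot_scale a (pv u)) mod_quot_scaleE. Qed.
Lemma phD u v : ph (u + v) = ph u + ph v. Proof. exact: raddfD. Qed.
Lemma phB u v : ph (u - v) = ph u - ph v. Proof. exact: raddfB. Qed.
Lemma phZ a u : ph (a *: u) = a *: ph u.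
Proof. by rewrite -[RHS]/(mod_quot_scale a (ph u)) mod_quot_scaleE. Qed.

Lemma pv_balanced u : balanced u -> pv u = 0.
Proof.
move=> bu; rewrite -pv0; apply/mod_projP; rewrite subr0 -[u]scale1r -[1 *: u]addr0.
by apply: SubmodGenD => //; left.
Qed.

Lemma eps_pv u : pv u = 0 -> eps u = 0.
Proof.
rewrite -pv0 => /mod_projP; rewrite subr0.
elim=> [|a s x [a' [b [m [v [Vb ->]]]]] _ IH]; first exact: eps0.
rewrite epsD IH addr0 scalerBr !ptensZ eps_sub !eps_ptens mulrA (Va_eps Vb).
by rewrite mulmxA subrr.
Qed.

Inductive xspan (Q : M -> Prop) : M -> Prop :=
| XSpan0 : xspan Q 0
| XSpanD x u w : Q u -> xspan Q w -> xspan Q (pi (hX x) *: u + w).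
Fixpoint xpow (m : nat) : M -> Prop := if m is m'.+1 then xspan (xpow m') else fun=> True.

Lemma xspan_add Q u w : xspan Q u -> xspan Q w -> xspan Q (u + w).
Proof.
move=> Qu Qw; elim: Qu => [|x v z Qv _ IH]; first by rewrite add0r.
by rewrite -addrA; apply: XSpanD.
Qed.

Lemma xpow_ord m u : xpow m u -> forall i, exists h, u 0 i = pi h /\ forall g, ordge m (co h g).
Proof.
elim: m u => [|m IHm] u; first by move=> _ i; have [h ->] := pi_surj (u 0 i); exists h.
move=> /= Xu i; elim: Xu => [|x v z Xv _ [h [eh oh]]].
  exists 0; split=> [|g]; first by rewrite mxE rmorph0.
  by rewrite (co0 pb) ffunE; apply: ordge_0.
have [h' [eh' oh']] := IHm v Xv i; exists (hX x * h' + h); split=> [|g].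
  by rewrite !mxE eh eh' rmorphD rmorphM.
rewrite (coD pb) VDE; apply: ordgeD => //; rewrite (co_X pb) -add1n.
by apply: ordgeM => //; apply/ordge1P/LX_coef0.
Qed.

(** X is nilpotent: every factor X raises the order of coordinates by one, and order [ord_bound]
    means zero in the restricted algebra. *)
Lemma xpow_zero u : xpow (ord_bound G n) u -> u = 0.
Proof.
move=> Xu; apply/rowP => i; have [h [-> oh]] := xpow_ord Xu i; rewrite mxE.
by apply/pi_ker; apply: (ord_ipow two_neq0 rootP pb).
Qed.

Definition xgen (u : M) := exists2 w, xpow 1 w & pv (u - w) = 0.

Lemma xgenD u v : xgen u -> xgen v -> xgen (u + v).
Proof.
move=> [w Xw ew] [w' Xw' ew']; exists (w + w'); first exact: xspan_add.
by rewrite opprD addrACA pvD ew ew' addr0.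
Qed.
Lemma xgen0 : xgen 0.
Proof. by exists 0; [left | rewrite subr0 pv0]. Qed.
Lemma xgen_pv u v : pv u = pv v -> xgen v -> xgen u.
Proof. by move=> e [w Xw ew]; exists w => //; rewrite pvB e -pvB. Qed.
Lemma xgen_X x u : xgen (pi (hX x) *: u).
Proof.
exists (pi (hX x) *: u); last by rewrite subrr pv0.
by rewrite /= -[_ *: u]addr0; apply: XSpanD => //; left.
Qed.

Lemma xgen_evp p v : xgen (ptens (pi (evp sc hY hX p)) v - ptens 1 (p@_0%MM *: v)).
Proof.
elim/(@phase_ind F F idfun n): p v => [a|p q ep eq|x p _|y p _] v.
- rewrite evpC mcoeffC eqxx mulr1 -ptens_sc mul1r subrr; exact: xgen0.
- rewrite (evpD sc hY hX p q) rmorphD ptensDl mcoeffD scalerDl ptensDr opprD addrACA.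
  exact: xgenD.
- rewrite (evp_LX act scC) mcoeff0M LX_coef0 mul0r scale0r ptens0r subr0 rmorphM -ptensZ.
  exact: xgen_X.
- rewrite (evp_LY act scC) mcoeff0M LY_coef0 mul0r scale0r ptens0r subr0 rmorphM.
  apply: (@xgen_pv _ 0); last exact: xgen0.
  rewrite pv0; apply: pv_balanced; exists (pi (evp sc hY hX p)), (pi (hY y)), 0, v.
  by split=> //; rewrite mulmx0 ptens0r subr0.
Qed.

Lemma xgen_ptens h v : xgen (ptens (pi h) v - ptens 1 (v *m ctmx h)).
Proof.
have Q0 : xgen (ptens (pi 0) v - ptens 1 (v *m 0)).
  by rewrite rmorph0 ptens0l mulmx0 ptens0r subr0; apply: xgen0.
have -> : ctmx h = \sum_(g in G) ctmx (evp sc hY hX (co h g) * hT g).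
  by rewrite -[h in LHS](pbw_evK pb) /ev (big_morph ctmx (ctmxD pb rho) (ctmx0 pb rho)).
rewrite -[h in pi h](pbw_evK pb) /ev.
apply: (big_rec2 (fun h m => xgen (ptens (pi h) v - ptens 1 (v *m m)))) => // g m h' Gg IH.
rewrite rmorphD mulmxDr ptensDl ptensDr opprD addrACA; apply: xgenD => //.
set p := co h g; rewrite (ctmx_Tr pb) // rmorphM.
have -> : ctmx (evp sc hY hX p) = p@_0%MM *: 1%:M.
  rewrite -(ctmx1 pb rho) /ctmx scaler_sumr; apply: eq_bigr => g' _.
  rewrite scalerA -(ct_comm_evp two_neq0 rootP pb) ?mul1r // => x.
  by rewrite mul1r mulr1 subrr; apply: ipow0.
rewrite -scalemxAr mulmx1.
have := xgen_evp p (v *m rho g^-1%g); rewrite -scalemxAr; apply: xgen_pv.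
rewrite !pvB; congr (_ - _); apply/eqP; rewrite -subr_eq0 -pvB; apply/eqP/pv_balanced.
by exists (pi (evp sc hY hX p)), (pi (hT g)), (rho g^-1%g), v; split; [apply: Va_T|].
Qed.

Lemma xgen_eps u : xgen (u - ptens 1 (eps u)).
Proof.
have -> : u - ptens 1 (eps u) =
   \sum_i (ptens (u 0 i) (delta_mx 0 i) - ptens 1 (row i (epsB (u 0 i)))).
  rewrite {1}[u]M_ptens sumrB; congr (_ - _).
  by rewrite /eps (big_morph _ (ptensDr 1) (ptens0r 1)).
apply: big_ind => [|x y|i _]; [exact: xgen0 | exact: xgenD |].
by have [h ->] := pi_surj (u 0 i); rewrite epsBE rowE; apply: xgen_ptens.
Qed.

Lemma irr_generated (v w : 'rV[F]_d) : v != 0 ->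
  exists a : gT -> F, w = \sum_(g in G) a g *: (v *m rho g^-1%g).
Proof.
move=> v0; have [_ irr] := (mx_irrP rho).1 irr_rho.
have full : row_full (cyclic_mx rho v).
  apply: irr; first exact: cyclic_mx_module.
  by apply: contraNneq v0 => e; have := cyclic_mx_id rho v; rewrite e submx0.
have /cyclic_mxP[A /envelop_mxP[a ->] ->] := submx_full w full.
exists (fun g => a g^-1%g); rewrite mulmx_sumr (reindex_inj invg_inj) /=.
by apply: eq_big => [g|g _]; rewrite ?groupV // -scalemxAr.
Qed.

Section Submodule.
Variable S : verma -> Prop.
Hypothesis subS : submodule S.
Let S0 : S 0. Proof. by case: subS. Qed.
Let SD u v : S u -> S v -> S (u + v). Proof. by case: subS => _ + _; apply. Qed.
Let SZ a v : S v -> S (a *: v). Proof. by case: subS => _ _ + ?; apply. Qed.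

Hypothesis S_eps : exists2 s, S (pv s) & eps s != 0.

Lemma submodule_eps_full v : exists2 s, S (pv s) & eps s = v.
Proof.
have [s Ss s0] := S_eps; have [a ->] := irr_generated v s0.
exists (\sum_(g in G) pi (sc (a g)) *: (pi (hT g) *: s)).
  rewrite (big_morph pv pvD pv0); apply: big_ind => // g _.
  by rewrite !pvZ; do 2!apply: SZ.
rewrite (big_morph eps epsD eps0); apply: eq_bigr => g Gg.
by rewrite eps_sc eps_T.
Qed.

Lemma submodule_step u : exists2 w, xpow 1 w & S (pv (u - w)).
Proof.
have [s Ss es] := submodule_eps_full (eps u).
have [w Xw ew] := xgen_eps (u - s); exists w => //.
have -> : u - w = s + (u - s - w) by rewrite addrAC addrCA subrr addr0.
rewrite pvD; apply: SD => //.
by move: ew; rewrite eps_sub es subrr ptens0r subr0 => ->.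
Qed.

Lemma submodule_xpow m u : exists2 w, xpow m w & S (pv (u - w)).
Proof.
elim: m u => [|m IHm] u; first by exists u => //; rewrite subrr pv0.
have [w + Sw] := IHm u.
suff lift k v : xpow k v -> exists2 w', xpow k.+1 w' & S (pv (v - w')).
  move/lift => [w' Xw' Sw']; exists w' => //.
  have -> : u - w' = (u - w) + (w - w') by rewrite addrA subrK.
  by rewrite pvD; apply: SD.
elim: k v => [|k IHk] v; first by move=> _; apply: submodule_step.
elim=> [|x v1 v2 Xv1 _ [w2 Xw2 Sw2]]; first by exists 0; [left | rewrite subrr pv0].
have [w1 Xw1 Sw1] := IHk v1 Xv1; exists (pi (hX x) *: w1 + w2); first exact: XSpanD.
by rewrite opprD addrACA -scalerBr pvD pvZ; apply: SD => //; apply: SZ.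
Qed.

(** A Nakayama argument. As rho is irreducible, one vector with nonzero [eps] yields representatives
    in S of all vectors modulo X; iteration gives them modulo every power of X, and X is
    nilpotent. *)
Lemma submodule_full v : S v.
Proof.
have [u ->] := mod_proj_surj v; have [w Xw Sw] := submodule_xpow (ord_bound G n) u.
by move: Sw; rewrite (xpow_zero Xw) subr0.
Qed.

End Submodule.

(** The largest submodule inside the kernel of [eps], in terms of representatives; it turns out to
    be the radical. *)
Definition nred (u : M) : Prop := forall b, eps (b *: u) = 0.

Lemma nred_submodule : submodule (fun v : verma => forall u, v = pv u -> nred u).
Proof.
have key u u' : pv u = pv u' -> nred u -> nred u'.
  move=> e nu b; have : pv (b *: (u - u')) = 0 by rewrite pvZ pvB e subrr scaler0.
  by move/eps_pv; rewrite scalerBr eps_sub nu sub0r => /eqP; rewrite oppr_eq0 => /eqP.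
split=> [u e|v w|a v _ nv u e].
- by apply: (key 0) => [|b]; rewrite ?pv0 // scaler0 eps0.
- have [u1 ->] := mod_proj_surj v; have [u2 ->] := mod_proj_surj w => n1 n2 u e.
  apply: (key (u1 + u2)); first by rewrite -e pvD.
  by move=> b; rewrite scalerDr epsD n1 // n2 // addr0.
- have [u1 e1] := mod_proj_surj v; apply: (key (a *: u1)); first by rewrite pvZ -e1 -e.
  by move=> b; rewrite scalerA; apply: nv.
Qed.

Lemma eps_one v : eps (ptens 1 v) = v.
Proof. by rewrite eps_ptens epsB1 mulmx1. Qed.

Lemma exists_nonzero_vector : exists v : 'rV[F]_d, v != 0.
Proof.
have [d0 _] := (mx_irrP rho).1 irr_rho; exists (const_mx 1).
by apply/rV0Pn; exists (Ordinal d0); rewrite mxE oner_neq0.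
Qed.

Lemma proper_submodule_nred S : submodule S -> (exists v, ~ S v) ->
  forall u, S (pv u) -> nred u.
Proof.
move=> subS [v0 Nv0] u Su b; apply/eqP/negPn/negP => e0; apply: Nv0.
apply: (submodule_full subS); exists (b *: u) => //.
by rewrite pvZ; case: subS => _ _ SZ; apply: SZ.
Qed.

(** By [proper_submodule_nred] every proper submodule lies in [nred]. As [nred] is itself a proper
    submodule, it is the unique maximal one. *)
Lemma radicalP u : radical (pv u) <-> nred u.
Proof.
have nsub := nred_submodule.
have nproper : exists v : verma, ~ (forall u, v = pv u -> nred u).
  have [v v0] := exists_nonzero_vector; exists (pv (ptens 1 v)) => /(_ _ erefl 1).
  by rewrite scale1r eps_one; apply/eqP.
split=> [rad | nu N [subN [v0 Nv0] maxN]].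
  apply: (rad (fun v => forall u, v = pv u -> nred u)) => //; split=> // N' subN' leN.
  have [full|/existsNP nfull] := pselect (forall v, N' v); [by right | left => v N'v u' e].
  by apply: (proper_submodule_nred subN' nfull); rewrite -e.
have /maxN : submodule (fun v : verma => forall u, v = pv u -> nred u) by [].
case=> [v Nv u' e | h | h].
- by apply: (proper_submodule_nred subN); [exists v0 | rewrite -e].
- apply: h => u' e.
  have key : pv (u' - u) = 0 by rewrite pvB e subrr.
  move=> b; have := eps_pv (etrans (pvZ b (u' - u)) (etrans (congr1 _ key) (scaler0 _ _))).
  by rewrite scalerBr eps_sub nu subr0.
- by case: nproper => v []; apply: h.
Qed.

Lemma head_eq0 u : ph (pv u) = 0 <-> nred u.
Proof.
rewrite -radicalP -[0 in X in X <-> _](raddf0 ph); split; last first.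
  by move=> r; apply/mod_projP; rewrite subr0 -[pv u]scale1r -[1 *: _]addr0;
     apply: SubmodGenD => //; left.
move/mod_projP; rewrite subr0; elim=> [|a s x rs _ IH] N maxN; have [[N0 ND NZ] _ _] := maxN => //.
by apply: ND; [apply: NZ => //; apply: rs | apply: IH].
Qed.

Lemma head_surj (v : head) : exists u, v = ph (pv u).
Proof.
have [v' ->] := mod_proj_surj v; have [u ->] := mod_proj_surj v'; by exists u.
Qed.

(** Since b is central, [eps (b *: u)] is [eps u] multiplied by [epsB b]. So b kills the head
    exactly when it kills the copy of rho in degree zero. *)
Lemma head_kills b : (forall x, b * pi (hX x) = pi (hX x) * b) ->
  (forall a, b * a = a * b) ->
  (forall v : head, b *: v = 0) <-> epsB b = 0.
Proof.
move=> bX bC; split=> [kill|e0 v].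
  apply/row_matrixP => i; rewrite row0 rowE -[delta_mx 0 i]eps_one.
  rewrite -eps_comm //; have := kill (ph (pv (ptens 1 (delta_mx 0 i)))).
  by rewrite -phZ -pvZ => /head_eq0/(_ 1); rewrite scale1r.
have [u ->] := head_surj v; rewrite -phZ -pvZ; apply/head_eq0 => a.
by rewrite scalerA -bC -scalerA eps_comm // e0 mulmx0.
Qed.

Lemma head_one b : central b -> (forall v : head, b *: v = v) <-> epsB b = 1%:M.
Proof.
move=> bC; have bC' a : (1 - b) * a = a * (1 - b).
  by rewrite mulrBl mulrBr mul1r mulr1 bC.
have k := head_kills (fun x => bC' _) bC'.
have e1 : epsB (1 - b) = 1%:M - epsB b by rewrite epsBD epsBN epsB1.
rewrite e1 in k; split=> [one|one v].
  apply/eqP; rewrite eq_sym -subr_eq0; apply/eqP/k => v.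
  by rewrite scalerBl scale1r one subrr.
have /k/(_ v) : 1%:M - epsB b = 0 by rewrite one subrr.
by rewrite scalerBl scale1r => /eqP; rewrite subr_eq0 => /eqP.
Qed.

(* Schur: an idempotent commuting with rho is 0 or 1. *)
Lemma central_idempotent_epsB b : central_idempotent b -> epsB b = 0 \/ epsB b = 1%:M.
Proof.
move=> [bC bb]; have EE : epsB b *m epsB b = epsB b by rewrite -epsB_comm ?bb // => x; rewrite bC.
have cE : centgmx rho (epsB b).
  apply/centgmxP => g Gg; rewrite -[g]invgK.
  by rewrite -epsB_T ?groupV // -epsB_Tr ?groupV // bC.
have [->|E0] := eqVneq (epsB b) 0; [by left | right].
have uE := mx_Schur irr_rho cE E0.
by rewrite -[epsB b](mulKmx uE) EE mulVmx.
Qed.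

(** Up to sign, the right-hand side of the relation for [y, x] at t = 0. It acts by zero on rho
    exactly when rho extends to a module on which all x and y act by zero. *)
Definition star : Prop := forall y x, \sum_(s in reflections rG)
  (c s * pairing y (alpha s) * pairing (alphav s) x) *: rho s^-1%g = 0.

Lemma bracketE y x (u : M) : pi (hY y) *: (pi (hX x) *: u) - pi (hX x) *: (pi (hY y) *: u) =
  - \sum_(s in reflections rG)
      pi (sc (c s * pairing y (alpha s) * pairing (alphav s) x)) *: (pi (hT s) *: u).
Proof.
rewrite !scalerA -scalerBl -!rmorphM -rmorphB (ca_YX act) mul0r rmorph0 sub0r rmorphN.
rewrite scaleNr rmorph_sum scaler_suml; congr (- _).
by apply: eq_bigr => s _; rewrite scalerA -rmorphM.
Qed.

Variable Gs : B -> Prop.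
Hypothesis Gs_sc : forall a, Gs (pi (sc a)).
Hypothesis Gs_T : forall g, g \in G -> Gs (pi (hT g)).
Hypothesis Gs_ind : forall Q : B -> Prop, (forall a, Q (pi (sc a))) ->
  (forall g, g \in G -> Q (pi (hT g))) -> (forall a b, Q a -> Q b -> Q (a + b)) ->
  (forall a b, Q a -> Q b -> Q (a * b)) -> forall b, Gs b -> Q b.

Inductive head_xspan : head -> Prop :=
| HeadXSpan0 : head_xspan 0
| HeadXSpanD x u w : head_xspan w -> head_xspan (pi (hX x) *: u + w).

Lemma head_xspan_submodule : submodule_over Gs head_xspan.
Proof.
have XD u v : head_xspan u -> head_xspan v -> head_xspan (u + v).
  move=> Xu Xv; elim: Xu => [|x w z _ IH]; first by rewrite add0r.
  by rewrite -addrA; right.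
split=> // [|b v Gb]; first by left.
elim/Gs_ind: b / Gb v => [a|g Gg|a b Ha Hb|a b Ha Hb] v Xv.
- elim: Xv => [|x u w _ IH]; first by rewrite scaler0; left.
  by rewrite scalerDr scalerA pi_scC -scalerA; right.
- elim: Xv => [|x u w _ IH]; first by rewrite scaler0; left.
  by rewrite scalerDr scalerA -rmorphM (ca_TX act) // rmorphM -scalerA; right.
- by rewrite scalerDl; apply: XD; [apply: Ha | apply: Hb].
- by rewrite -scalerA; apply/Ha/Hb.
Qed.

(** The span of X on the head is stable under G, so it is zero or everything, and nilpotency of X
    excludes the latter. If X kills the head, then [eps] of Y X u and of X Y u both vanish, and
    their difference is the sum in [star]. *)
Lemma rigid_star : irreducible_over head Gs -> star.
Proof.
case=> [[v0 v0n] irr]; have [zero|full] := irr _ head_xspan_submodule.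
  have X0 x u : nred (pi (hX x) *: u).
    apply/head_eq0/zero; rewrite pvZ phZ -[_ *: _]addr0; right; left.
  move=> y x; apply/row_matrixP => i; rewrite row0.
  have := X0 x (ptens 1 (delta_mx 0 i)) (pi (hY y)).
  have := congr1 eps (bracketE y x (ptens 1 (delta_mx 0 i))).
  rewrite eps_sub eps_X subr0 => -> /eqP; rewrite epsN oppr_eq0 => /eqP e.
  rewrite rowE mulmx_sumr -[RHS]e (big_morph eps epsD eps0); apply: eq_bigr => s.
  by rewrite inE => /andP[Gs' _]; rewrite eps_sc eps_T // eps_one scalemxAr.
case: v0n; have step m (v : head) : exists2 u, xpow m u & v = ph (pv u).
  elim: m v => [|m IHm] v; first by have [u ->] := head_surj v; exists u.
  elim: (full v) => [|x u w _ [w' Xw' ->]]; first by exists 0; [left | rewrite pv0 raddf0].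
  have [u' Xu' ->] := IHm u; exists (pi (hX x) *: u' + w'); first exact: XSpanD.
  by rewrite pvD pvZ phD phZ.
by have [u /xpow_zero -> ->] := step (ord_bound G n) v0; rewrite pv0 raddf0.
Qed.

(** Under [star], Y can be moved past every X without leaving a contribution, so it is killed also
    from the left. Then [epsB] reverses products on the whole algebra and [eps] becomes a map of
    modules onto rho. *)
Lemma star_epsB : star -> forall a b, epsB (a * b) = epsB b *m epsB a.
Proof.
move=> st.
have evp0 p : epsB (pi (evp sc hY hX p)) = p@_0%MM *: 1%:M.
  rewrite epsBE -(ctmx1 pb rho) /ctmx scaler_sumr; apply: eq_bigr => g' _.
  rewrite scalerA -(ct_comm_evp two_neq0 rootP pb) ?mul1r // => x.
  by rewrite mul1r mulr1 subrr; apply: ipow0.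
have Yevp y p : epsB (pi (hY y) * pi (evp sc hY hX p)) = 0.
  elim/(@phase_ind F F idfun n): p => [a|p q ep eq|x p _|z p _].
  - by rewrite evpC -pi_scC epsB_sc -[pi (hY y)]mul1r epsB_Yr scaler0.
  - by rewrite (evpD sc hY hX p q) rmorphD mulrDr epsBD ep eq addr0.
  - rewrite (evp_LX act scC) rmorphM mulrA -rmorphM -(subrK (hX x * hY y) (hY y * hX x)).
    rewrite (ca_YX act) mul0r rmorph0 sub0r rmorphD rmorphM mulrDl epsBD -mulrA epsB_X addr0.
    rewrite rmorphN mulNr epsBN rmorph_sum mulr_suml (big_morph epsB epsBD epsB0).
    rewrite (eq_bigr (fun s => epsB (pi (evp sc hY hX p)) *m
      ((c s * pairing y (alpha s) * pairing (alphav s) x) *: rho s^-1%g))).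
      by rewrite -mulmx_sumr st mulmx0 oppr0.
    move=> s; rewrite inE => /andP[Gs' _].
    by rewrite rmorphM -mulrA epsB_sc epsB_T // scalemxAr.
  - by rewrite (evp_LY act scC) rmorphM mulrA epsB_Yr.
have Yb y b : epsB (pi (hY y) * b) = 0.
  have [h ->] := pi_surj b; rewrite -(pbw_evK pb h) /ev rmorph_sum mulr_sumr.
  rewrite (big_morph epsB epsBD epsB0) big1 // => g Gg.
  by rewrite rmorphM mulrA epsB_Tr // Yevp mulmx0.
have sc1 a : epsB (pi (sc a)) = a *: 1%:M by rewrite -[pi _]mulr1 epsB_sc epsB1.
move=> a b; have [h ->] := pi_surj a; elim/(pbw_ind pb): h b => [e|y|x|g Gg|h h' IH IH'|h h' IH IH'] b.
- by rewrite epsB_sc sc1 -scalemxAr mulmx1.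
- by rewrite Yb -[pi _]mulr1 Yb mulmx0.
- by rewrite epsB_X -[pi _]mulr1 epsB_X mulmx0.
- by rewrite epsB_T // -[pi (hT g)]mulr1 epsB_T // epsB1 mul1mx.
- by rewrite rmorphD mulrDl !epsBD IH IH' mulmxDr.
- by rewrite rmorphM -mulrA IH IH' IH mulmxA.
Qed.

Lemma star_rigid : star -> irreducible_over head Gs.
Proof.
move=> st; have nE u : nred u <-> eps u = 0.
  split=> [/(_ 1)|e b]; first by rewrite scale1r.
  suff -> : eps (b *: u) = eps u *m epsB b by rewrite e mul0mx.
  rewrite /eps mulmx_suml; apply: eq_bigr => i _.
  by rewrite mxE star_epsB // row_mul.
split.
  have [v v0] := exists_nonzero_vector; exists (ph (pv (ptens 1 v))) => /head_eq0/nE.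
  by rewrite eps_one; apply/eqP.
move=> N [N0 ND NZ].
have [zero|/existsNP[v /not_implyP[Nv v0]]] := pselect (forall v, N v -> v = 0); [by left | right => w].
have [u e] := head_surj v; have [u' ->] := head_surj w.
have u0 : eps u != 0 by apply/eqP => /nE/head_eq0; rewrite -e.
have [a ea] := irr_generated (eps u') u0.
have -> : ph (pv u') = \sum_(g in G) pi (sc (a g)) *: (pi (hT g) *: v).
  rewrite e; apply/eqP; rewrite -subr_eq0; apply/eqP.
  rewrite (eq_bigr (fun g => ph (pv (pi (sc (a g)) *: (pi (hT g) *: u))))); last first.
    by move=> g _; rewrite !pvZ !phZ.
  have phpvD : {morph (fun x => ph (pv x)) : x y / x + y} by move=> x y; rewrite pvD phD.
  have phpv0 : ph (pv 0) = 0 by rewrite pv0 raddf0.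
  rewrite -(big_morph _ phpvD phpv0) -phB -pvB; apply/head_eq0/nE.
  rewrite eps_sub (big_morph eps epsD eps0) ea; apply/eqP; rewrite subr_eq0; apply/eqP.
  by apply: eq_bigr => g Gg; rewrite eps_sc eps_T.
by apply: big_ind => // g Gg; apply: (NZ); [|apply: NZ => //; apply: Gs_T].
Qed.

End Simple.

(** * Group algebra elements acting on representations *)

Section GroupAlgebraAction.
Variables (F : fieldType) (gT : finGroupType) (G : {group gT}).

Definition actmx n (rG : mx_representation F G n) (a : gT -> F) : 'M[F]_n :=
  \sum_(g in G) a g *: rG g^-1%g.

Definition intertwines m n (rho : mx_representation F G m) (rG : mx_representation F G n)
    (V : 'M[F]_(m, n)) : Prop :=
  forall x, x \in G -> rho x *m V = V *m rG x.

Lemma intertwines_act m n (rho : mx_representation F G m) (rG : mx_representation F G n) V a :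
  intertwines rho rG V -> actmx rho a *m V = V *m actmx rG a.
Proof.
move=> iV; rewrite /actmx mulmx_suml mulmx_sumr; apply: eq_bigr => g Gg.
by rewrite -scalemxAl -scalemxAr iV ?groupV.
Qed.

Lemma rsim_submod_intertwines m n (rho : mx_representation F G m)
    (rG : mx_representation F G n) (U : 'M_n) (modU : mxmodule rG U) :
  mx_rsim rho (submod_repr modU) -> exists V, [/\ row_free V, intertwines rho rG V & (V <= U)%MS].
Proof.
case=> B e fB hB; exists (val_submod B); split.
- by rewrite /row_free -(mxrank_in_submod (val_submodP B)) val_submodK.
- by move=> x Gx; rewrite -val_submodJ // -hB // /val_submod mulmxA.
- exact: val_submodP.
Qed.

Lemma intertwines_rsim_submod m n (rho : mx_representation F G m)
    (rG : mx_representation F G n) (V : 'M_(m, n)) :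
  row_free V -> intertwines rho rG V ->
  exists (U : 'M_n) (modU : mxmodule rG U), mx_rsim rho (submod_repr modU).
Proof.
move=> fV iV; have modU : mxmodule rG <<V>>%MS.
  apply/mxmoduleP => x Gx; rewrite genmxE (eqmxMr _ (genmxE V)) -iV //; exact: submxMl.
exists <<V>>%MS, modU; have sV : (V <= <<V>>)%MS by rewrite genmxE.
exists (in_submod <<V>>%MS V).
- by rewrite genmxE; apply/esym/eqP.
- by rewrite /row_free mxrank_in_submod.
- by move=> x Gx; rewrite -in_submodJ // -iV // /in_submod mulmxA.
Qed.

Lemma mx_irr1_neq0 d (rho : mx_representation F G d) :
  mx_irreducible rho -> 1%:M <> 0 :> 'M[F]_d.
Proof.
case/mx_irrP => d0 _ /(congr1 mxrank); rewrite mxrank1 mxrank0 => e.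
by rewrite e in d0.
Qed.

Hypothesis F'G : ([pchar F]^'.-group G)%g.

Lemma simple_constituents_zero (sG : irrType F G) n (rG : mx_representation F G n) a :
  (forall (i : sG) V, row_free V -> intertwines (irr_repr i) rG V ->
     actmx (irr_repr i) a = 0) -> actmx rG a = 0.
Proof.
move=> z; apply/eqP.
apply: (mx_reducible_semisimple (mxmodule1 rG) (mx_Maschke_pchar rG F'G)) => -[I U S simU eS _].
apply/eqP; rewrite -[LHS]mul1mx; apply/eqP; rewrite -submx0 -(eqmxMr _ eS) sumsmxMr.
apply/sumsmx_subP => i _; rewrite submx0; apply/eqP.
have irrU := (submod_mx_irr (mxsimple_module (simU i))).2 (simU i).
have sim := rsim_irr_comp_pchar sG F'G irrU.
set j := irr_comp _ _ in sim.
have [V [fV iV sV]] := rsim_submod_intertwines (mx_rsim_sym sim).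
have rV : (U i <= V)%MS.
  have := mxrank_leqif_sup sV; case=> _ <-; apply/eqP.
  move/eqP: fV => ->; case: (mx_rsim_sym sim) => B e _ _; exact: e.
have /submxP[C ->] := rV.
by rewrite -mulmxA -(intertwines_act a iV) (z j V) // mul0mx mulmx0.
Qed.

(** By Maschke the element acts by zero on the regular representation, where the row indexed by 1
    displays its coefficients. *)
Lemma irr_separates (sG : irrType F G) (a : gT -> F) :
  (forall i : sG, actmx (irr_repr i) a = 0) -> forall g, g \in G -> a g = 0.
Proof.
move=> z g Gg; have e : actmx (regular_repr F G) a = 0.
  by apply: (simple_constituents_zero (sG := sG)) => i V _ _; apply: z.
have := congr1 (fun A : 'M[F]_#|G| => A (gring_index G 1%g) (gring_index G g^-1%g)) e.
rewrite mxE /actmx summxE (bigD1 g) //= big1 ?addr0.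
  by rewrite !mxE gring_indexK ?group1 // mul1g !eqxx mulr1.
move=> h /andP[Gh hg]; rewrite !mxE gring_indexK ?group1 // mul1g eqxx /=.
rewrite (inj_in_eq (can_in_inj (@gring_indexK _ G))) ?groupV // (inj_eq invg_inj).
by rewrite eq_sym (negPf hg) mulr0.
Qed.

End GroupAlgebraAction.

(** * Central idempotents with vanishing constant term *)

Section Nilpotent.
Variables (F : fieldType) (gT : finGroupType) (G : {group gT}) (n : nat).
Variable rG : mx_representation F G n.
Variables (alpha : gT -> 'cV[F]_n) (alphav : gT -> 'rV[F]_n) (c : gT -> F).
Hypothesis two_neq0 : 2 != 0 :> F.
Hypothesis rootP : forall s, s \in reflections rG -> root_coroot rG s (alpha s) (alphav s).
Variables (H : pzRingType) (sc : {rmorphism F -> H}) (hY : 'rV[F]_n -> H).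
Variables (hX : 'cV[F]_n -> H) (hT : gT -> H) (co : H -> dunkl_space gT n F).
Hypothesis pb : pbw_ring rG alpha alphav c idfun 0 sc hY hX hT co.
Let act := pbw_act pb.
Let scC := pbw_scC pb.
Variables (B : pzRingType) (pi : {rmorphism H -> B}).
Hypothesis pi_surj : forall b, exists h, b = pi h.
Hypothesis pi_ker : forall h, pi h = 0 <-> ipow (dplus rG sc hY hX) 1 h.

(** For Q everything this is X B + B Y, where elements without constant term lie; a smaller Q keeps
    track of the order of the cofactors. *)
Inductive xyspan (Q : B -> Prop) : B -> Prop :=
| XYSpan0 : xyspan Q 0
| XYSpanX x u w : Q u -> xyspan Q w -> xyspan Q (pi (hX x) * u + w)
| XYSpanY y u w : Q u -> xyspan Q w -> xyspan Q (u * pi (hY y) + w).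

Lemma xyspanD Q u w : xyspan Q u -> xyspan Q w -> xyspan Q (u + w).
Proof.
move=> Qu Qw; elim: Qu => [|x v z Qv _ IH|x v z Qv _ IH]; first by rewrite add0r.
  by rewrite -addrA; apply: XYSpanX.
by rewrite -addrA; apply: XYSpanY.
Qed.

Lemma xyspan_evp p : p@_0%MM = 0 -> xyspan (fun=> True) (pi (evp sc hY hX p)).
Proof.
suff Hp : xyspan (fun=> True) (pi (evp sc hY hX p) - pi (sc p@_0%MM)).
  by move=> e; move: Hp; rewrite e !rmorph0 subr0.
elim/(@phase_ind F F idfun n): p => [a|p q ep eq|x p _|y p _].
- by rewrite evpC mcoeffC eqxx mulr1 subrr; exact: XYSpan0.
- rewrite (evpD sc hY hX p q) mcoeffD !rmorphD opprD addrACA; exact: xyspanD.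
- rewrite (evp_LX act scC) mcoeff0M LX_coef0 mul0r !rmorph0 subr0 rmorphM.
  by rewrite -[_ * _]addr0; apply: XYSpanX => //; exact: XYSpan0.
- rewrite (evp_LY act scC) mcoeff0M LY_coef0 mul0r !rmorph0 subr0 rmorphM.
  by rewrite -[_ * _]addr0; apply: XYSpanY => //; exact: XYSpan0.
Qed.

Lemma xyspan_Tr g b : g \in G -> xyspan (fun=> True) b -> xyspan (fun=> True) (b * pi (hT g)).
Proof.
move=> Gg; elim=> [|x v z Qv _ IH|y v z Qv _ IH]; first by rewrite mul0r; exact: XYSpan0.
  by rewrite mulrDl -mulrA; apply: XYSpanX.
rewrite mulrDl -mulrA -rmorphM.
have -> : hY y * hT g = hT g * hY (y *m rG g).
  by rewrite (ca_TY act) // -mulmxA -repr_mxM ?groupV // mulgV repr_mx1 mulmx1.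
by rewrite rmorphM mulrA; apply: XYSpanY.
Qed.

Lemma xyspan_ct h : (forall g, ct co h g = 0) -> xyspan (fun=> True) (pi h).
Proof.
move=> z; rewrite -(pbw_evK pb h) /ev rmorph_sum.
apply: big_ind => [|u w|g Gg]; [exact: XYSpan0 | exact: xyspanD |].
by rewrite rmorphM; apply: xyspan_Tr => //; apply/xyspan_evp/z.
Qed.

Definition ordB m (b : B) := exists2 h, b = pi h & forall g, ordge m (co h g).

Lemma xyspan_ordB m b : xyspan (ordB m) b -> ordB m.+1 b.
Proof.
have ordL (p q : mpoly (n + n) F) : p@_0%MM = 0 -> ordge m q -> ordge m.+1 (p * q).
  by move=> p0 oq; rewrite -add1n; apply: ordgeM => //; apply/ordge1P.
elim=> [|x v z [h -> oh] _ [h' -> oh']|y v z [h -> oh] _ [h' -> oh']].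
- exists 0; first by rewrite rmorph0.
  by move=> g; rewrite (co0 pb) ffunE; apply: ordge_0.
- exists (hX x * h + h'); first by rewrite rmorphD rmorphM.
  move=> g; rewrite (coD pb) VDE; apply: ordgeD => //; rewrite (co_X pb).
  by apply: ordL => //; apply: LX_coef0.
- exists (h * hY y + h'); first by rewrite rmorphD rmorphM.
  move=> g; rewrite (coD pb) VDE; apply: ordgeD => //; rewrite (co_Yr pb) mulrC.
  by apply: ordL => //; case: ifP => _; [apply: LY_coef0 | apply: mcoeff0].
Qed.

(* e B lies in X B + B Y, hence by e = e^2 and centrality in forms of every order. *)
Lemma central_idempotent_ct h : central_idempotent (pi h) -> (forall g, ct co h g = 0) -> pi h = 0.
Proof.
move=> [eC ee] z; set e := pi h.
have hXC x : ipow (dplus rG sc hY hX) 1 (h * hX x - hX x * h).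
  by apply/pi_ker; rewrite rmorphB !rmorphM eC subrr.
have eB b : xyspan (fun=> True) (e * b).
  have [h' ->] := pi_surj b; rewrite -rmorphM; apply: xyspan_ct => g.
  rewrite -(pbw_evK pb h') /ev mulr_sumr.
  apply: (big_ind (fun u => ct co u g = 0)) => [|u w eu ew|g' Gg'].
  - by rewrite /ct (co0 pb) ffunE mcoeff0.
  - by rewrite (ctD pb) eu ew addr0.
  - by rewrite mulrA (ct_Tr pb) // (ct_comm_evp two_neq0 rootP pb) // z mulr0.
have ord m b : ordB m (e * b).
  elim: m b => [|m IHm] b; first by have [h' ->] := pi_surj (e * b); exists h'.
  apply: xyspan_ordB; have -> : e * b = e * (e * b) by rewrite mulrA ee.
  elim: (eB b) => [|x v w _ _ IH|y v w _ _ IH]; first by rewrite mulr0; exact: XYSpan0.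
  - by rewrite mulrDr mulrA eC -mulrA; apply: XYSpanX.
  - by rewrite mulrDr mulrA; apply: XYSpanY.
have [h' eh' oh'] := ord (ord_bound G n) 1; rewrite -[e]mulr1 eh'.
by apply/pi_ker; apply: (ord_ipow two_neq0 rootP pb).
Qed.

End Nilpotent.

(** * Blocks as atoms of a Boolean algebra of idempotents *)

Section BooleanBlocks.
Variables (B : pzRingType) (I : finType) (on : I -> B -> Prop).
Hypothesis on1 : forall i, on i 1.
Hypothesis onM : forall i e f, central_idempotent e -> central_idempotent f ->
  on i (e * f) <-> on i e /\ on i f.
Hypothesis onC : forall i e, central_idempotent e -> on i (1 - e) <-> ~ on i e.
Hypothesis on_none : forall e, central_idempotent e -> (forall i, ~ on i e) -> e = 0.

Lemma central_idempotent1 : central_idempotent (1 : B).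
Proof. by split=> [a|]; rewrite ?mul1r ?mulr1. Qed.
Lemma central_idempotentM (e f : B) : central_idempotent e -> central_idempotent f ->
  central_idempotent (e * f).
Proof.
move=> [eC ee] [fC ff]; split=> [a|]; first by rewrite -mulrA fC mulrA eC mulrA.
by rewrite -mulrA (mulrA f) (fC e) !mulrA ee -mulrA ff.
Qed.
Lemma central_idempotentC (e : B) : central_idempotent e -> central_idempotent (1 - e).
Proof.
move=> [eC ee]; split=> [a|]; first by rewrite mulrBl mulrBr mul1r mulr1 eC.
by rewrite mulrBl mul1r mulrBr mulr1 ee subrr subr0.
Qed.

(** Among the central idempotents that are on at i, one that is on at the fewest points is
    primitive: by [on_none] a part of it without points is zero. *)
Lemma block_exists i : exists2 e, primitive_central_idempotent e & on i e.
Proof.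
pose S e := [set j | `[< on j e >]].
have SE e j : reflect (on j e) (j \in S e) by rewrite inE; apply: asboolP.
pose Q m := `[< exists e, [/\ central_idempotent e, on i e & #|S e| = m] >].
have exQ : exists m, Q m.
  by exists #|S 1|; apply/asboolP; exists 1; split=> //; apply: central_idempotent1.
case: (ex_minnP exQ) => m /asboolP[e [eI ei em]] minm; exists e => //; split=> //.
  move=> e0; have := (onC i central_idempotent1).1; rewrite subrr -e0; exact.
move=> f fI fe; have gI : central_idempotent (e * (1 - f)).
  by apply: central_idempotentM => //; apply: central_idempotentC.
have Sf : S f \subset S e.
  by apply/subsetP => j /SE; rewrite -{1}fe => /onM[] // _ /SE.
have ce := eI.1; have e1f : e * (1 - f) = e - f by rewrite mulrBr mulr1 ce fe.
have [fi|nfi] := pselect (on i f).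
  right; have eqS : S f = S e.
    apply/eqP; rewrite eqEcard Sf em minm //; apply/asboolP; by exists f.
  have /eqP : e * (1 - f) = 0.
    apply: on_none => // j /onM[] //; first exact: central_idempotentC.
    by move=> /SE; rewrite -eqS => /SE fj /onC; apply.
  by rewrite e1f subr_eq0 => /eqP.
(* Here f is off at i, so e - f is on at i. By minimality it has all the points of e, which leaves
   none for f. *)
left; have gi : on i (e * (1 - f)).
  by apply/onM => //; [apply: central_idempotentC | split=> //; apply/onC].
have Sg : S (e * (1 - f)) \subset S e.
  by apply/subsetP => j /SE/onM[] //; [apply: central_idempotentC | move=> /SE].
have eqS : S (e * (1 - f)) = S e.
  by apply/eqP; rewrite eqEcard Sg em minm //; apply/asboolP; exists (e * (1 - f)).
apply: on_none => // j fj; have : j \in S e by apply: (subsetP Sf); apply/SE.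
by rewrite -eqS => /SE/onM[] //; [apply: central_idempotentC | move=> _ /onC; apply].
Qed.

Lemma same_blockP i j : (exists e, [/\ primitive_central_idempotent e, on i e & on j e]) <->
  forall f, central_idempotent f -> on i f <-> on j f.
Proof.
split=> [[e [[eI e0 eP] ei ej]] f fI|ij]; last first.
  by have [e eP ei] := block_exists i; exists e; split=> //; apply/ij => //; case: eP.
suff H k k' : on k e -> on k' e -> on k f -> on k' f by split; apply: H.
move=> ek ek' fk; have feI := central_idempotentM fI eI.
have [z|e1] : f * e = 0 \/ f * e = e.
  by apply: eP => //; rewrite -mulrA eI.2.
- have : on k (f * e) by apply/onM.
  by rewrite z -(subrr 1) => /(onC k central_idempotent1).1; case.
- by have /(onM k' fI eI)[] : on k' (f * e) by rewrite e1.
Qed.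

End BooleanBlocks.

(** * Annihilators, blocks and rigidity in terms of constant terms *)

Section Families.
Variables (F : decFieldType) (gT : finGroupType) (G : {group gT}) (n : nat).
Variable rG : mx_representation F G n.
Variables (alpha : gT -> 'cV[F]_n) (alphav : gT -> 'rV[F]_n) (c : gT -> F).
Hypothesis two_neq0 : 2 != 0 :> F.
Hypothesis F'G : ([pchar F]^'.-group G)%g.
Hypothesis rootP : forall s, s \in reflections rG -> root_coroot rG s (alpha s) (alphav s).

Local Notation H := (Hc rG alpha alphav c).
Local Notation sc := (ch_scal rG alpha alphav c idfun 0).
Local Notation hX := (ch_X rG alpha alphav c idfun 0).
Local Notation hY := (ch_Y rG alpha alphav c idfun 0).
Local Notation hT := (ch_T rG alpha alphav c idfun 0).
Variable co : H -> dunkl_space gT n F.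
Hypothesis pb : pbw_ring rG alpha alphav c idfun 0 sc hY hX hT co.
Local Notation B := (Hbar rG alpha alphav c).
Local Notation pi := (ring_proj (@D_plus F gT G n rG alpha alphav c)).

Lemma bar_ker (h : H) : pi h = 0 <-> ipow (dplus rG sc hY hX) 1 h.
Proof.
have Dc := dplus_central two_neq0 rootP pb.
rewrite (ipow1P Dc) -(rmorph0 pi) ring_projP subr0; split; exact: id.
Qed.

Lemma bar_surj (b : B) : exists h, b = pi h.
Proof. exact: ring_proj_surj. Qed.

Section OneRep.
Variables (d : nat) (rho : mx_representation F G d).
Hypothesis irr_rho : mx_irreducible rho.

Local Notation epsB := (epsB two_neq0 rootP pb bar_surj bar_ker rho).

Lemma verma_action_T g : g \in G -> @verma_action _ _ _ _ rG alpha alphav c d rho (pi (hT g)) (rho g^-1%g).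
Proof. exact: VaT. Qed.
Lemma verma_action_Y y : @verma_action _ _ _ _ rG alpha alphav c d rho (pi (hY y)) 0.
Proof. exact: VaY. Qed.
Lemma verma_action_eps b m : @verma_action _ _ _ _ rG alpha alphav c d rho b m ->
  forall a, epsB (a * b) = m *m epsB a.
Proof.
elim=> [e|g Gg|y|b1 b2 m1 m2 _ IH1 _ IH2|b1 b2 m1 m2 _ IH1 _ IH2].
- by move=> a; rewrite (epsB_scr two_neq0 rootP pb bar_surj bar_ker) mul_scalar_mx.
- by move=> a; apply: (epsB_Tr two_neq0 rootP pb bar_surj bar_ker).
- by move=> a; rewrite (epsB_Yr two_neq0 rootP pb bar_surj bar_ker) mul0mx.
- exact: (epsB_mulrD IH1 IH2).
- exact: (epsB_mulrM IH1 IH2).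
Qed.

Local Notation L := (simple_head rG alpha alphav c rho).

Let epsBE_ h : epsB (pi h) = actmx rho (ct co h).
Proof. exact: (epsBE two_neq0 rootP pb bar_surj bar_ker rho). Qed.

Lemma simple_head_kills (h : H) : central (pi h) ->
  (forall v : L, pi h *: v = 0) <-> actmx rho (ct co h) = 0.
Proof.
move=> hC; rewrite -epsBE_.
exact: (head_kills irr_rho verma_action_T verma_action_Y verma_action_eps (fun x => hC _) hC).
Qed.

Lemma simple_head_one (h : H) : central (pi h) ->
  (forall v : L, pi h *: v = v) <-> actmx rho (ct co h) = 1%:M.
Proof.
move=> hC; rewrite -epsBE_.
exact: (head_one irr_rho verma_action_T verma_action_Y verma_action_eps hC).
Qed.

Lemma central_bar (z : H) : central z -> central (pi z).
Proof. by move=> zC a; have [h ->] := bar_surj a; rewrite -!rmorphM zC. Qed.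

Lemma annihilatorP z : annihilator rG alpha alphav c rho z <->
  central z /\ actmx rho (ct co z) = 0.
Proof.
split=> -[zC k]; split=> //.
  exact: (simple_head_kills (central_bar zC)).1.
exact: (simple_head_kills (central_bar zC)).2.
Qed.

Lemma rigidP : rigid rG alpha alphav c rho <-> star rG alpha alphav c rho.
Proof.
have Gs_sc a : @group_subalgebra _ _ _ _ rG alpha alphav c (pi (sc a)) by apply: GsScal.
have Gs_T g : g \in G -> @group_subalgebra _ _ _ _ rG alpha alphav c (pi (hT g)) by apply: GsT.
have Gs_ind (Q : B -> Prop) : (forall a, Q (pi (sc a))) ->
  (forall g, g \in G -> Q (pi (hT g))) -> (forall a b, Q a -> Q b -> Q (a + b)) ->
  (forall a b, Q a -> Q b -> Q (a * b)) ->
  forall b, @group_subalgebra _ _ _ _ rG alpha alphav c b -> Q b.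
  by move=> Q1 Q2 Q3 Q4 b; elim=> *; [apply: Q1|apply: Q2|apply: Q3|apply: Q4].
split.
  exact: (rigid_star irr_rho verma_action_T verma_action_Y verma_action_eps Gs_ind).
exact: (star_rigid irr_rho verma_action_T verma_action_Y verma_action_eps Gs_sc Gs_T).
Qed.

Lemma central_idempotent_act h : central_idempotent (pi h) ->
  actmx rho (ct co h) = 0 \/ actmx rho (ct co h) = 1%:M.
Proof.
rewrite -epsBE_; exact: central_idempotent_epsB.
Qed.

End OneRep.

Lemma act1 d (rho : mx_representation F G d) : actmx rho (ct co 1) = 1%:M.
Proof. exact: (ctmx1 pb). Qed.

Lemma actB d (rho : mx_representation F G d) h h' : actmx rho (ct co (h - h')) =
  actmx rho (ct co h) - actmx rho (ct co h').
Proof. by have := ctmxD pb rho h (- h'); rewrite (ctmxN pb). Qed.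

Lemma irr1_neq0 (i : Irr F G) : 1%:M <> 0 :> 'M[F]_(irr_degree i).
Proof. exact: mx_irr1_neq0 (socle_irr i). Qed.

Local Notation L := (L rG alpha alphav c).

Lemma act_dichotomy (i : Irr F G) e : central_idempotent e -> exists h,
  [/\ e = pi h, (forall v : L i, e *: v = v) <-> actmx (irr_repr i) (ct co h) = 1%:M,
    (forall v : L i, (1 - e) *: v = v) <-> actmx (irr_repr i) (ct co h) = 0
    & actmx (irr_repr i) (ct co h) = 0 \/ actmx (irr_repr i) (ct co h) = 1%:M].
Proof.
have [h ->] := bar_surj e => eI; exists h; split=> //.
- exact: (simple_head_one (socle_irr i) eI.1).
- have -> : 1 - pi h = pi (1 - h) by rewrite rmorphB rmorph1.
  have gI : central_idempotent (pi (1 - h)).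
    by rewrite rmorphB rmorph1; apply: central_idempotentC.
  apply: iff_trans (simple_head_one (socle_irr i) gI.1) _; rewrite actB act1.
  split=> [/eqP|->]; last by rewrite subr0.
  by rewrite subr_eq addrC -subr_eq subrr eq_sym => /eqP.
- exact: (central_idempotent_act (socle_irr i) eI).
Qed.

Lemma blockP (i j : Irr F G) : same_block (L i) (L j) <->
  forall h, central_idempotent (pi h) ->
    actmx (irr_repr i) (ct co h) = 1%:M <-> actmx (irr_repr j) (ct co h) = 1%:M.
Proof.
pose on (i : Irr F G) (b : Hbar rG alpha alphav c) := forall v : L i, b *: v = v.
have onM k e f : central_idempotent e -> central_idempotent f ->
    on k (e * f) <-> on k e /\ on k f.
  move=> [eC ee] [fC ff]; split=> [ef|[oe of_] v]; last by rewrite -scalerA of_ oe.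
  split=> v; first by rewrite -{1}(ef v) scalerA mulrA ee.
  by rewrite -{1}(ef v) scalerA eC mulrA ff -eC.
have onC k e : central_idempotent e -> on k (1 - e) <-> ~ on k e.
  move=> eI; have [h [_ h1 h0 hd]] := act_dichotomy k eI.
  split=> [/h0 z /h1 o|no]; first by apply: (@irr1_neq0 k); rewrite -o.
  by apply/h0; case: hd => // /h1.
(* If e acts by 0 on every irreducible representation, its constant term vanishes by
   [irr_separates], and then e does by [central_idempotent_ct]. *)
have on_none e : central_idempotent e -> (forall k, ~ on k e) -> e = 0.
  have [h ->] := bar_surj e => eI no.
  apply: (central_idempotent_ct two_neq0 rootP pb bar_surj bar_ker eI) => g.
  have [Gg|nGg] := boolP (g \in G); last exact: (ct_out pb).
  apply: (irr_separates F'G (sG := Irr F G)) Gg => k.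
  have [//|a1] := central_idempotent_act (socle_irr k) eI.
  by case: (no k); apply/(simple_head_one (socle_irr k) eI.1).
have on1 k : on k 1 by move=> v; rewrite scale1r.
apply: iff_trans (same_blockP on1 onM onC on_none i j) _.
split=> ij h hI.
  by rewrite -!(simple_head_one (socle_irr _) hI.1); apply: ij.
have [h' e] := bar_surj h; rewrite e in hI *.
by apply: iff_trans (simple_head_one (socle_irr i) hI.1) (iff_trans (ij _ hI) (iff_sym (simple_head_one (socle_irr j) hI.1))).
Qed.

End Families.

(** * Normal reflection subgroups *)

Section Inclusion.
Variables (F : fieldType) (gT : finGroupType) (W K : {group gT}) (nKW : (K <| W)%g) (n : nat).
Variable rW : mx_representation F W n.
Variables (alpha : gT -> 'cV[F]_n) (alphav : gT -> 'rV[F]_n) (c : gT -> F).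
Variables (k : idomainType) (phi : {rmorphism F -> k}) (t : k).
Local Notation sKW := (normal_sub nKW).
Local Notation rK := (subg_repr rW sKW).
Local Notation cW := (extend_by_zero rK c).

Lemma reflections_normal_sub : reflections rK \subset reflections rW.
Proof. by apply/subsetP => s; rewrite !inE => /andP[/(subsetP sKW)-> /=]. Qed.

Lemma reflections_normalE s : (s \in reflections rK) = (s \in K) && (s \in reflections rW).
Proof.
rewrite !inE; case: (boolP (s \in K)) => //= Ks; by rewrite (subsetP sKW).
Qed.

Lemma reflections_normalJ s w : w \in W -> (s ^ w \in reflections rK)%g = (s \in reflections rK).
Proof.
move=> Ww; rewrite !reflections_normalE memJ_norm ?(subsetP (normal_norm nKW)) //.
case: (boolP (s \in K)) => //= Ks; apply/idP/idP => [Rs|Rs]; last exact: reflectionsJ.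
by rewrite -(conjgK w s) reflectionsJ ?groupV.
Qed.

Lemma extend_by_zeroJ : (forall s w, s \in reflections rK -> w \in W -> c (s ^ w)%g = c s) ->
  forall s w, s \in reflections rW -> w \in W -> cW (s ^ w)%g = cW s.
Proof.
move=> cJ s w _ Ww; rewrite /extend_by_zero reflections_normalJ //.
by case: ifP => // Rs; apply: cJ.
Qed.

(** The reflections of W outside K drop out of the commutator relation, because the extended
    parameter vanishes on them. *)
Lemma ch_action_restrict (B : pzRingType) (sc : {rmorphism k -> B}) fY fX fT :
  ch_action rW alpha alphav cW phi t sc fY fX fT -> ch_action rK alpha alphav c phi t sc fY fX fT.
Proof.
case=> a1 a2 a3 a4 a5 a6 a7 a8 a9 a10 a11 a12; have s := subsetP sKW.
apply: (ChAction a1 a2 a3 _ _ _ a7 a8 _ a10 a11 _).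
- by move=> g h /s Wg /s Wh; apply: a4.
- by move=> g y /s Wg; apply: a5.
- by move=> g y /s Wg; apply: a6.
- move=> y x; rewrite a9; congr (_ - _).
  rewrite (big_setID (reflections rK)) /= (setIidPr reflections_normal_sub) [X in _ + X]big1 ?addr0.
    by apply: eq_bigr => r Rr; rewrite /extend_by_zero Rr.
  move=> r; rewrite inE => /andP[/negPf nr _].
  by rewrite /extend_by_zero nr !mul0r !rmorph0 mul0r.
- by move=> a g /s Wg; apply: a12.
Qed.

Lemma ch_inclusion_exists :
  exists f : {rmorphism cherednik rK alpha alphav c phi t -> cherednik rW alpha alphav cW phi t},
  [/\ forall a, f (ch_scal rK alpha alphav c phi t a) = ch_scal rW alpha alphav cW phi t a,
      forall y, f (ch_Y rK alpha alphav c phi t y) = ch_Y rW alpha alphav cW phi t y,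
      forall x, f (ch_X rK alpha alphav c phi t x) = ch_X rW alpha alphav cW phi t x
    & forall g, g \in K -> f (ch_T rK alpha alphav c phi t g) = ch_T rW alpha alphav cW phi t g].
Proof.
exact: ch_lift_exists (ch_action_restrict (ch_actionP rW alpha alphav cW phi t)).
Qed.

Section Abstract.
Variables (HK : pzRingType) (scK : {rmorphism k -> HK}) (YK : 'rV[F]_n -> HK).
Variables (XK : 'cV[F]_n -> HK) (TK : gT -> HK) (coK : HK -> dunkl_space gT n k).
Hypothesis pbK : pbw_ring rK alpha alphav c phi t scK YK XK TK coK.
Variables (HW : pzRingType) (scW : {rmorphism k -> HW}) (YW : 'rV[F]_n -> HW).
Variables (XW : 'cV[F]_n -> HW) (TW : gT -> HW) (coW : HW -> dunkl_space gT n k).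
Hypothesis pbW : pbw_ring rW alpha alphav cW phi t scW YW XW TW coW.
Variable iota : {rmorphism HK -> HW}.
Hypothesis iotaS : forall a, iota (scK a) = scW a.
Hypothesis iotaY : forall y, iota (YK y) = YW y.
Hypothesis iotaX : forall x, iota (XK x) = XW x.
Hypothesis iotaT : forall g, g \in K -> iota (TK g) = TW g.
Let actK := pbw_act pbK.
Let actW := pbw_act pbW.
Let KW g : g \in K -> g \in W := subsetP sKW g.

Lemma iota_evp p : iota (evp scK YK XK p) = evp scW YW XW p.
Proof.
elim/(@phase_ind F k phi n): p => [a|p q ep eq|x p ep|y p ep].
- by rewrite !evpC.
- by rewrite !evpD rmorphD ep eq.
- by rewrite (evp_LX actK (pbw_scC pbK)) (evp_LX actW (pbw_scC pbW)) rmorphM iotaX ep.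
- by rewrite (evp_LY actK (pbw_scC pbK)) (evp_LY actW (pbw_scC pbW)) rmorphM iotaY ep.
Qed.

(** Normal ordering of X and Y does not involve the group, so coordinates over K extended by zero
    are coordinates over W. *)
Lemma co_iota h : coW (iota h) = coK h.
Proof.
rewrite -{1}(pbw_evK pbK h); have suppK := pbw_supp pbK h.
have -> : iota (ev K scK YK XK TK (coK h)) = ev W scW YW XW TW (coK h).
  rewrite /ev rmorph_sum /= [RHS](big_setID K) /= (setIidPr sKW) [X in _ = _ + X]big1 ?addr0.
    by apply: eq_bigr => g Kg; rewrite rmorphM iota_evp iotaT.
  by move=> g; rewrite inE => /andP[nKg _]; rewrite suppK // evp0 mul0r.
by rewrite (pbw_coK pbW) // => g nWg; apply: suppK; apply: contra nWg; apply: KW.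
Qed.

Lemma iota_inj : injective iota.
Proof. by move=> h h' e; apply: (co_inj pbK); rewrite -!co_iota e. Qed.

Lemma TW_conj_inv w : w \in W -> TW w^-1%g * TW w = 1.
Proof. by move=> Ww; rewrite -(ca_TM actW) ?groupV // mulVg (ca_T1 actW). Qed.
Lemma TW_conjV w : w \in W -> TW w * TW w^-1%g = 1.
Proof. by move=> Ww; rewrite -(ca_TM actW) ?groupV // mulgV (ca_T1 actW). Qed.

Lemma iota_conj w h : w \in W -> exists h', iota h' = TW w * iota h * TW w^-1%g.
Proof.
move=> Ww; elim/(pbw_ind pbK): h => [a|y|x|g Kg|h h' [u eu] [u' eu']|h h' [u eu] [u' eu']].
- by exists (scK a); rewrite iotaS -(pbw_scC pbW) -mulrA TW_conjV ?mulr1.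
- by exists (YK (y *m rW w^-1%g)); rewrite !iotaY (ca_TY actW) // -mulrA TW_conjV ?mulr1.
- by exists (XK (rW w *m x)); rewrite !iotaX (ca_TX actW) // -mulrA TW_conjV ?mulr1.
- have Kgw : (w * g * w^-1)%g \in K.
    have -> : (w * g * w^-1 = g ^ w^-1)%g by rewrite conjgE invgK mulgA.
    by rewrite memJ_norm // groupV (subsetP (normal_norm nKW)).
  exists (TK (w * g * w^-1)%g); have Wg := KW Kg.
  by rewrite !iotaT // !(ca_TM actW) ?groupM ?groupV.
- by exists (u + u'); rewrite !rmorphD mulrDr mulrDl eu eu'.
- exists (u * u'); rewrite !rmorphM eu eu' !mulrA; congr (_ * _ * _).
  by rewrite -(mulrA (_ * _)) TW_conj_inv // mulr1.
Qed.

(** The projection onto the trivial coset in the decomposition of the algebra of W along W / K. It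
    retracts [iota] and, by [truncateMl], is linear on the left over the algebra of K. *)
Definition truncate (h : HW) : HK := ev K scK YK XK TK [ffun g => if g \in K then coW h g else 0].

Lemma co_truncate h g : coK (truncate h) g = if g \in K then coW h g else 0.
Proof.
rewrite (pbw_coK pbK) ?ffunE // => x nKx; by rewrite ffunE (negPf nKx).
Qed.

Lemma truncateD h h' : truncate (h + h') = truncate h + truncate h'.
Proof.
apply: (co_inj pbK); apply/ffunP => g.
by rewrite (coD pbK) VDE !co_truncate (coD pbW) VDE; case: ifP => // _; rewrite addr0.
Qed.

Lemma truncate0 : truncate 0 = 0.
Proof. by have := truncateD 0 0; rewrite addr0 -{1}[truncate 0]addr0 => /addrI. Qed.

Lemma truncate_iota h : truncate (iota h) = h.
Proof.
apply: (co_inj pbK); apply/ffunP => g; rewrite co_truncate co_iota.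
by case: (boolP (g \in K)) => // nKg; rewrite (pbw_supp pbK).
Qed.

Lemma truncate_T a w : w \in W -> w \notin K -> truncate (iota a * TW w) = 0.
Proof.
move=> Ww nKw; apply: (co_inj pbK); apply/ffunP => g; rewrite co_truncate (co0 pbK) ffunE.
case: ifP => // Kg; rewrite (co_Tr pbW) // co_iota (pbw_supp pbK) //.
by rewrite groupMl // groupV.
Qed.

Lemma truncateMl a h : truncate (iota a * h) = a * truncate h.
Proof.
rewrite -(pbw_evK pbW h) /ev mulr_sumr.
apply: (big_ind2 (fun u v => truncate u = a * truncate v)) => [|u v u' v' e e'|w Ww].
- by rewrite truncate0 mulr0.
- by rewrite !truncateD mulrDr e e'.
rewrite -iota_evp; set b := evp _ _ _ _; case: (boolP (w \in K)) => Kw.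
  by rewrite -iotaT // -!rmorphM !truncate_iota.
by rewrite mulrA -rmorphM !truncate_T // mulr0.
Qed.

Lemma truncateK h : (forall w, w \in W -> w \notin K -> coW h w = 0) -> iota (truncate h) = h.
Proof.
move=> z; apply: (co_inj pbW); rewrite co_iota; apply/ffunP => g; rewrite co_truncate.
case: ifP => // /negbT nKg; case: (boolP (g \in W)) => Wg; first by rewrite z.
by rewrite (pbw_supp pbW).
Qed.

End Abstract.

End Inclusion.

(** A point (t^j) of the moment curve works: a nonzero row of [M i] pairs with it to the value at t
    of a nonzero polynomial, and in characteristic zero some natural number avoids the roots of all
    these polynomials. *)
Lemma generic_vector (F : fieldType) (n : nat) (I : finType) (P : pred I) (M : I -> 'M[F]_n) :
  [pchar F] =i pred0 -> (forall i, P i -> M i != 0) ->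
  exists x : 'cV[F]_n, forall i, P i -> M i *m x != 0.
Proof.
move=> ch0 M0; pose p i : {poly F} := if [pick r | row r (M i) != 0] is Some r then rVpoly (row r (M i)) else 1.
have pP i : P i -> exists2 r, row r (M i) != 0 & p i = rVpoly (row r (M i)).
  move=> Pi; rewrite /p; case: pickP => [r rM|z]; first by exists r.
  case/negP: (M0 i Pi); apply/eqP/row_matrixP => r; rewrite row0; apply/eqP.
  by move/negbT: (z r); rewrite negbK.
have p0 : \prod_(i | P i) p i != 0.
  apply/prodf_neq0 => i /pP[r rM ->]; apply: contra_neq rM => e.
  by rewrite -[LHS]rVpolyK e linear0.
have [t tP] : exists t, (\prod_(i | P i) p i).[t] != 0.
  (* The candidates 0, 1, ... are as many as the size of q, one more than its degree, so they cannot
     all be roots. *)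
  set q := \prod_(i | _) _ in p0 *; pose s := [seq m%:R : F | m <- iota 0 (size q)].
  have us : uniq s.
    rewrite map_inj_uniq ?iota_uniq // => a b.
    wlog le : a b / (a <= b)%N => [th|].
      by case: (leqP a b) => [/th|/ltnW/th h e]; [apply | apply/esym/h].
    move/eqP; rewrite eq_sym -subr_eq0 -natrB // ((pcharf0P F).1 ch0) subn_eq0 => ge.
    by apply/eqP; rewrite eqn_leq le.
  have /allPn[x _ xq] : ~~ all (root q) s.
    apply/negP => al; have := max_poly_roots p0 al us.
    by rewrite size_map size_iota ltnn.
  by exists x.
exists (\col_j t ^+ j) => i Pi; have [r _ e] := pP i Pi.
apply: contra_neq tP => /(congr1 (fun A : 'cV_n => A r 0)).
rewrite [RHS]mxE mxE => z; rewrite horner_prod (bigD1 i) //= e.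
suff -> : (rVpoly (row r (M i))).[t] = 0 by rewrite mul0r.
rewrite -[RHS]z (@horner_coef_wide _ n) ?size_poly //.
by apply: eq_bigr => j _; rewrite coef_rVpoly_ord !mxE.
Qed.

(** * Orders of products with linear forms on h *)

Section LinearForms.
Variables (F : fieldType) (n : nat).
Local Notation P := (mpoly (n + n) F).

Lemma LX_inj (x : 'cV[F]_n) : (LX idfun x : P) = 0 -> x = 0.
Proof.
move=> e; apply/colP => i; rewrite mxE.
have := congr1 (mcoeff U_(lshift n i)) e; rewrite mcoeff0 /LX raddf_sum (bigD1 i) //= big1.
  by rewrite addr0 mcoeffZ mcoeffXU eqxx mulr1.
by move=> j ji; rewrite mcoeffZ mcoeffXU (inj_eq (@lshift_inj _ _)) (negPf ji) mulr0.
Qed.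

Lemma LX_degle (x : 'cV[F]_n) : degle 1 (LX idfun x : P).
Proof.
move=> m m1; rewrite /LX raddf_sum big1 //= => i _; rewrite mcoeffZ mcoeffX.
by case: eqP => [e|_]; rewrite ?mulr0 //; rewrite -e mdeg1 in m1.
Qed.

Lemma ordge_prod_linear (I : eqType) (s : seq I) (x : I -> 'cV[F]_n) N (v : P) :
  (forall i, i \in s -> x i != 0) ->
  ordge (N + size s) ((\prod_(i <- s) LX idfun (x i)) * v) -> ordge N v.
Proof.
elim: s => [|i s IH] x0; first by rewrite addn0 big_nil mul1r.
rewrite big_cons -mulrA addnS => o; apply: IH; first by move=> j js; rewrite x0 ?inE ?js ?orbT.
apply: ordge_linear o; last exact: LX_degle.
  by apply/eqP => /LX_inj/eqP; apply/negP/x0; rewrite inE eqxx.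
by apply/ordge1P/LX_coef0.
Qed.

Definition linform (x : 'cV[F]_n) : mpoly n F := \sum_i x i 0 *: 'X_i.

Lemma pX_linform x : pX n F (linform x) = LX idfun x.
Proof.
rewrite /linform /pX rmorph_sum /LX; apply: eq_bigr => i _ /=.
by rewrite -mul_mpolyC rmorphM membedC membedX mul_mpolyC.
Qed.

Lemma msubst_linform A x : msubst A (linform x) = linform (A^T *m x).
Proof.
rewrite /linform (big_morph (msubst A) (msubstD A) (_ : _ = 0)); last by rewrite -mpolyC0 msubstC.
under eq_bigr do rewrite msubstZ msubstX scaler_sumr.
rewrite exchange_big; apply: eq_bigr => j _ /=.
rewrite mxE scaler_suml; apply: eq_bigr => i _.
by rewrite scalerA mxE mulrC.
Qed.

End LinearForms.

Lemma addrACA_sub (V : zmodType) (a b c d : V) : (a - b) - (c - d) = (a - c) - (b - d).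
Proof. by rewrite !opprB addrACA [RHS]addrACA (addrC (- b)). Qed.

Lemma map_prod_XsubC (A B : comNzRingType) (s : {rmorphism A -> B}) (I : finType)
    (P : pred I) (a : I -> A) :
  map_poly s (\prod_(i | P i) ('X - (a i)%:P)) = \prod_(i | P i) ('X - (s (a i))%:P).
Proof. by rewrite rmorph_prod; apply: eq_bigr => i _; exact: map_polyXsubC. Qed.

(** * Central elements for W come from K *)

Section Descent.
Variables (F : fieldType) (gT : finGroupType) (W K : {group gT}) (nKW : (K <| W)%g) (n : nat).
Variable rW : mx_representation F W n.
Variables (alpha : gT -> 'cV[F]_n) (alphav : gT -> 'rV[F]_n) (c : gT -> F).
Local Notation sKW := (normal_sub nKW).
Local Notation rK := (subg_repr rW sKW).
Local Notation cW := (extend_by_zero rK c).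
Hypothesis two_neq0 : 2 != 0 :> F.
Hypothesis ch0 : [pchar F] =i pred0.
Hypothesis faithW : mx_faithful rW.
Hypothesis rootW : forall s, s \in reflections rW -> root_coroot rW s (alpha s) (alphav s).
Variables (HK : pzRingType) (scK : {rmorphism F -> HK}) (YK : 'rV[F]_n -> HK).
Variables (XK : 'cV[F]_n -> HK) (TK : gT -> HK) (coK : HK -> dunkl_space gT n F).
Hypothesis pbK : pbw_ring rK alpha alphav c idfun 0 scK YK XK TK coK.
Variables (HW : pzRingType) (scW : {rmorphism F -> HW}) (YW : 'rV[F]_n -> HW).
Variables (XW : 'cV[F]_n -> HW) (TW : gT -> HW) (coW : HW -> dunkl_space gT n F).
Hypothesis pbW : pbw_ring rW alpha alphav cW idfun 0 scW YW XW TW coW.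
Variable iota : {rmorphism HK -> HW}.
Hypothesis iotaS : forall a, iota (scK a) = scW a.
Hypothesis iotaY : forall y, iota (YK y) = YW y.
Hypothesis iotaX : forall x, iota (XK x) = XW x.
Hypothesis iotaT : forall g, g \in K -> iota (TK g) = TW g.
Let actW := pbw_act pbW.
Let KW g : g \in K -> g \in W := subsetP sKW g.
Local Notation dK := (dplus rK scK YK XK).
Local Notation dW := (dplus rW scW YW XW).
Local Notation truncate := (truncate K scK YK XK TK coW).

Let coI h : coW (iota h) = coK h.
Proof. exact: (co_iota pbK pbW iotaS iotaY iotaX iotaT _). Qed.
Let injI : injective iota.
Proof. exact: (iota_inj pbK pbW iotaS iotaY iotaX iotaT). Qed.

Let coWB h h' g : coW (h - h') g = coW h g - coW h' g.
Proof. by rewrite (coB pbW) VBE. Qed.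

Lemma rootK s : s \in reflections rK -> root_coroot rK s (alpha s) (alphav s).
Proof. move=> Rs; exact: rootW (subsetP (reflections_normal_sub nKW rW) _ Rs). Qed.

(** The first power of the ideal for K need not land in the ideal for W. The exponent is the order
    of coordinates that forces membership for W. *)
Lemma iota_ipow h : ipow dK (ord_bound W n) h -> ipow dW 1 (iota h).
Proof.
move=> Jh; apply: (ord_ipow two_neq0 rootW pbW) => g; rewrite coI.
exact: (ipow_ord two_neq0 rootK pbK).
Qed.

Lemma dplus_iota d : dW d -> exists2 d', dK d' & iota d' = d.
Proof.
have iw (vK : 'I_n -> HK) (vW : 'I_n -> HW) f : (forall i, iota (vK i) = vW i) ->
    iota (wev vK scK f) = wev vW scW f.
  move=> e; rewrite /wev /mlin rmorph_sum; apply: eq_bigr => m _.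
  rewrite rmorphM iotaS rmorph_prod; congr (_ * _).
  by apply: eq_bigr => i _; rewrite rmorphXn e.
case=> s [sI s0 ->]; exists (\sum_(fg <- s) evX scK XK fg.1 * evY scK YK fg.2).
  exists s; split=> // fg /sI[I1 I2]; split=> g Kg; [exact: I1 (KW Kg) | exact: I2 (KW Kg)].
rewrite rmorph_sum; apply: eq_bigr => fg _; rewrite rmorphM.
by congr (_ * _); apply: iw.
Qed.

(** Invariants of W are invariants of K, so the generators of the ideal come from K, and left
    multiplication by them commutes with truncation. *)
Lemma truncate_ipow h : ipow dW 1 h -> ipow dK 1 (truncate h).
Proof.
elim=> [|d x z /dplus_iota[d' dd' <-] _ _ IH].
  by rewrite (truncate0 pbK pbW); left.
rewrite (truncateD pbK pbW) (truncateMl pbK pbW iotaS iotaY iotaX iotaT).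
by right.
Qed.

Lemma iota_ipow_inv h : ipow dW 1 (iota h) -> ipow dK 1 h.
Proof. by move/truncate_ipow; rewrite (truncate_iota pbK pbW iotaS iotaY iotaX iotaT). Qed.

Lemma evp_mulX f p : (forall y, YW y * evX scW XW f = evX scW XW f * YW y) ->
  evp scW YW XW p * evX scW XW f = evp scW YW XW (p * pX n F f).
Proof.
move=> fY; have -> : evp scW YW XW p * evX scW XW f = evX scW XW f * evp scW YW XW p.
  elim/(@phase_ind F F idfun n): p => [a|p q ep eq|z p ep|z p ep].
  - by rewrite evpC (pbw_scC pbW).
  - by rewrite evpD mulrDl mulrDr ep eq.
  - by rewrite (evp_LX actW (pbw_scC pbW)) mulrA (evX_X pbW) -!mulrA ep.
  - by rewrite (evp_LY actW (pbw_scC pbW)) -mulrA fY !mulrA ep.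
have XC i j : XW (delta_mx i 0) * XW (delta_mx j 0) = XW (delta_mx j 0) * XW (delta_mx i 0).
  exact: (ca_XX actW).
have scX a i : scW a * XW (delta_mx i 0) = XW (delta_mx i 0) * scW a by apply: (pbw_scC pbW).
rewrite mulrC /evX /pX; elim/mpoly_ind: f {fY} p => [a|f f' e e'|i f e] p.
- by rewrite wevC membedC evpMC.
- by rewrite wevD rmorphD !mulrDl evpD e e'.
- by rewrite (wevX XC scX) rmorphM membedX -!mulrA (evp_Xl actW (pbw_scC pbW)) e.
Qed.

Lemma co_mul_evX e f g : g \in W ->
  (forall g y, g \in W -> YW y * evX scW XW (msubst (rW g)^T f) = evX scW XW (msubst (rW g)^T f) * YW y) ->
  coW (e * evX scW XW f) g = coW e g * pX n F (msubst (rW g)^T f).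
Proof.
move=> Wg fY; have := @ev_right _ _ _ _ _ _ _ _ _ _ _ _ _ _ _ _ _ pbW (evX scW XW f)
  (fun g => if g \in W then pX n F (msubst (rW g)^T f) else 0) e _ g.
rewrite Wg; apply=> h q Wh; rewrite Wh -mulrA (hT_evX pbW) // map_mx_id // mulrA.
by rewrite evp_mulX // => y; apply: fY.
Qed.

(** This is the w-coordinate of a commutator of e with f: multiplication by f on the left multiplies
    it by f, and on the right by the translate w f. *)
Lemma comm_ordge m e f w : w \in W -> centralmod dW m e ->
  (forall g y, g \in W -> YW y * evX scW XW (msubst (rW g)^T f) = evX scW XW (msubst (rW g)^T f) * YW y) ->
  ordge m ((pX n F f - pX n F (msubst (rW w)^T f)) * coW e w).
Proof.
move=> Ww ce fY; have := ipow_ord two_neq0 rootW pbW (ce (evX scW XW f)) w.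
rewrite coWB (co_evX pbW) co_mul_evX //; set f' := pX _ _ f; set f2 := pX _ _ _.
move: (coW e w) => v o m' md; have := o m' md; rewrite !mcoeffB.
by rewrite mulrBl mcoeffB (mulrC v) => /eqP; rewrite subr_eq0 => /eqP ->; rewrite subrr.
Qed.

Section OffSubgroup.
Variables (w : gT).
Hypotheses (Ww : w \in W) (nKw : w \notin K).

(** As w is not in K, faithfulness makes the differences [rW w - rW g] nonzero for all g in K. *)
Let generic : exists x : 'cV[F]_n, forall g, g \in K -> rW w *m x - rW g *m x != 0.
Proof.
have [g Kg|x xP] := @generic_vector F n gT (mem K) (fun g => rW w - rW g) ch0.
  apply: contra nKw; rewrite subr_eq0 => /eqP e.
  by rewrite (mx_faithful_inj faithW Ww (KW Kg) e).
by exists x => g Kg; rewrite -mulmxBl; apply: xP.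
Qed.

Section Orbit.
Variable x : 'cV[F]_n.

(** The polynomial with roots the translates of the form x by the coset v K. Normality of K makes
    its coefficients K-invariant, and W permutes these polynomials. *)
Let Q : gT -> {poly mpoly n F} :=
  locked (fun v => \prod_(g in K) ('X - (linform (rW (v * g)%g *m x))%:P)).
Let QE v : Q v = \prod_(g in K) ('X - (linform (rW (v * g)%g *m x))%:P).
Proof. by rewrite /Q -lock. Qed.

Let subst_Q v u j : v \in W -> u \in W -> msubst (rW v)^T (Q u)`_j = (Q (v * u)%g)`_j.
Proof.
move=> Wv Wu; have [s sE] := msubst_rmorphism (rW v)^T; rewrite -sE -coef_map.
suff -> : map_poly s (Q u) = Q (v * u)%g by []; rewrite !QE.
apply: etrans (map_prod_XsubC _ _ _) _; apply: eq_bigr => g Kg; congr ('X - (_)%:P).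
apply: etrans (sE _) _; rewrite msubst_linform trmxK mulmxA -repr_mxM ?mulgA //.
exact: (groupM Wu (KW Kg)).
Qed.

Let Q_K v g : v \in W -> g \in K -> Q (g * v)%g = Q v.
Proof.
move=> Wv Kg; have Kgv : (g ^ v)%g \in K by rewrite memJ_norm // (subsetP (normal_norm nKW)).
rewrite !QE [RHS](reindex_inj (mulgI (g ^ v)%g)) /=.
apply: eq_big => [h|h Kh]; first by rewrite groupMl.
by rewrite conjgE !mulgA mulgV mul1g.
Qed.

(* Off K the function c vanishes, so K-invariants in the X variables commute with all Y. *)
Let Q_Y v j y : v \in W -> YW y * evX scW XW (Q v)`_j = evX scW XW (Q v)`_j * YW y.
Proof.
move=> Wv; apply: (evX_Y two_neq0 rootW pbW) => s Rs; rewrite /extend_by_zero.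
case: ifP => [RKs|_]; [right | by left].
have Ks := refl_mem RKs; by rewrite (subst_Q j (KW Ks) Wv) (Q_K Wv Ks).
Qed.

Lemma orbit_ordge m e j : centralmod dW m e ->
  ordge m ((pX n F (Q 1%g)`_j - pX n F (Q w)`_j) * coW e w).
Proof.
have eQ v : v \in W -> msubst (rW v)^T (Q 1%g)`_j = (Q v)`_j.
  by move=> Wv; rewrite (subst_Q j Wv (group1 W)) mulg1.
move=> ce; rewrite -(eQ w Ww); apply: (comm_ordge Ww ce) => g y Wg.
by rewrite (eQ g Wg); exact: (Q_Y j y Wg).
Qed.

Lemma orbit_product m e : centralmod dW m e ->
  ordge m ((\prod_(g in K) LX idfun (rW w *m x - rW g *m x)) * coW e w).
Proof.
move=> ce; pose p : {rmorphism _ -> _} := pX n F.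
have LXB (a b : 'cV[F]_n) : LX idfun (a - b) = LX idfun a - LX idfun b :> mpoly (n + n) F.
  by rewrite -scaleN1r addrC LX_lin rmorphN1 scaleN1r addrC.
have hQ v : (map_poly p (Q v)).[LX idfun (rW w *m x)] =
    \prod_(g in K) (LX idfun (rW w *m x) - LX idfun (rW (v * g)%g *m x)).
  rewrite QE map_prod_XsubC horner_prod; apply: eq_bigr => g _.
  by rewrite hornerXsubC /p pX_linform.
(* At T = w x the polynomial [Q w] vanishes through its factor g = 1. Subtracting it changes nothing
   there, but turns the coefficients into the differences bounded by [orbit_ordge]. *)
have -> : \prod_(g in K) LX idfun (rW w *m x - rW g *m x) =
    (map_poly p (Q 1%g) - map_poly p (Q w)).[LX idfun (rW w *m x)] :> mpoly (n + n) F.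
  rewrite hornerD hornerN !hQ [X in _ - X](bigD1 1%g) ?group1 //= mulg1 subrr mul0r subr0.
  by apply: eq_bigr => g _; rewrite LXB mul1g.
rewrite horner_coef mulr_suml; apply: ordge_sum => j _.
rewrite coefB !coef_map /= mulrAC; move: (orbit_ordge j ce) => o.
by rewrite -[m]addn0; apply: ordgeM.
Qed.

End Orbit.

(** Each of the #|K| nonzero linear forms in [orbit_product] costs one order. *)
Lemma centralmod_off m e : centralmod dW (m + #|K|) e -> ordge m (coW e w).
Proof.
move=> ce; have [x xP] := generic.
apply: (@ordge_prod_linear F n gT (enum K) (fun g => rW w *m x - rW g *m x)).
  by move=> g; rewrite mem_enum; apply: xP.
by rewrite -cardE big_enum; apply: orbit_product.
Qed.

End OffSubgroup.

Lemma central_descends z : central z -> exists2 z', central z' & iota z' = z.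
Proof.
move=> zC; have e : iota (truncate z) = z.
  apply: (truncateK pbK pbW iotaS iotaY iotaX iotaT) => w Ww nKw; apply/mpolyP => m; rewrite mcoeff0.
  (* A central element is central modulo every power; to kill the coefficient at m, an order one
     above the degree of m suffices. *)
  apply: (@centralmod_off w Ww nKw (mdeg m).+1) => // a.
  by rewrite zC subrr; apply: ipow0.
by exists (truncate z) => // a; apply: injI; rewrite !rmorphM e zC.
Qed.

(** [ord_bound W n] is the order that puts the part off K into the ideal, and #|K| pays for the
    division in [centralmod_off]. *)
Lemma centralmod_descends e : centralmod dW (ord_bound W n + #|K|) e ->
  exists h, [/\ ipow dW 1 (e - iota h) & centralmod dK 1 h].
Proof.
move=> ce; have J : ipow dW 1 (e - iota (truncate e)).
  apply: (ord_ipow two_neq0 rootW pbW) => g; rewrite coWB coI (co_truncate pbK); case: ifP => [_|/negbT nKg]; first by rewrite subrr; apply: ordge_0.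
  rewrite subr0; case: (boolP (g \in W)) => Wg; first exact: centralmod_off.
  by rewrite (pbw_supp pbW) //; apply: ordge_0.
exists (truncate e); split=> // a; apply: iota_ipow_inv; rewrite rmorphB !rmorphM.
have Dc := dplus_central two_neq0 rootW pbW.
have -> : iota (truncate e) * iota a - iota a * iota (truncate e) =
  (e * iota a - iota a * e) - ((e - iota (truncate e)) * iota a - iota a * (e - iota (truncate e))).
  by rewrite mulrBl mulrBr [RHS]addrACA_sub !subKr.
apply: (ipowB Dc); last by apply: (ipowB Dc); [apply: ipowMr | apply: (ipowMl Dc)].
by apply: (ipow_le Dc _ (ce _)); apply: ltn_addr.
Qed.

End Descent.

Section CommutingProducts.
Variables (R : pzRingType) (I : eqType) (F : I -> R).

Lemma comm_prod_seq a s : (forall i, i \in s -> a * F i = F i * a) ->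
  a * (\prod_(i <- s) F i) = (\prod_(i <- s) F i) * a.
Proof.
move=> aF; rewrite big_seq; apply: (big_ind (fun z => a * z = z * a)) => [|x y ex ey|i /aF //].
  by rewrite mulr1 mul1r.
by rewrite mulrA ex -mulrA ey mulrA.
Qed.

Lemma perm_prod_comm s1 s2 : perm_eq s1 s2 -> {in s1 &, forall i j, F i * F j = F j * F i} ->
  \prod_(i <- s1) F i = \prod_(i <- s2) F i.
Proof.
elim: s1 s2 => [|x s1 IH] s2; first by rewrite perm_sym => /perm_nilP->.
move=> p cF; have xs2 : x \in s2 by rewrite -(perm_mem p) mem_head.
case/splitPr: xs2 p => a b; rewrite perm_sym (perm_catCA a [:: x] b) perm_sym perm_cons => p.
rewrite big_cat !big_cons /= mulrA -comm_prod_seq.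
  rewrite -mulrA -big_cat; congr (_ * _); apply: IH => // i j is1 js1.
  by apply: cF; rewrite inE ?is1 ?js1 orbT.
move=> i ia; apply: cF; rewrite ?mem_head // inE (perm_mem p) mem_cat ia orbT //.
Qed.

Lemma prod_comm_idempotent s : {in s &, forall i j, F i * F j = F j * F i} ->
  {in s, forall i, F i * F i = F i} ->
  (\prod_(i <- s) F i) * (\prod_(i <- s) F i) = \prod_(i <- s) F i.
Proof.
elim: s => [|x s IH] cF iF; first by rewrite big_nil mulr1.
have sx i : i \in s -> i \in x :: s by rewrite inE => ->; rewrite orbT.
rewrite !big_cons; set P := \prod_(i <- s) F i.
have PP : P * P = P.
  by apply: IH => [i j /sx xi /sx xj|i /sx xi]; [apply: cF | apply: iF].
have xP : F x * P = P * F x by apply: comm_prod_seq => i /sx xi; rewrite cF ?mem_head.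
by rewrite -mulrA (mulrA P) -xP -(mulrA (F x)) PP mulrA iF ?mem_head.
Qed.

End CommutingProducts.

Lemma compl_idem (R : pzRingType) (e : R) : e * e = e -> (1 - e) * (1 - e) = 1 - e.
Proof. by move=> ee; rewrite mulrBl mul1r mulrBr mulr1 ee subrr subr0. Qed.

Lemma compl_comm (R : pzRingType) (e f : R) : e * f = f * e -> (1 - e) * f = f * (1 - e).
Proof. by move=> ef; rewrite mulrBl mulrBr mul1r mulr1 ef. Qed.

(** * Central idempotents for W built from those for K *)

Section Ascent.
Variables (F : fieldType) (gT : finGroupType) (W K : {group gT}) (nKW : (K <| W)%g) (n : nat).
Variable rW : mx_representation F W n.
Variables (alpha : gT -> 'cV[F]_n) (alphav : gT -> 'rV[F]_n) (c : gT -> F).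
Local Notation sKW := (normal_sub nKW).
Local Notation rK := (subg_repr rW sKW).
Local Notation cW := (extend_by_zero rK c).
Hypothesis two_neq0 : 2 != 0 :> F.
Hypothesis rootW : forall s, s \in reflections rW -> root_coroot rW s (alpha s) (alphav s).
Variables (HK : pzRingType) (scK : {rmorphism F -> HK}) (YK : 'rV[F]_n -> HK).
Variables (XK : 'cV[F]_n -> HK) (TK : gT -> HK) (coK : HK -> dunkl_space gT n F).
Hypothesis pbK : pbw_ring rK alpha alphav c idfun 0 scK YK XK TK coK.
Variables (HW : pzRingType) (scW : {rmorphism F -> HW}) (YW : 'rV[F]_n -> HW).
Variables (XW : 'cV[F]_n -> HW) (TW : gT -> HW) (coW : HW -> dunkl_space gT n F).
Hypothesis pbW : pbw_ring rW alpha alphav cW idfun 0 scW YW XW TW coW.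
Variable iota : {rmorphism HK -> HW}.
Hypothesis iotaS : forall a, iota (scK a) = scW a.
Hypothesis iotaY : forall y, iota (YK y) = YW y.
Hypothesis iotaX : forall x, iota (XK x) = XW x.
Hypothesis iotaT : forall g, g \in K -> iota (TK g) = TW g.
Let actW := pbw_act pbW.
Local Notation dK := (dplus rK scK YK XK).
Local Notation dW := (dplus rW scW YW XW).
Variables (B : pzRingType) (pi : {rmorphism HW -> B}).
Hypothesis pi_surj : forall b, exists h, b = pi h.
Hypothesis pi_ker : forall h, pi h = 0 <-> ipow dW 1 h.

Let th_subproof : exists th : gT -> HK -> HK,
  forall w h, w \in W -> iota (th w h) = TW w * iota h * TW w^-1%g.
Proof.
have H w h : exists h', w \in W -> iota h' = TW w * iota h * TW w^-1%g.
  case: (boolP (w \in W)) => [Ww|_]; last by exists 0.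
  by have [h' e] := iota_conj pbK pbW iotaS iotaY iotaX iotaT h Ww; exists h'.
by exists (fun w h => sval (cid (H w h))) => w h; apply: svalP (cid (H w h)).
Qed.

Lemma ct_iota h g : ct coW (iota h) g = ct coK h g.
Proof. by rewrite /ct (co_iota pbK pbW iotaS iotaY iotaX iotaT). Qed.

Lemma ct_conj w h h' x : w \in W -> iota h' = TW w * iota h * TW w^-1%g ->
  ct coK h' x = ct coK h (x ^ w)%g.
Proof.
move=> Ww e; rewrite -!ct_iota e -mulrA (ct_T pbW) // (ct_Tr pbW) ?groupV //.
by rewrite invgK conjgE mulgA.
Qed.

(** The commutator with a is the conjugate of the one between h and w^-1 a w. The latter lies in a
    high power for K, hence in the ideal of W, which is two-sided and so stable under conjugation by
    T w. *)
Lemma centralmod_conj w h h' : w \in W -> iota h' = TW w * iota h * TW w^-1%g ->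
  centralmod dK (ord_bound W n) h ->
  forall a, pi (iota h') * pi (iota a) = pi (iota a) * pi (iota h').
Proof.
move=> Ww e ch a; apply/eqP; rewrite -subr_eq0; apply/eqP; rewrite -!(rmorphM pi) -(rmorphB pi).
apply/pi_ker; have [th thE] := th_subproof.
have ea : iota a = TW w * iota (th w^-1%g a) * TW w^-1%g.
  rewrite thE ?groupV // invgK !mulrA (TW_conjV pbW Ww) mul1r -mulrA.
  by rewrite (TW_conjV pbW Ww) mulr1.
have cM u v : (TW w * u * TW w^-1%g) * (TW w * v * TW w^-1%g) = TW w * (u * v) * TW w^-1%g.
  by rewrite !mulrA; congr (_ * _ * _); rewrite -(mulrA (_ * _)) (TW_conj_inv pbW Ww) mulr1.
have -> : iota h' * iota a - iota a * iota h' =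
    TW w * (iota (h * th w^-1%g a - th w^-1%g a * h)) * TW w^-1%g.
  by rewrite e ea !cM rmorphB !rmorphM -mulrBl -mulrBr.
have Dc := dplus_central two_neq0 rootW pbW.
apply/ipowMr/(ipowMl Dc)/(iota_ipow two_neq0 rootW pbK pbW iotaS iotaY iotaX iotaT).
exact: ch.
Qed.

Lemma conj_idempotent w h h' : w \in W -> iota h' = TW w * iota h * TW w^-1%g ->
  idemmod dK (ord_bound W n) h -> pi (iota h') * pi (iota h') = pi (iota h').
Proof.
move=> Ww e ch; apply/eqP; rewrite -subr_eq0; apply/eqP; rewrite -!(rmorphM pi) -(rmorphB pi).
apply/pi_ker; have -> : iota h' * iota h' - iota h' = TW w * (iota (h * h - h)) * TW w^-1%g.
  rewrite e rmorphB rmorphM mulrBr mulrBl; congr (_ - _).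
  by rewrite !mulrA; congr (_ * _ * _); rewrite -(mulrA (_ * _)) (TW_conj_inv pbW Ww) mulr1.
have Dc := dplus_central two_neq0 rootW pbW.
apply/ipowMr/(ipowMl Dc)/(iota_ipow two_neq0 rootW pbK pbW iotaS iotaY iotaX iotaT).
exact: ch.
Qed.

(* The boolean union of the W-conjugates of a central idempotent of the algebra of K. *)
Lemma norm_idempotent u0 : centralmod dK 1 u0 -> idemmod dK 1 u0 ->
  exists (g : HK) (uu : gT -> HK),
  [/\ central_idempotent (pi (iota g)),
      forall w x, w \in W -> ct coK (uu w) x = ct coK u0 (x ^ w)%g,
      forall w, w \in W -> centralmod dK 1 (uu w) /\ idemmod dK 1 (uu w)
    & g = 1 - \prod_(w <- enum W) (1 - uu w)].
Proof.
move=> cu iu; have DcK := dplus_central two_neq0 (rootK rootW) pbK.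
(* The exponent is the one for which [iota_ipow] makes the conjugates idempotent, and commuting with
   the image of K, in the restricted algebra of W. *)
have [u [eu cu' iu']] : exists u, [/\ ipow dK 1 (u - u0), centralmod dK (ord_bound W n) u
    & idemmod dK (ord_bound W n) u] by exact: (lift_idempotent DcK).
have [th thE] := th_subproof.
exists (1 - \prod_(w <- enum W) (1 - th w u)), (fun w => th w u).
pose y w := pi (iota (th w u)).
have yC w a : w \in W -> y w * pi (iota a) = pi (iota a) * y w.
  by move=> Ww; apply: (centralmod_conj Ww (thE w u Ww)).
have yI w : w \in W -> y w * y w = y w.
  by move=> Ww; apply: (conj_idempotent Ww (thE w u Ww)).
have yT w v : w \in W -> v \in W -> pi (TW v) * y w = y (v * w)%g * pi (TW v).
  move=> Ww Wv; rewrite /y -!rmorphM !thE ?groupM // (ca_TM actW) // invMg (ca_TM actW) ?groupV //.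
  by rewrite -!mulrA (TW_conj_inv pbW Wv) mulr1 !mulrA.
pose z w := 1 - y w.
have zE : pi (iota (1 - \prod_(w <- enum W) (1 - th w u))) = 1 - \prod_(w <- enum W) z w.
  rewrite !rmorphB !rmorph1 !rmorph_prod; congr (_ - _).
  by apply: eq_bigr => w _; rewrite !rmorphB !rmorph1.
have zz v w : v \in W -> w \in W -> z v * z w = z w * z v.
  move=> Wv Ww; apply: compl_comm; symmetry; apply: compl_comm.
  by rewrite -[y w]/(pi (iota _)) -yC.
split.
- rewrite zE; split; last first.
    apply: compl_idem; apply: prod_comm_idempotent => [i j|i]; rewrite !mem_enum => Wi.
      by move=> Wj; apply: zz.
    by apply: compl_idem; apply: yI.
  have prodC a : (\prod_(w <- enum W) z w) * pi (iota a) = pi (iota a) * \prod_(w <- enum W) z w.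
    symmetry; apply: comm_prod_seq => w; rewrite mem_enum => Ww.
    by symmetry; apply: compl_comm; apply: yC.
  move=> b; have [h ->] := pi_surj b; apply: compl_comm.
  elim/(pbw_ind pbW): h => [a|v|x|v Wv|h h' e e'|h h' e e'].
  + by rewrite -iotaS prodC.
  + by rewrite -iotaY prodC.
  + by rewrite -iotaX prodC.
  (* Passing T v replaces the factor of w by that of v w; this permutes commuting factors, so the
     product over all of W is unchanged. *)
  + have -> : pi (TW v) * \prod_(w <- enum W) z w =
        (\prod_(w <- enum W) z (v * w)%g) * pi (TW v).
      rewrite -[enum W]/(enum (mem W)); have : {subset enum W <= W} by move=> w; rewrite mem_enum.
      elim: (enum W) => [|w s IH] sW; first by rewrite !big_nil mulr1 mul1r.
      rewrite !big_cons -mulrA -IH; last by move=> i si; apply: sW; rewrite inE si orbT.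
      rewrite !mulrA; congr (_ * _); rewrite mulrBr mulr1 mulrBl mul1r yT //.
      by apply: sW; rewrite mem_head.
    congr (_ * _); rewrite -(big_map (fun w => (v * w)%g) xpredT z).
    apply: perm_prod_comm => [|i j]; last by rewrite !mem_enum; apply: zz.
    apply: uniq_perm => [||i]; rewrite ?map_inj_uniq ?enum_uniq //; try exact: mulgI.
    rewrite mem_enum; apply/idP/mapP => [Wi|[j]]; last by rewrite mem_enum => Wj ->; rewrite groupM.
    by exists (v^-1 * i)%g; rewrite ?mulKVg // mem_enum groupM ?groupV.
  + by rewrite rmorphD mulrDr mulrDl e e'.
  + by rewrite rmorphM mulrA e -mulrA e' mulrA.
- move=> w x Ww; rewrite (ct_conj x Ww (thE w u Ww)).
  have e1 := ct_ipow two_neq0 (rootK rootW) pbK (x ^ w)%g eu.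
  by move: e1; rewrite (ctD pbK) (ctN pbK) => /eqP; rewrite subr_eq0 => /eqP.
- move=> w Ww.
  split=> [a|]; apply: (iota_ipow_inv pbK pbW iotaS iotaY iotaX iotaT).
    by apply/pi_ker; rewrite !rmorphB !rmorphM -/(y w) yC // subrr.
  by apply/pi_ker; rewrite !rmorphB !rmorphM -/(y w) yI // subrr.
- by [].
Qed.

End Ascent.

(** * Clifford theory *)

Section CliffordTheory.
Variables (F : decFieldType) (gT : finGroupType) (W K : {group gT}) (nKW : (K <| W)%g).
Hypothesis ch0 : [pchar F] =i pred0.
Local Notation sKW := (normal_sub nKW).

Lemma pchar0_group (G : {group gT}) : ([pchar F]^'.-group G)%g.
Proof.
by rewrite /pgroup; apply: (sub_in_pnat _ (pnat_pi (cardG_gt0 G))) => p _ _; rewrite inE /= ch0.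
Qed.

Lemma gring_op_actmx (G : {group gT}) d (rho : mx_representation F G d) A :
  gring_op rho A = actmx rho (fun g => gring_row A 0 (gring_index G g^-1%g)).
Proof.
rewrite gring_opE /gring_mx /= mulmx_sum_row linear_sum /actmx (reindex_inj invg_inj) /=.
rewrite [RHS](eq_bigl (mem G)) => [|g]; last by rewrite groupV.
rewrite [RHS]big_enum_val; apply: eq_bigr => k _.
by rewrite linearZ /= rowK mxvecK !invgK gring_valK.
Qed.

Lemma irr_indicator (G : {group gT}) (j : Irr F G) : exists a : gT -> F,
  actmx (irr_repr j) a = 1%:M /\ forall i : Irr F G, i != j -> actmx (irr_repr i) a = 0.
Proof.
exists (fun g => gring_row (Wedderburn_id j) 0 (gring_index G g^-1%g)).
rewrite -gring_op_actmx (op_Wedderburn_id_pchar (pchar0_group G)); split=> // i ij.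
rewrite -gring_op_actmx; apply: (irr_repr'_op0_pchar (pchar0_group G)) (Wedderburn_id_mem j).
by rewrite eq_sym.
Qed.

Lemma in_restrictionP j (i : Irr F W) : in_restriction sKW j i <-> exists V,
  row_free V /\ intertwines (irr_repr j) (subg_repr (irr_repr i) sKW) V.
Proof.
split=> [[U [modU /rsim_submod_intertwines[V [fV iV _]]]]|[V [fV iV]]]; first by exists V.
by have [U [modU s]] := intertwines_rsim_submod fV iV; exists U, modU.
Qed.

Lemma restriction_exists (i : Irr F W) : exists j, in_restriction sKW j i.
Proof.
have m1 := mxmodule1 (subg_repr (irr_repr i) sKW).
have nz : 1%:M != 0 :> 'M[F]_(irr_degree i) by apply/eqP/(mx_irr1_neq0 (socle_irr i)).
have [U simU _] := dec_mxsimple_exists m1 nz; have [modU _ _] := simU.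
have irrU := (submod_mx_irr modU).2 simU.
exists (irr_comp (Irr F K) (submod_repr modU)), U, modU; apply: mx_rsim_sym.
exact: (rsim_irr_comp_pchar (Irr F K) (pchar0_group K) irrU).
Qed.

Lemma actmx_normal d (rho : mx_representation F W d) a : (forall g, g \notin K -> a g = 0) ->
  actmx rho a = actmx (subg_repr rho sKW) a.
Proof.
move=> a0; rewrite /actmx (big_setID K) /= (setIidPr sKW) [X in _ + X]big1 ?addr0 //.
by move=> g; rewrite inE => /andP[nKg _]; rewrite a0 // scale0r.
Qed.

(** Take an element of the group algebra of K acting as 1 on j and as 0 on all other irreducibles.
    If j occurred in no restriction, it would act by 0 on every irreducible of W, and so be zero. *)
Lemma induction_exists (j : Irr F K) : exists i, in_restriction sKW j i.
Proof.
have [//|no] := pselect (exists i, in_restriction sKW j i); exfalso.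
have [a [aj aN]] := irr_indicator j; pose b g := if g \in K then a g else 0.
have eb d (rho : mx_representation F K d) : actmx rho a = actmx rho b.
  by apply: eq_bigr => g Kg; rewrite /b Kg.
apply: (mx_irr1_neq0 (socle_irr j)); rewrite -aj /actmx big1 // => g Kg.
suff -> : a g = 0 by rewrite scale0r.
have <- : b g = a g by rewrite /b Kg.
apply: (irr_separates (pchar0_group W) (sG := Irr F W)) (subsetP sKW g Kg) => i.
rewrite actmx_normal => [|h /negPf nKh]; last by rewrite /b nKh.
apply: (simple_constituents_zero (pchar0_group K) (sG := Irr F K)) => k V fV iV.
rewrite -eb; apply: aN; apply/eqP => kj; apply: no; exists i.
by apply/in_restrictionP; rewrite -kj; exists V.
Qed.

Section Conjugate.
Variables (w : gT) (i : Irr F K).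
Hypothesis Ww : w \in W.

Let KJ k : k \in K -> (k ^ w)%g \in K.
Proof. by move=> Kk; rewrite memJ_norm // (subsetP (normal_norm nKW)). Qed.

Lemma conj_repr_subproof : mx_repr K (fun k => irr_repr i (k ^ w)%g).
Proof. by split=> [|k l Kk Kl]; rewrite ?conj1g ?repr_mx1 // conjMg repr_mxM ?KJ. Qed.

Definition conj_repr := MxRepresentation conj_repr_subproof.

Lemma conj_repr_irr : mx_irreducible conj_repr.
Proof.
apply/mx_irrP; case/mx_irrP: (socle_irr i) => d0 irr_i; split=> // U modU.
apply: irr_i; apply/mxmoduleP => k Kk.
have Kk' : (k ^ w^-1)%g \in K by rewrite memJ_norm // groupV (subsetP (normal_norm nKW)).
by have := mxmoduleP modU _ Kk'; rewrite /= conjgKV.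
Qed.

Lemma conj_irrP (j : Irr F K) : conj_irr w i j <-> mx_rsim conj_repr (irr_repr j).
Proof.
split=> [[B [fB uB hB]]|[B e fB hB]].
  by exists B => //; apply: etrans (esym (eqP fB)) (eqP uB).
by exists B; split=> //; apply/eqP/(etrans (eqP fB)).
Qed.

Lemma conj_irr_exists : exists j, conj_irr w i j.
Proof.
exists (irr_comp (Irr F K) conj_repr); apply/conj_irrP.
exact: (rsim_irr_comp_pchar (Irr F K) (pchar0_group K) conj_repr_irr).
Qed.

Lemma conj_irr_unique j j' : conj_irr w i j -> conj_irr w i j' -> j = j'.
Proof.
move=> /conj_irrP s /conj_irrP s'.
rewrite -(irr_reprK_pchar (pchar0_group K) j) -(irr_reprK_pchar (pchar0_group K) j').
exact/(irr_comp_rsim_pchar (Irr F K) (pchar0_group K))/(mx_rsim_trans (mx_rsim_sym s) s').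
Qed.

End Conjugate.

Lemma conj_irrM v w (i j l : Irr F K) : v \in W ->
  conj_irr w i j -> conj_irr v j l -> conj_irr (v * w)%g i l.
Proof.
move=> Wv [B [fB uB hB]] [C [fC uC hC]]; exists (B *m C).
have ed : irr_degree i = irr_degree j.
  exact: etrans (esym (eqP fB)) (eqP uB).
split.
- by rewrite /row_free mxrankMfree.
- by rewrite /row_full mxrankMfree // (eqP fB) ed -(etrans (esym (eqP fC)) (eqP uC)).
- move=> k Kk; have Kkv : (k ^ v)%g \in K by rewrite memJ_norm // (subsetP (normal_norm nKW)).
  rewrite conjgM (mulmxA _ B C) hB // -(mulmxA B (irr_repr j (k ^ v)%g) C) hC //.
  exact: mulmxA.
Qed.

Lemma conj_irr1 (i : Irr F K) : conj_irr 1%g i i.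
Proof.
exists 1%:M; rewrite row_free_unit row_full_unit unitmx1; split=> // k _.
by rewrite conjg1 mulmx1 mul1mx.
Qed.

Lemma conj_irrV w (i j : Irr F K) : w \in W -> conj_irr w i j -> conj_irr w^-1%g j i.
Proof.
move=> Ww ij; have Wv : w^-1%g \in W by rewrite groupV.
have [l jl] := conj_irr_exists j Wv.
have := conj_irrM Wv ij jl; rewrite mulVg => il.
by rewrite (conj_irr_unique (group1 W) (conj_irr1 i) il).
Qed.

Lemma conj_irr_actmx w (i j : Irr F K) a a' (z : F) : w \in W -> conj_irr w i j ->
  (forall x, x \in K -> a' x = a (x ^ w)%g) ->
  actmx (irr_repr i) a = z%:M <-> actmx (irr_repr j) a' = z%:M.
Proof.
move=> Ww [B [fB uB hB]] aa'; have e : actmx (irr_repr i) a *m B = B *m actmx (irr_repr j) a'.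
  rewrite /actmx mulmx_suml mulmx_sumr (reindex_inj (conjg_inj w)) /=.
  apply: eq_big => [k|k]; first by rewrite memJ_norm // (subsetP (normal_norm nKW)).
  rewrite memJ_norm ?(subsetP (normal_norm nKW)) // => Kk.
  by rewrite -scalemxAl -scalemxAr aa' // -conjVg hB ?groupV.
split=> [ei|ej].
  by apply: (row_full_inj uB); rewrite -e ei mul_scalar_mx mul_mx_scalar.
by apply: (row_free_inj fB); rewrite e ej mul_scalar_mx mul_mx_scalar.
Qed.

Lemma restriction_actmx j (i : Irr F W) a z : in_restriction sKW j i ->
  actmx (subg_repr (irr_repr i) sKW) a = z%:M -> actmx (irr_repr j) a = z%:M.
Proof.
case/in_restrictionP => V [fV iV] e; apply: (row_free_inj fV).
by rewrite (intertwines_act a iV) e mul_mx_scalar mul_scalar_mx.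
Qed.

End CliffordTheory.

(** * Comparison of blocks *)

Lemma image_eq (R B : pzRingType) (pi : {rmorphism R -> B}) a b : pi (a - b) = 0 -> pi a = pi b.
Proof. by rewrite rmorphB => /eqP; rewrite subr_eq0 => /eqP. Qed.

Lemma idem_image (A R B : pzRingType) (iota : {rmorphism A -> R}) (pi : {rmorphism R -> B}) h :
  pi (iota h) * pi (iota h) = pi (iota h) -> pi (iota (h * h - h)) = 0.
Proof. by move=> e; rewrite !rmorphB !rmorphM e subrr. Qed.

Lemma conj_image (R B : pzRingType) (pi : {rmorphism R -> B}) a b h : a * b = 1 ->
  central (pi h) -> pi (a * h * b) = pi h.
Proof. by move=> ab hC; rewrite 2!rmorphM -hC -mulrA -rmorphM ab rmorph1 mulr1. Qed.

Section BlockTransfer.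
Variables (F : decFieldType) (gT : finGroupType) (W K : {group gT}) (nKW : (K <| W)%g) (n : nat).
Variable rW : mx_representation F W n.
Variables (alpha : gT -> 'cV[F]_n) (alphav : gT -> 'rV[F]_n) (c : gT -> F).
Local Notation sKW := (normal_sub nKW).
Local Notation rK := (subg_repr rW sKW).
Local Notation cW := (extend_by_zero rK c).
Hypothesis two_neq0 : 2 != 0 :> F.
Hypothesis ch0 : [pchar F] =i pred0.
Hypothesis faithW : mx_faithful rW.
Hypothesis rootW : forall s, s \in reflections rW -> root_coroot rW s (alpha s) (alphav s).
Local Notation HK := (Hc rK alpha alphav c).
Local Notation scK := (ch_scal rK alpha alphav c idfun 0).
Local Notation XK := (ch_X rK alpha alphav c idfun 0).
Local Notation YK := (ch_Y rK alpha alphav c idfun 0).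
Local Notation TK := (ch_T rK alpha alphav c idfun 0).
Variable coK : HK -> dunkl_space gT n F.
Hypothesis pbK : pbw_ring rK alpha alphav c idfun 0 scK YK XK TK coK.
Local Notation HW := (Hc rW alpha alphav cW).
Local Notation scW := (ch_scal rW alpha alphav cW idfun 0).
Local Notation XW := (ch_X rW alpha alphav cW idfun 0).
Local Notation YW := (ch_Y rW alpha alphav cW idfun 0).
Local Notation TW := (ch_T rW alpha alphav cW idfun 0).
Variable coW : HW -> dunkl_space gT n F.
Hypothesis pbW : pbw_ring rW alpha alphav cW idfun 0 scW YW XW TW coW.
Variable iota : {rmorphism HK -> HW}.
Hypothesis iotaS : forall a, iota (scK a) = scW a.
Hypothesis iotaY : forall y, iota (YK y) = YW y.
Hypothesis iotaX : forall x, iota (XK x) = XW x.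
Hypothesis iotaT : forall g, g \in K -> iota (TK g) = TW g.
Local Notation dK := (dplus rK scK YK XK).
Local Notation dW := (dplus rW scW YW XW).
Local Notation piK := (ring_proj (@D_plus F gT K n rK alpha alphav c)).
Local Notation piW := (ring_proj (@D_plus F gT W n rW alpha alphav cW)).
Local Notation LK := (L rK alpha alphav c).
Local Notation LW := (L rW alpha alphav cW).
Let rootK_ := rootK (nKW := nKW) rootW.
Let F'K := pchar0_group ch0 K.
Let F'W := pchar0_group ch0 W.

Lemma central_idempotent_ipow (R B : pzRingType) (D : R -> Prop) (pi : {rmorphism R -> B}) :
  (forall b, exists h, b = pi h) -> (forall h, pi h = 0 <-> ipow D 1 h) ->
  forall h, central_idempotent (pi h) <-> centralmod D 1 h /\ idemmod D 1 h.
Proof.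
move=> surj ker h; split=> [[hC hI]|[hC hI]]; split.
- by move=> a; apply/ker; rewrite rmorphB !rmorphM hC subrr.
- by apply/ker; rewrite rmorphB rmorphM hI subrr.
- move=> b; have [a ->] := surj b; apply/eqP; rewrite -subr_eq0 -!(rmorphM pi) -(rmorphB pi).
  by apply/eqP/ker.
- by apply/eqP; rewrite -subr_eq0 -!(rmorphM pi) -(rmorphB pi); apply/eqP/ker.
Qed.

Let ciK := central_idempotent_ipow (@bar_surj _ _ _ _ rK alpha alphav c) (bar_ker two_neq0 rootK_ pbK).
Let ciW := central_idempotent_ipow (@bar_surj _ _ _ _ rW alpha alphav cW) (bar_ker two_neq0 rootW pbW).

Lemma act_iota (i : Irr F W) h : actmx (irr_repr i) (ct coW (iota h)) =
  actmx (subg_repr (irr_repr i) sKW) (ct coK h).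
Proof.
rewrite -(actmx_normal nKW) => [|g nKg]; last exact: (ct_out pbK).
by apply: eq_bigr => g _; rewrite (ct_iota pbK pbW iotaS iotaY iotaX iotaT).
Qed.

Lemma act_restrict j i h z : in_restriction sKW j i ->
  actmx (irr_repr i) (ct coW (iota h)) = z%:M -> actmx (irr_repr j) (ct coK h) = z%:M.
Proof. by move=> ji; rewrite act_iota; apply: restriction_actmx. Qed.

Lemma act_dich (i : Irr F W) h : central_idempotent (piW h) ->
  actmx (irr_repr i) (ct coW h) = 0 \/ actmx (irr_repr i) (ct coW h) = 1%:M.
Proof. exact: (central_idempotent_act two_neq0 rootW pbW (socle_irr i)). Qed.

(** A central idempotent acts on an irreducible of W by 0 or by 1, so a single constituent over K
    decides which. *)
Lemma act_restrict_idem j i h : in_restriction sKW j i -> central_idempotent (piW (iota h)) ->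
  actmx (irr_repr i) (ct coW (iota h)) = 1%:M <-> actmx (irr_repr j) (ct coK h) = 1%:M.
Proof.
have s0 m : 0%:M = 0 :> 'M[F]_m by apply/matrixP => a b; rewrite !mxE mul0rn.
move=> ji hI; split; first exact: act_restrict.
move=> e1; have [e0|//] := act_dich i hI.
case: (mx_irr1_neq0 (socle_irr j)); rewrite -e1 -[RHS]s0.
by apply: (act_restrict ji); rewrite e0 s0.
Qed.

Lemma act_bar (i : Irr F W) h h' : piW h = piW h' ->
  actmx (irr_repr i) (ct coW h) = actmx (irr_repr i) (ct coW h').
Proof.
move=> e; have J : ipow dW 1 (h - h').
  by apply/(bar_ker two_neq0 rootW pbW); rewrite rmorphB /= e subrr.
apply: eq_bigr => g _; have := ct_ipow two_neq0 rootW pbW g J.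
by rewrite (ctD pbW) (ctN pbW) => /eqP; rewrite subr_eq0 => /eqP->.
Qed.

Lemma central_idempotent_descends h0 : central_idempotent (piW h0) -> exists2 h,
  central_idempotent (piK h) & piW (iota h) = piW h0.
Proof.
move=> h0I; have [hC hI] := (ciW h0).1 h0I; have Dc := dplus_central two_neq0 rootW pbW.
have [e [eJ eC _]] := lift_idempotent Dc (ord_bound W n + #|K|) hC hI.
have [h [hJ hCK]] := centralmod_descends two_neq0 ch0 faithW rootW pbK pbW iotaS iotaY iotaX iotaT
  (fun a => ipow_le Dc (leqnSn _) (eC a)).
have eh : piW (iota h) = piW h0.
  have := (bar_ker two_neq0 rootW pbW _).2 eJ; have := (bar_ker two_neq0 rootW pbW _).2 hJ.
  by move=> /image_eq <- /image_eq.
exists h; last exact: eh.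
apply/ciK; split; first exact: hCK.
apply: (iota_ipow_inv pbK pbW iotaS iotaY iotaX iotaT); apply/(bar_ker two_neq0 rootW pbW).
exact: (idem_image (etrans (congr1 (fun x => x * x) eh) (etrans h0I.2 (esym eh)))).
Qed.

Lemma bar_conj w h h' : w \in W -> central_idempotent (piW (iota h)) ->
  iota h' = TW w * iota h * TW w^-1%g -> piW (iota h') = piW (iota h).
Proof.
move=> Ww [hC _] ->; exact: conj_image (TW_conjV pbW Ww) hC.
Qed.

(** A central idempotent for W is represented by some h over K, and a conjugate of h has the same
    image for W. Testing h on i1, j1 and j, and then its conjugate on j2 and i2, gives the same
    answer throughout. *)
Lemma block_up w j1 j j2 i1 i2 : w \in W -> in_restriction sKW j1 i1 -> in_restriction sKW j2 i2 ->
  same_block (LK j1) (LK j) -> conj_irr w j j2 -> same_block (LW i1) (LW i2).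
Proof.
move=> Ww ji1 ji2 /(blockP two_neq0 F'K rootK_ pbK) bl jj2.
apply/(blockP two_neq0 F'W rootW pbW) => h0 h0I.
have [h hI eh] := central_idempotent_descends h0I.
have hIW : central_idempotent (piW (iota h)) by rewrite eh.
have [h' eh'] := iota_conj pbK pbW iotaS iotaY iotaX iotaT h Ww.
have eh2 := bar_conj Ww hIW eh'.
rewrite -(act_bar i1 eh) -(act_bar i2 eh) -(act_bar i2 eh2).
apply: iff_trans (act_restrict_idem ji1 hIW) _; apply: iff_trans (bl h hI) _.
apply: iff_trans (conj_irr_actmx nKW 1 Ww jj2
  (fun x _ => ct_conj pbK pbW iotaS iotaY iotaX iotaT x Ww eh')) _.
have hI' : central_idempotent (piW (iota h')) by rewrite eh2.
by have [] := act_restrict_idem ji2 hI'; split.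
Qed.

Let barW_surj := @bar_surj _ _ _ _ rW alpha alphav cW.

(** A central idempotent for K is transported by w to another one; [norm_idempotent] is used here
    for its individual conjugates [uu], not for their union. *)
Lemma block_conj w j1 j2 j1' j2' : w \in W -> same_block (LK j1) (LK j2) ->
  conj_irr w j1 j1' -> conj_irr w j2 j2' -> same_block (LK j1') (LK j2').
Proof.
move=> Ww /(blockP two_neq0 F'K rootK_ pbK) bl c1 c2.
apply/(blockP two_neq0 F'K rootK_ pbK) => h' h'I; have Wv : w^-1%g \in W by rewrite groupV.
have [h'C h'i] := (ciK h').1 h'I.
have [_ [uu [_ ct_uu uuI _]]] := norm_idempotent two_neq0 rootW pbK pbW iotaS iotaY iotaX iotaT
  barW_surj (bar_ker two_neq0 rootW pbW) h'C h'i.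
have uI := (ciK (uu w^-1%g)).2 (uuI _ Wv).
have ct_h x : x \in K -> ct coK h' x = ct coK (uu w^-1%g) (x ^ w)%g.
  by move=> _; rewrite ct_uu // conjgK.
apply: iff_trans (iff_sym (conj_irr_actmx nKW 1 Ww c1 ct_h)) _.
by apply: iff_trans (bl _ uI) (conj_irr_actmx nKW 1 Ww c2 ct_h).
Qed.

Lemma act_mul_comm d (rho : mx_representation F K d) a b : centralmod dK 1 a ->
  actmx rho (ct coK (a * b)) = actmx rho (ct coK b) *m actmx rho (ct coK a).
Proof. by move=> aC; apply: (ctmx_comm two_neq0 rootK_ pbK) => x; apply: aC. Qed.

Lemma act_union (j : Irr F K) (uu : gT -> HK) (s : seq gT) :
  (forall w, w \in s -> centralmod dK 1 (uu w) /\ idemmod dK 1 (uu w)) ->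
  let p := \prod_(w <- s) (1 - uu w) in
  (exists2 w, w \in s & actmx (irr_repr j) (ct coK (uu w)) = 1%:M) /\ actmx (irr_repr j) (ct coK p) = 0
  \/ (forall w, w \in s -> actmx (irr_repr j) (ct coK (uu w)) = 0) /\
     actmx (irr_repr j) (ct coK p) = 1%:M.
Proof.
elim: s => [|w s IH] uuI p; rewrite {}/p.
  by right; split=> //; rewrite big_nil; apply: (act1 pbK).
have wI := uuI w (mem_head w s); have DcK := dplus_central two_neq0 rootK_ pbK.
have cw : centralmod dK 1 (1 - uu w).
  move=> a; have -> : (1 - uu w) * a - a * (1 - uu w) = - (uu w * a - a * uu w).
    by rewrite mulrBl mulrBr mul1r mulr1 addrACA_sub subrr sub0r.
  by apply: (ipowN DcK); apply: wI.1.
rewrite big_cons (act_mul_comm _ _ cw) (actB pbK) (act1 pbK).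
have [|[[v vs v1] ->]|[z ->]] := IH; first by move=> v vs; apply: uuI; rewrite inE vs orbT.
  by left; rewrite mul0mx; split=> //; exists v; rewrite // inE vs orbT.
rewrite mul1mx; have [w0|w1] := central_idempotent_act two_neq0 rootK_ pbK (socle_irr j) ((ciK _).2 wI).
  right; rewrite w0 subr0; split=> // v; rewrite inE => /predU1P[-> //|]; exact: z.
by left; rewrite w1 subrr; split=> //; exists w; rewrite ?mem_head.
Qed.

(** The union of the conjugates of the block idempotent of j1 acts as 1 on j1, hence on i1, on i2
    and on j2. So one of these conjugates acts as 1 on j2, which places a conjugate of j2 in the
    block of j1. *)
Lemma block_down j1 i1 j2 i2 : in_restriction sKW j1 i1 -> in_restriction sKW j2 i2 ->
  same_block (LW i1) (LW i2) ->
  exists w j, [/\ w \in W, same_block (LK j1) (LK j) & conj_irr w j j2].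
Proof.
move=> ji1 ji2 /(blockP two_neq0 F'W rootW pbW) bl.
have [e [eP e1 _]] : same_block (LK j1) (LK j1) by apply/(blockP two_neq0 F'K rootK_ pbK).
have [h eh] := bar_surj e; rewrite {}eh in eP e1.
have hI : central_idempotent (piK h) by case: eP.
have onE (j : Irr F K) : (forall v : LK j, piK h *: v = v) <-> actmx (irr_repr j) (ct coK h) = 1%:M.
  exact: (simple_head_one two_neq0 rootK_ pbK (socle_irr j) hI.1).
have [hC hi] := (ciK h).1 hI.
have [g [uu [gI ct_uu uuI gE]]] := norm_idempotent two_neq0 rootW pbK pbW iotaS iotaY iotaX iotaT
  barW_surj (bar_ker two_neq0 rootW pbW) hC hi.
have sW w : w \in enum W -> centralmod dK 1 (uu w) /\ idemmod dK 1 (uu w).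
  by rewrite mem_enum; apply: uuI.
have act_g (j : Irr F K) : actmx (irr_repr j) (ct coK g) = 1%:M - actmx (irr_repr j) (ct coK (\prod_(w <- enum W) (1 - uu w))).
  by rewrite gE (actB pbK) (act1 pbK).
have j1g : actmx (irr_repr j1) (ct coK g) = 1%:M.
  rewrite act_g; have [[_ ->]|[z _]] := act_union j1 sW; first by rewrite subr0.
  case: (mx_irr1_neq0 (socle_irr j1)); rewrite -((onE j1).1 e1) -(z 1%g) ?mem_enum //.
  by apply: eq_bigr => x _; rewrite ct_uu ?group1 // conjg1.
have i2g := (bl _ gI).1 ((act_restrict_idem ji1 gI).2 j1g).
have := (act_restrict_idem ji2 gI).1 i2g; rewrite act_g.
have [[[w]]|[_ ->]] := act_union j2 sW; last first.
  by rewrite subrr => /esym /(mx_irr1_neq0 (socle_irr j2)).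
rewrite mem_enum => Ww w1 _ _; have Wv : w^-1%g \in W by rewrite groupV.
have [j jP] := conj_irr_exists nKW ch0 j2 Wv.
have := conj_irrV nKW ch0 Wv jP; rewrite invgK => jj2.
exists w, j; split=> //; exists (piK h); split=> //; apply/onE.
exact: (conj_irr_actmx nKW 1 Ww jj2 (fun x _ => ct_uu w x Ww)).2 w1.
Qed.

End BlockTransfer.

(** * Poisson brackets *)

Section Specialization.
Variables (F : fieldType) (gT : finGroupType) (G : {group gT}) (n : nat).
Variable rG : mx_representation F G n.
Variables (alpha : gT -> 'cV[F]_n) (alphav : gT -> 'rV[F]_n) (c : gT -> F).
Local Notation k := {poly F}.
Local Notation horner0 := (horner_eval (0 : F)).

Lemma ch_action_specialize (B : pzRingType) (sc : {rmorphism F -> B}) fY fX fT :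
  ch_action rG alpha alphav c idfun 0 sc fY fX fT ->
  ch_action rG alpha alphav c polyC 'X (sc \o horner0) fY fX fT.
Proof.
have h0 a : horner0 a%:P = a by rewrite /horner_eval hornerC.
case=> a1 a2 a3 a4 a5 a6 a7 a8 a9 a10 a11 a12.
split=> //=; rewrite ?h0 //.
- by move=> a y y'; rewrite h0 a1.
- by move=> a y y'; rewrite h0 a2.
- move=> y x; rewrite a9 /horner_eval hornerM hornerX !mul0r; congr (_ - _).
  by apply: eq_bigr => s _; rewrite hornerC.
- by move=> a g Gg; apply: a12.
Qed.

Variables (Ht : pzRingType) (scT : {rmorphism k -> Ht}) (YT : 'rV[F]_n -> Ht).
Variables (XT : 'cV[F]_n -> Ht) (TT : gT -> Ht) (coT : Ht -> dunkl_space gT n k).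
Hypothesis pbT : pbw_ring rG alpha alphav c polyC 'X scT YT XT TT coT.
Variables (H : pzRingType) (sc : {rmorphism F -> H}) (hY : 'rV[F]_n -> H).
Variables (hX : 'cV[F]_n -> H) (hT : gT -> H) (co : H -> dunkl_space gT n F).
Hypothesis pb : pbw_ring rG alpha alphav c idfun 0 sc hY hX hT co.
Variable sp : {rmorphism Ht -> H}.
Hypothesis spS : forall a, sp (scT a) = sc a.[0].
Hypothesis spY : forall y, sp (YT y) = hY y.
Hypothesis spX : forall x, sp (XT x) = hX x.
Hypothesis spT : forall g, g \in G -> sp (TT g) = hT g.
Let actT := pbw_act pbT.
Let act := pbw_act pb.

Lemma specialize_surj z : exists u, sp u = z.
Proof.
elim/(pbw_ind pb): z => [a|y|x|g Gg|h h' [u <-] [u' <-]|h h' [u <-] [u' <-]].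
- by exists (scT a%:P); rewrite spS hornerC.
- by exists (YT y).
- by exists (XT x).
- by exists (TT g); rewrite spT.
- by exists (u + u'); rewrite rmorphD.
- by exists (u * u'); rewrite rmorphM.
Qed.

Lemma specialize_torsion_free u v : scT 'X * u = scT 'X * v -> u = v.
Proof.
move=> e; apply: (co_inj pbT); apply/ffunP => g.
have := congr1 (fun h => coT h g) e; rewrite /= !(co_sc pbT) => /mulfI; apply.
by rewrite mpolyC_eq0 polyX_eq0.
Qed.

Lemma specialize_evp p : sp (evp scT YT XT (map_mpoly polyC p)) = evp sc hY hX p.
Proof.
elim/mpoly_ind: p => [a|p q ep eq|i p ep].
- by rewrite map_mpolyC !evpC spS hornerC.
- by rewrite rmorphD !evpD rmorphD ep eq.
- rewrite rmorphM /= map_mpolyX; case: (split_ordP i) => j ->.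
    by rewrite (evp_Xl actT (pbw_scC pbT)) (evp_Xl act (pbw_scC pb)) rmorphM spX ep.
  by rewrite (evp_Yr actT) (evp_Yr act) rmorphM spY ep.
Qed.

Lemma mpoly_divX (p : mpoly (n + n) k) : exists p0 q, p = map_mpoly polyC p0 + 'X%:MP * q.
Proof.
elim/mpoly_ind: p => [a|p p' [p0 [q ->]] [p0' [q' ->]]|i p [p0 [q ->]]].
- elim/poly_ind: a => [|a b _]; first by exists 0, 0; rewrite !rmorph0 mulr0 addr0.
  exists b%:MP, a%:MP; by rewrite map_mpolyC -mpolyCM -mpolyCD addrC mulrC.
- by exists (p0 + p0'), (q + q'); rewrite rmorphD mulrDr addrACA.
- by exists ('X_i * p0), ('X_i * q); rewrite rmorphM /= map_mpolyX mulrDr mulrCA.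
Qed.

(** Each coordinate is a polynomial free of t plus a multiple of t; uniqueness of coordinates at t =
    0 makes the first part vanish. *)
Lemma specialize_ker u : sp u = 0 -> exists r, u = scT 'X * r.
Proof.
have /choice[p0 /choice[q e]] g : exists p0 q, coT u g = map_mpoly polyC p0 + 'X%:MP * q.
  exact: mpoly_divX.
rewrite -(pbw_evK pbT u) /ev rmorph_sum /=.
have spE : \sum_(g in G) sp (evp scT YT XT (coT u g) * TT g) =
    ev G sc hY hX hT [ffun g => if g \in G then p0 g else 0].
  apply: eq_bigr => g Gg; rewrite ffunE Gg rmorphM spT // e evpD evpMC rmorphD rmorphM spS.
  by rewrite hornerX rmorph0 mul0r addr0 specialize_evp.
move=> z; exists (\sum_(g in G) evp scT YT XT (q g) * TT g).
rewrite mulr_sumr; apply: eq_bigr => g Gg; rewrite e evpD evpMC mulrA.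
suff -> : p0 g = 0 by rewrite rmorph0 evp0 add0r.
have := congr1 (fun h => co h g) (etrans (esym spE) z); rewrite /= (pbw_coK pb).
  by rewrite ffunE Gg (co0 pb) ffunE.
by move=> h /negPf nGh; rewrite ffunE nGh.
Qed.

(** [poisson_bracket] with lifting expressed through the ring morphism [sp]; see
    [poisson_bracketP]. *)
Definition bracket (z1 z2 z : H) : Prop := exists u1 u2 u : Ht,
  [/\ sp u1 = z1, sp u2 = z2, sp u = z & u1 * u2 - u2 * u1 = scT 'X * u].

Lemma bracket_exists z1 z2 : central z1 -> exists z, bracket z1 z2 z.
Proof.
move=> zC; have [u1 e1] := specialize_surj z1; have [u2 e2] := specialize_surj z2.
have [|u eu] := @specialize_ker (u1 * u2 - u2 * u1).
  by rewrite rmorphB !rmorphM e1 zC subrr.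
by exists (sp u), u1, u2, u.
Qed.

(* The Jacobi identity in the family over the t-line, divided by t. *)
Lemma bracket_central z1 z2 z : central z1 -> central z2 -> bracket z1 z2 z -> central z.
Proof.
move=> z1C z2C [u1 [u2 [u [e1 e2 ez eu]]]] a; have [b eb] := specialize_surj a.
have div v : central (sp v) -> exists r, v * b - b * v = scT 'X * r.
  by move=> vC; apply: specialize_ker; rewrite rmorphB !rmorphM vC subrr.
have [|r1 er1] := div u1; first by rewrite e1.
have [|r2 er2] := div u2; first by rewrite e2.
have cM x y : x * y * b - b * (x * y) = x * (y * b - b * y) + (x * b - b * x) * y.
  by rewrite mulrBr mulrBl !mulrA addrA subrK.
have E : u * b - b * u = (u1 * r2 + r1 * u2) - (u2 * r1 + r2 * u1).
  apply: specialize_torsion_free; set tc := scT 'X in eu er1 er2 *.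
  have tl x y : x * (tc * y) = tc * (x * y) by rewrite !mulrA (pbw_scC pbT 'X x).
  rewrite mulrBr -(tl b) mulrA -eu mulrBl mulrBr addrACA_sub !cM er1 er2.
  by rewrite mulrBr !mulrDr !tl -!mulrA.
rewrite -eb -ez; apply/eqP; rewrite -subr_eq0 -!rmorphM -rmorphB E.
rewrite rmorphB !rmorphD !rmorphM e1 e2 z1C (z2C (sp r1)).
by rewrite [X in _ - X]addrC subrr.
Qed.

End Specialization.

(** * Lifts along t = 0 as preimages under a ring morphism *)

Section MonomialImages.
Variables (F : fieldType) (gT : finGroupType) (G : {group gT}) (n : nat).
Variable rG : mx_representation F G n.
Variables (alpha : gT -> 'cV[F]_n) (alphav : gT -> 'rV[F]_n) (c : gT -> F).
Variables (k : comNzRingType) (phi : {rmorphism F -> k}) (t : k).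
Local Notation proj := (ch_proj rG alpha alphav c phi t).
Local Notation mon := {fmonom (cherednik_gen F G n)}.

Lemma ch_proj_U (b : k) (m : mon) : proj << b *g m >> = ch_scal rG alpha alphav c phi t b * proj << m >>.
Proof. by rewrite malgU_scale; apply: (rmorphM (ring_proj _)). Qed.

Lemma ch_proj_nil : proj << FMonom [::] : mon >> = 1.
Proof.
have -> : FMonom [::] = mone :> mon by rewrite -fmoneE.
exact: (rmorph1 (ring_proj _)).
Qed.

Lemma ch_proj_cons i (s : seq (cherednik_gen F G n)) :
  proj << FMonom (i :: s) : mon >> = proj << fmu i >> * proj << FMonom s : mon >>.
Proof.
have -> : FMonom (i :: s) = mmul (fmu i) (FMonom s) :> mon.
  by apply/eqP; rewrite fmP fmM fmU.
rewrite -[X in mkmalgU _ X](mulr1 1) -malgUM; exact: (rmorphM (ring_proj _)).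
Qed.

Lemma ch_proj_sum (s : seq mon) (f : mon -> cherednik_free F G n k) :
  proj (\sum_(m <- s) f m) = \sum_(m <- s) proj (f m).
Proof. exact: (raddf_sum (ring_proj _)). Qed.

End MonomialImages.

Section LiftsSpecialization.
Variables (F : fieldType) (gT : finGroupType) (G : {group gT}) (n : nat).
Variable rG : mx_representation F G n.
Variables (alpha : gT -> 'cV[F]_n) (alphav : gT -> 'rV[F]_n) (c : gT -> F).
Local Notation T := (Ht rG alpha alphav c).
Local Notation C := (Hc rG alpha alphav c).

Lemma specialization_exists : exists sp : {rmorphism T -> C},
  [/\ forall a, sp (ch_scal rG alpha alphav c polyC 'X a) = ch_scal rG alpha alphav c idfun 0 a.[0],
      forall y, sp (ch_Y rG alpha alphav c polyC 'X y) = ch_Y rG alpha alphav c idfun 0 y,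
      forall x, sp (ch_X rG alpha alphav c polyC 'X x) = ch_X rG alpha alphav c idfun 0 x
    & forall g, g \in G -> sp (ch_T rG alpha alphav c polyC 'X g) = ch_T rG alpha alphav c idfun 0 g].
Proof. exact: ch_lift_exists (ch_action_specialize (ch_actionP rG alpha alphav c idfun 0)). Qed.

Variable sp : {rmorphism T -> C}.
Hypothesis spS : forall a, sp (ch_scal rG alpha alphav c polyC 'X a) = ch_scal rG alpha alphav c idfun 0 a.[0].
Hypothesis spY : forall y, sp (ch_Y rG alpha alphav c polyC 'X y) = ch_Y rG alpha alphav c idfun 0 y.
Hypothesis spX : forall x, sp (ch_X rG alpha alphav c polyC 'X x) = ch_X rG alpha alphav c idfun 0 x.
Hypothesis spT : forall g, g \in G -> sp (ch_T rG alpha alphav c polyC 'X g) = ch_T rG alpha alphav c idfun 0 g.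
Local Notation mon := {fmonom (cherednik_gen F G n)}.

Lemma specialize_monom (m : mon) :
  sp (ch_proj rG alpha alphav c polyC 'X << m >>) = ch_proj rG alpha alphav c idfun 0 << m >>.
Proof.
case: m => s; elim: s => [|i s IHs]; first by rewrite !ch_proj_nil; apply: rmorph1.
rewrite !ch_proj_cons; apply: etrans (rmorphM sp _ _) _; congr (_ * _); last exact: IHs.
case: i => [[y|x]|g]; [exact: spY | exact: spX |].
by have := spT (subgP g); rewrite /ch_T sgvalK.
Qed.

(** Setting t = 0 in the coefficients of a free representative computes [sp], so the class at t = 0
    does not depend on the representative. *)
Lemma liftsP (u : T) (z : C) : lifts u z <-> sp u = z.
Proof.
have E (a : {malg {poly F}[mon]}) : sp (ch_proj rG alpha alphav c polyC 'X a) =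
    ch_proj rG alpha alphav c idfun 0
      (\sum_(m <- enum_fset (monalg.msupp a)) << (monalg.mcoeff m a).[0] *g m >>).
  rewrite ch_proj_sum [in LHS](monalgE a) ch_proj_sum.
  apply: etrans (raddf_sum sp _ _ _) _; apply: eq_bigr => m _.
  apply: etrans (congr1 sp (ch_proj_U rG alpha alphav c polyC 'X _ m)) _.
  apply: etrans (rmorphM sp _ _) _.
  apply: etrans _ (esym (ch_proj_U rG alpha alphav c idfun 0 _ m)).
  exact: congr2 (spS _) (specialize_monom m).
split=> [[a [-> ->]]|<-]; first exact: E.
by have [a ->] := ring_proj_surj u; exists a; split=> //; rewrite -E.
Qed.

Lemma poisson_bracketP z1 z2 z : poisson_bracket z1 z2 z <->
  bracket (ch_scal rG alpha alphav c polyC 'X) sp z1 z2 z.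
Proof.
split=> [[u1 [u2 [u [/liftsP e1 /liftsP e2 /liftsP e e3]]]]|[u1 [u2 [u [e1 e2 e e3]]]]].
  by exists u1, u2, u.
by exists u1, u2, u; split=> //; apply/liftsP.
Qed.

End LiftsSpecialization.

(** The effect on a commutator of changing both lifts by multiples of t. *)
Lemma commutator_expand (R : pzRingType) (t a1 a2 r1 r2 u1 u2 : R) : (forall x, t * x = x * t) ->
  u1 = a1 + t * r1 -> u2 = a2 + t * r2 ->
  u1 * u2 - u2 * u1 = (a1 * a2 - a2 * a1) + t * ((a1 * r2 + r1 * u2) - (a2 * r1 + r2 * u1)).
Proof.
move=> tC e1 e2; have H a b r s u v : u = a + t * r -> v = b + t * s ->
    u * v = a * b + t * (a * s + r * v).
  move=> eu ev; rewrite eu mulrDl {1}ev mulrDr mulrDr !mulrA -tC -addrA.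
  by congr (_ + (_ + _)); rewrite -!mulrA.
by rewrite (H _ _ _ _ _ _ e1 e2) (H _ _ _ _ _ _ e2 e1) opprD addrACA -mulrBr.
Qed.

(** * Brackets for K and for W *)

Section PoissonTransfer.
Variables (F : fieldType) (gT : finGroupType) (W K : {group gT}) (nKW : (K <| W)%g) (n : nat).
Variable rW : mx_representation F W n.
Variables (alpha : gT -> 'cV[F]_n) (alphav : gT -> 'rV[F]_n) (c : gT -> F).
Local Notation sKW := (normal_sub nKW).
Local Notation rK := (subg_repr rW sKW).
Local Notation cW := (extend_by_zero rK c).
Local Notation k := {poly F}.
Variables (UK : pzRingType) (suK : {rmorphism k -> UK}) (yuK : 'rV[F]_n -> UK).
Variables (xuK : 'cV[F]_n -> UK) (tuK : gT -> UK) (cuK : UK -> dunkl_space gT n k).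
Hypothesis puK : pbw_ring rK alpha alphav c polyC 'X suK yuK xuK tuK cuK.
Variables (UW : pzRingType) (suW : {rmorphism k -> UW}) (yuW : 'rV[F]_n -> UW).
Variables (xuW : 'cV[F]_n -> UW) (tuW : gT -> UW) (cuW : UW -> dunkl_space gT n k).
Hypothesis puW : pbw_ring rW alpha alphav cW polyC 'X suW yuW xuW tuW cuW.
Variables (HK : pzRingType) (scK : {rmorphism F -> HK}) (YK : 'rV[F]_n -> HK).
Variables (XK : 'cV[F]_n -> HK) (TK : gT -> HK) (coK : HK -> dunkl_space gT n F).
Hypothesis pbK : pbw_ring rK alpha alphav c idfun 0 scK YK XK TK coK.
Variables (HW : pzRingType) (scW : {rmorphism F -> HW}) (YW : 'rV[F]_n -> HW).
Variables (XW : 'cV[F]_n -> HW) (TW : gT -> HW) (coW : HW -> dunkl_space gT n F).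
Hypothesis pbW : pbw_ring rW alpha alphav cW idfun 0 scW YW XW TW coW.
Variable iu : {rmorphism UK -> UW}.
Hypothesis iuS : forall a, iu (suK a) = suW a.
Hypothesis iuY : forall y, iu (yuK y) = yuW y.
Hypothesis iuX : forall x, iu (xuK x) = xuW x.
Hypothesis iuT : forall g, g \in K -> iu (tuK g) = tuW g.
Variable iota : {rmorphism HK -> HW}.
Hypothesis iotaS : forall a, iota (scK a) = scW a.
Hypothesis iotaY : forall y, iota (YK y) = YW y.
Hypothesis iotaX : forall x, iota (XK x) = XW x.
Hypothesis iotaT : forall g, g \in K -> iota (TK g) = TW g.
Variable spK : {rmorphism UK -> HK}.
Hypothesis spKS : forall a, spK (suK a) = scK a.[0].
Hypothesis spKY : forall y, spK (yuK y) = YK y.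
Hypothesis spKX : forall x, spK (xuK x) = XK x.
Hypothesis spKT : forall g, g \in K -> spK (tuK g) = TK g.
Variable spW : {rmorphism UW -> HW}.
Hypothesis spWS : forall a, spW (suW a) = scW a.[0].
Hypothesis spWY : forall y, spW (yuW y) = YW y.
Hypothesis spWX : forall x, spW (xuW x) = XW x.
Hypothesis spWT : forall g, g \in W -> spW (tuW g) = TW g.
Let KW g : g \in K -> g \in W := subsetP sKW g.

Lemma specialize_iota u : spW (iu u) = iota (spK u).
Proof.
elim/(pbw_ind puK): u => [a|y|x|g Kg|u v eu ev|u v eu ev].
- by rewrite iuS spWS spKS iotaS.
- by rewrite iuY spWY spKY iotaY.
- by rewrite iuX spWX spKX iotaX.
- by rewrite iuT // spWT ?KW // spKT // iotaT.
- by rewrite !rmorphD eu ev.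
- by rewrite !rmorphM eu ev.
Qed.

(** Lifts over K give lifts over W. Any other lifts differ from them by multiples of t, and the
    corrections specialize to commutators with the central elements [iota z1] and [iota z2]. *)
Lemma bracket_descends z1 z2 z : central z1 -> central (iota z1) -> central (iota z2) ->
  bracket suW spW (iota z1) (iota z2) z -> exists2 z', bracket suK spK z1 z2 z' & iota z' = z.
Proof.
move=> z1C i1C i2C [u1 [u2 [u [e1 e2 ez eu]]]].
have [z' [a1 [a2 [a [f1 f2 fz fu]]]]] := bracket_exists puK pbK spKS spKY spKX spKT z2 z1C.
exists z'; first by exists a1, a2, a.
have div v b : spW v = iota (spK b) -> exists r, v = iu b + suW 'X * r.
  move=> e; have [|r er] := specialize_ker puW pbW spWS spWY spWX spWT (u := v - iu b).
    by rewrite rmorphB e specialize_iota subrr.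
  by exists r; rewrite -er addrC subrK.
have [|r1 er1] := div u1 a1; first by rewrite f1.
have [|r2 er2] := div u2 a2; first by rewrite f2.
have E : u = iu a + ((iu a1 * r2 + r1 * u2) - (iu a2 * r1 + r2 * u1)).
  apply: (specialize_torsion_free puW); rewrite -eu.
  rewrite (commutator_expand (pbw_scC puW 'X) er1 er2) [in RHS]mulrDr; congr (_ + _).
  by rewrite -iuS -!rmorphM -rmorphB fu.
rewrite -fz -specialize_iota -ez E rmorphD [X in _ = _ + X](_ : _ = 0) ?addr0 //.
rewrite rmorphB !rmorphD !rmorphM !specialize_iota f1 f2 e1 e2 i1C (i2C (spW r1)).
by rewrite [X in _ - X]addrC subrr.
Qed.

Lemma bracket_conj w z1 z2 z : w \in W -> bracket suK spK z1 z2 z -> exists z1' z2' z',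
  [/\ bracket suK spK z1' z2' z', iota z1' = TW w * iota z1 * TW w^-1%g,
      iota z2' = TW w * iota z2 * TW w^-1%g & iota z' = TW w * iota z * TW w^-1%g].
Proof.
move=> Ww [u1 [u2 [u [<- <- <- eu]]]].
have cj v : exists v', iu v' = tuW w * iu v * tuW w^-1%g.
  exact: (iota_conj puK puW iuS iuY iuX iuT v Ww).
have [v1 e1] := cj u1; have [v2 e2] := cj u2; have [v e] := cj u.
have sE x x' : iu x' = tuW w * iu x * tuW w^-1%g ->
    iota (spK x') = TW w * iota (spK x) * TW w^-1%g.
  by move=> ex; rewrite -!specialize_iota ex !rmorphM !spWT ?groupV.
exists (spK v1), (spK v2), (spK v); split; try exact: sE.
exists v1, v2, v; split=> //; apply: (iota_inj puK puW iuS iuY iuX iuT).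
have cM x y : (tuW w * x * tuW w^-1%g) * (tuW w * y * tuW w^-1%g) = tuW w * (x * y) * tuW w^-1%g.
  by rewrite !mulrA; congr (_ * _ * _); rewrite -(mulrA (_ * _)) (TW_conj_inv puW Ww) mulr1.
rewrite rmorphB !rmorphM e1 e2 e !cM -mulrBl -mulrBr -!rmorphM -rmorphB eu rmorphM iuS.
by rewrite !mulrA (pbw_scC puW 'X (tuW w)).
Qed.

Lemma conj_central w z z' : w \in W -> iota z' = TW w * iota z * TW w^-1%g -> central z -> central z'.
Proof.
move=> Ww e zC a; apply: (iota_inj pbK pbW iotaS iotaY iotaX iotaT).
have Wv : w^-1%g \in W by rewrite groupV.
have [b eb] := iota_conj pbK pbW iotaS iotaY iotaX iotaT a Wv; rewrite invgK in eb.
have ea : iota a = TW w * iota b * TW w^-1%g.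
  by rewrite eb !mulrA (TW_conjV pbW Ww) mul1r -mulrA (TW_conjV pbW Ww) mulr1.
have cM x y : (TW w * x * TW w^-1%g) * (TW w * y * TW w^-1%g) = TW w * (x * y) * TW w^-1%g.
  by rewrite !mulrA; congr (_ * _ * _); rewrite -(mulrA (_ * _)) (TW_conj_inv pbW Ww) mulr1.
by rewrite !rmorphM e ea !cM -!rmorphM zC.
Qed.

End PoissonTransfer.

(** * Rigidity and Poisson ideals under restriction *)

Section StarTransfer.
Variables (F : decFieldType) (gT : finGroupType) (W K : {group gT}) (nKW : (K <| W)%g) (n : nat).
Variable rW : mx_representation F W n.
Variables (alpha : gT -> 'cV[F]_n) (alphav : gT -> 'rV[F]_n) (c : gT -> F).
Local Notation sKW := (normal_sub nKW).
Local Notation rK := (subg_repr rW sKW).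
Local Notation cW := (extend_by_zero rK c).
Hypothesis two_neq0 : 2 != 0 :> F.
Hypothesis rootW : forall s, s \in reflections rW -> root_coroot rW s (alpha s) (alphav s).
Hypothesis cJ : forall s w, s \in reflections rK -> w \in W -> c (s ^ w)%g = c s.

Let coef (y : 'rV[F]_n) (x : 'cV[F]_n) s := c s * pairing y (alpha s) * pairing (alphav s) x.
Let br d (rho : mx_representation F W d) y x : 'M[F]_d :=
  \sum_(s in reflections rK) coef y x s *: rho s^-1%g.

(** Only the matrix [alpha s *m alphav s] enters. It is equivariant under conjugation, although
    roots and coroots are so only up to scalars. *)
Let coefJ y x s w : s \in reflections rK -> w \in W ->
  coef y x (s ^ w)%g = coef (y *m rW w^-1%g) (rW w *m x) s.
Proof.
move=> Rs Ww; have RW := subsetP (reflections_normal_sub nKW rW) _ Rs.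
have Ws := refl_mem RW; rewrite /coef cJ // -!mulrA !pairing_mulmx; congr (_ * _).
rewrite (root_matrixJ two_neq0 Ws Ww (rootW RW) (rootW (reflectionsJ RW Ww))).
by rewrite !mulmxA.
Qed.

Let br_comm d (rho : mx_representation F W d) w y x : w \in W ->
  rho w *m br rho y x = br rho (y *m rW w^-1%g) (rW w *m x) *m rho w.
Proof.
move=> Ww; rewrite /br mulmx_sumr mulmx_suml (reindex_inj (conjg_inj w)) /=.
apply: eq_big => [s|s]; first exact: reflections_normalJ.
rewrite reflections_normalJ // => Rs; rewrite coefJ // -scalemxAr -scalemxAl.
have Ws : s \in W by apply: (subsetP sKW); apply: refl_mem Rs.
congr (_ *: _); rewrite -conjVg conjgE -!repr_mxM ?groupM ?groupV //.
by rewrite !mulgA mulgV mul1g.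
Qed.

(** From rho to tau, V is injective. From tau to rho, the sums vanish on the image of V; W permutes
    them by changing y and x, so they vanish on the W-span of V, which is all of rho by
    irreducibility. *)
Lemma star_intertwines d e (rho : mx_representation F W d) (tau : mx_representation F K e) V :
  mx_irreducible rho -> mx_irreducible tau -> row_free V ->
  intertwines tau (subg_repr rho sKW) V ->
  star rW alpha alphav cW rho <-> star rK alpha alphav c tau.
Proof.
move=> irr_rho irr_tau fV iV.
have starW y x : \sum_(s in reflections rW)
    (cW s * pairing y (alpha s) * pairing (alphav s) x) *: rho s^-1%g = br rho y x.
  rewrite (big_setID (reflections rK)) /= (setIidPr (reflections_normal_sub nKW rW)) [X in _ + X]big1.
    by rewrite addr0; apply: eq_bigr => s Rs; rewrite /extend_by_zero Rs.
  move=> s; rewrite inE => /andP[/negPf nRs _].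
  by rewrite /extend_by_zero nRs !mul0r scale0r.
have brV y x : (\sum_(s in reflections rK) coef y x s *: tau s^-1%g) *m V = V *m br rho y x.
  rewrite /br mulmx_suml mulmx_sumr; apply: eq_bigr => s Rs.
  by rewrite -scalemxAl -scalemxAr iV // groupV; apply: refl_mem Rs.
split=> st y x; first by apply: (row_free_inj fV); rewrite brV -starW st mulmx0 mul0mx.
rewrite starW; have V0 y' x' : V *m br rho y' x' = 0 by rewrite -brV [X in X *m _](st y' x') mul0mx.
pose U := (\sum_(w in W) <<V *m rho w>>)%MS.
have modU : mxmodule rho U.
  apply/mxmoduleP => w Ww; rewrite sumsmxMr; apply/sumsmx_subP => v Wv.
  apply: (sumsmx_sup (v * w)%g); rewrite ?groupM //.
  by rewrite (eqmxMr _ (genmxE _)) genmxE repr_mxM // mulmxA.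
have U0 : U *m br rho y x = 0.
  apply/eqP; rewrite -submx0 sumsmxMr; apply/sumsmx_subP => w Ww.
  by rewrite (eqmxMr _ (genmxE _)) -mulmxA br_comm // mulmxA V0 mul0mx sub0mx.
have nzU : U != 0.
  have sVU : (V <= U)%MS by apply: (sumsmx_sup 1%g); rewrite // genmxE repr_mx1 mulmx1.
  apply: contraTneq sVU => ->; rewrite submx0; apply: contraL fV => /eqP->.
  rewrite /row_free mxrank0 eq_sym; apply: contra_notN (mx_irr1_neq0 irr_tau) => /eqP d0.
  by apply/matrixP => a; case: a => m; rewrite d0.
have [_ irr_i] := (mx_irrP rho).1 irr_rho.
by apply: (row_full_inj (irr_i U modU nzU)); rewrite U0 mulmx0.
Qed.

Lemma star_restrict j (i : Irr F W) : in_restriction sKW j i ->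
  star rW alpha alphav cW (irr_repr i) <-> star rK alpha alphav c (irr_repr j).
Proof.
case/in_restrictionP => V [fV iV].
exact: star_intertwines (socle_irr i) (socle_irr j) fV iV.
Qed.

Lemma intertwines_conj d e e' (rho : mx_representation F W d) (tau : mx_representation F K e)
    (tau' : mx_representation F K e') V (B : 'M_(e, e')) w : w \in W ->
  row_free B -> row_full B -> (forall k, k \in K -> tau (k ^ w)%g *m B = B *m tau' k) ->
  row_free V -> intertwines tau (subg_repr rho sKW) V ->
  exists V', row_free V' /\ intertwines tau' (subg_repr rho sKW) V'.
Proof.
move=> Ww fB uB hB fV iV.
have [C [BC CB]] : exists C, B *m C = 1%:M /\ C *m B = 1%:M.
  by exists (pinvmx B); rewrite (mulmxVp fB) (mulVpmx uB).
exists (C *m V *m rho w^-1%g); split.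
  rewrite /row_free mxrankMfree ?row_free_unit ?repr_mx_unit ?groupV //.
  by rewrite mxrankMfree // -(mxrankMfree _ fB) CB mxrank1.
move=> k Kk; have Kw : (k ^ w)%g \in K by rewrite memJ_norm // (subsetP (normal_norm nKW)).
have e1 : tau' k *m C = C *m tau (k ^ w)%g.
  have := congr1 (fun M => C *m M *m C) (hB k Kk).
  by rewrite /= -!mulmxA BC mulmx1 (mulmxA C B) CB mul1mx.
have -> : tau' k *m (C *m V *m rho w^-1%g) = C *m (tau (k ^ w)%g *m V) *m rho w^-1%g.
  by rewrite !mulmxA e1.
have Wk := subsetP sKW k Kk.
rewrite iV //= -!mulmxA; congr (_ *m (_ *m _)).
by rewrite -!repr_mxM ?groupJ ?groupV // conjgE !mulgA mulgK.
Qed.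

Lemma in_restriction_conj w j j' (i : Irr F W) : w \in W -> in_restriction sKW j i ->
  conj_irr w j j' -> in_restriction sKW j' i.
Proof.
move=> Ww /in_restrictionP[V [fV iV]] [B [fB uB hB]]; apply/in_restrictionP.
exact: intertwines_conj Ww fB uB hB fV iV.
Qed.

End StarTransfer.

Lemma conj_cancel (R : pzRingType) (a b x : R) : a * b = 1 -> x = a * (b * x * a) * b.
Proof. by move=> ab; rewrite !mulrA ab mul1r -mulrA ab mulr1. Qed.

(** * Blocks, rigidity and Poisson ideals for the concrete algebras *)

Section NormalReflectionSubgroup.
Variables (F : decFieldType) (gT : finGroupType) (W K : {group gT}) (nKW : (K <| W)%g) (n : nat).
Variable rW : mx_representation F W n.
Variables (alpha : gT -> 'cV[F]_n) (alphav : gT -> 'rV[F]_n) (c : gT -> F).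
Local Notation sKW := (normal_sub nKW).
Local Notation rK := (subg_repr rW sKW).
Local Notation cW := (extend_by_zero rK c).
Hypothesis two_neq0 : 2 != 0 :> F.
Hypothesis ch0 : [pchar F] =i pred0.
Hypothesis faithW : mx_faithful rW.
Hypothesis rootW : forall s, s \in reflections rW -> root_coroot rW s (alpha s) (alphav s).
Hypothesis cJ : forall s w, s \in reflections rK -> w \in W -> c (s ^ w)%g = c s.
Local Notation LK := (L rK alpha alphav c).
Local Notation LW := (L rW alpha alphav cW).
Local Notation annK j := (annihilator rK alpha alphav c (irr_repr j)).
Local Notation annW i := (annihilator rW alpha alphav cW (irr_repr i)).

Let rootK_ := rootK (nKW := nKW) rootW.
Let cJK s g : s \in reflections rK -> g \in K -> c (s ^ g)%g = c s.
Proof. by move=> Rs Kg; apply: cJ => //; apply: subsetP sKW g Kg. Qed.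
Let cJW := extend_by_zeroJ cJ.
Let coK := cherednik_pbw idfun 0 two_neq0 rootK_ cJK.
Let coW := cherednik_pbw idfun 0 two_neq0 rootW cJW.
Let cuK := cherednik_pbw polyC 'X two_neq0 rootK_ cJK.
Let cuW := cherednik_pbw polyC 'X two_neq0 rootW cJW.
Let pbK := svalP coK.
Let pbW := svalP coW.
Let puK := svalP cuK.
Let puW := svalP cuW.

Lemma blocks_up w j1 j j2 i1 i2 : w \in W -> in_restriction sKW j1 i1 -> in_restriction sKW j2 i2 ->
  same_block (LK j1) (LK j) -> conj_irr w j j2 -> same_block (LW i1) (LW i2).
Proof.
have [iota [i1' i2' i3 i4]] := ch_inclusion_exists nKW rW alpha alphav c idfun 0.
exact: (block_up two_neq0 ch0 faithW rootW pbK pbW i1' i2' i3 i4).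
Qed.

Lemma blocks_down j1 i1 j2 i2 : in_restriction sKW j1 i1 -> in_restriction sKW j2 i2 ->
  same_block (LW i1) (LW i2) ->
  exists w j, [/\ w \in W, same_block (LK j1) (LK j) & conj_irr w j j2].
Proof.
have [iota [i1' i2' i3 i4]] := ch_inclusion_exists nKW rW alpha alphav c idfun 0.
exact: (block_down two_neq0 ch0 rootW pbK pbW i1' i2' i3 i4).
Qed.

Lemma blocks_conj w j1 j2 j1' j2' : w \in W -> same_block (LK j1) (LK j2) ->
  conj_irr w j1 j1' -> conj_irr w j2 j2' -> same_block (LK j1') (LK j2').
Proof.
have [iota [i1' i2' i3 i4]] := ch_inclusion_exists nKW rW alpha alphav c idfun 0.
exact: (block_conj two_neq0 ch0 rootW pbK pbW i1' i2' i3 i4).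
Qed.

Lemma blocksK_equiv : equivalence_rel (fun i j => `[< same_block (LK i) (LK j) >]).
Proof.
have P i j : reflect (forall h, central_idempotent (ring_proj (@D_plus F gT K n rK alpha alphav c) h) ->
    actmx (irr_repr i) (ct (sval coK) h) = 1%:M <-> actmx (irr_repr j) (ct (sval coK) h) = 1%:M)
    `[< same_block (LK i) (LK j) >].
  apply: (iffP (asboolP _)) => [/(blockP two_neq0 (pchar0_group ch0 K) rootK_ pbK)//|e].
  exact/(blockP two_neq0 (pchar0_group ch0 K) rootK_ pbK).
apply/equivalence_relP; split=> [i|i j /P ij k]; first exact/P.
apply/P/P => e h hI; first by apply: iff_trans (iff_sym (ij h hI)) (e h hI).
by apply: iff_trans (ij h hI) (e h hI).
Qed.

Lemma blocksW_equiv : equivalence_rel (fun i j => `[< same_block (LW i) (LW j) >]).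
Proof.
have P i j : reflect (forall h, central_idempotent (ring_proj (@D_plus F gT W n rW alpha alphav cW) h) ->
    actmx (irr_repr i) (ct (sval coW) h) = 1%:M <-> actmx (irr_repr j) (ct (sval coW) h) = 1%:M)
    `[< same_block (LW i) (LW j) >].
  apply: (iffP (asboolP _)) => [/(blockP two_neq0 (pchar0_group ch0 W) rootW pbW)//|e].
  exact/(blockP two_neq0 (pchar0_group ch0 W) rootW pbW).
apply/equivalence_relP; split=> [i|i j /P ij k]; first exact/P.
apply/P/P => e h hI; first by apply: iff_trans (iff_sym (ij h hI)) (e h hI).
by apply: iff_trans (ij h hI) (e h hI).
Qed.

Lemma rigid_restrict j (i : Irr F W) : in_restriction sKW j i ->
  rigid rW alpha alphav cW (irr_repr i) <-> rigid rK alpha alphav c (irr_repr j).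
Proof.
move=> ji; apply: iff_trans (rigidP two_neq0 rootW pbW (socle_irr i)) _.
apply: iff_trans (star_restrict two_neq0 rootW cJ ji) _.
exact: iff_sym (rigidP two_neq0 rootK_ pbK (socle_irr j)).
Qed.

Lemma central_act_unit (i : Irr F W) (z : Hc rW alpha alphav cW) : central z ->
  actmx (irr_repr i) (ct (sval coW) z) != 0 -> actmx (irr_repr i) (ct (sval coW) z) \in unitmx.
Proof.
move=> zC; apply: (mx_Schur (socle_irr i)); apply/centgmxP => g Wg.
have Wv : g^-1%g \in W by rewrite groupV.
have := etrans (esym (ctmx_Tr pbW (irr_repr i) z Wv))
  (etrans (congr1 (ctmx (sval coW) (irr_repr i)) (zC _)) (ctmx_T pbW (irr_repr i) z Wv)).
by rewrite invgK => ->.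
Qed.

(** Central elements for W and their bracket come from K, where the bracket acts by zero on j. The
    bracket is central for W, so by Schur it acts on i by zero or invertibly, and it kills the
    constituent j. *)
Lemma poisson_up j (i : Irr F W) : in_restriction sKW j i ->
  poisson_ideal (annK j) -> poisson_ideal (annW i).
Proof.
have [iota [iS iY iX iT]] := ch_inclusion_exists nKW rW alpha alphav c idfun 0.
have [iu [uS uY uX uT]] := ch_inclusion_exists nKW rW alpha alphav c polyC 'X.
have [spK [kS kY kX kT]] := specialization_exists rK alpha alphav c.
have [spW [wS wY wX wT]] := specialization_exists rW alpha alphav cW.
have s0 m : 0%:M = 0 :> 'M[F]_m by apply/matrixP => a b; rewrite !mxE mul0rn.
move=> ji PK z1 z2 z z1C /(annihilatorP two_neq0 rootW pbW (socle_irr i))[z2C a2].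
move=> /(poisson_bracketP wS wY wX wT) br; have zC := bracket_central puW pbW wS wY wX wT z1C z2C br.
have [y1 y1C e1] := central_descends two_neq0 ch0 faithW rootW pbK pbW iS iY iX iT z1C.
have [y2 y2C e2] := central_descends two_neq0 ch0 faithW rootW pbK pbW iS iY iX iT z2C.
rewrite -e1 -e2 in br z1C z2C a2.
have [y bry ey] := bracket_descends puK puW pbK pbW uS uY uX uT iS iY iX iT
  kS kY kX kT wS wY wX wT y1C z1C z2C br.
have b2 : annK j y2.
  apply/(annihilatorP two_neq0 rootK_ pbK (socle_irr j)); split=> //; rewrite -s0.
  by apply: (act_restrict pbK pbW iS iY iX iT ji); rewrite a2 s0.
have /(annihilatorP two_neq0 rootK_ pbK (socle_irr j))[_ b] :=
  PK y1 y2 y y1C b2 ((poisson_bracketP kS kY kX kT _ _ _).2 bry).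
apply: (annihilatorP two_neq0 rootW pbW (socle_irr i) z).2; split; first exact: zC.
have [e0|nz] := eqVneq (actmx (irr_repr i) (ct (sval coW) z)) 0; first exact: e0.
have u := central_act_unit zC nz.
case/in_restrictionP: ji => V [fV iV].
have := intertwines_act (ct (sval coK) y) iV.
rewrite b mul0mx -(act_iota pbK pbW iS iY iX iT) ey => /esym V0.
have {}V0 : V = 0 by rewrite -(mulmxK u V) V0 mul0mx.
by case: (mx_irr1_neq0 (socle_irr j)); apply: (row_free_inj fV); rewrite V0 !mulmx0.
Qed.

Lemma poisson_conj w (j j' : Irr F K) : w \in W -> conj_irr w j j' ->
  poisson_ideal (annK j) -> poisson_ideal (annK j').
Proof.
have [iota [iS iY iX iT]] := ch_inclusion_exists nKW rW alpha alphav c idfun 0.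
have [iu [uS uY uX uT]] := ch_inclusion_exists nKW rW alpha alphav c polyC 'X.
have [spK [kS kY kX kT]] := specialization_exists rK alpha alphav c.
have [spW [wS wY wX wT]] := specialization_exists rW alpha alphav cW.
have s0 m : 0%:M = 0 :> 'M[F]_m by apply/matrixP => a b; rewrite !mxE mul0rn.
move=> Ww jj' PK z1 z2 z z1C z2A; have Wv : w^-1%g \in W by rewrite groupV.
move=> /(poisson_bracketP kS kY kX kT) br.
have [y1 [y2 [y [bry e1 e2 e]]]] := bracket_conj puK puW uS uY uX uT iS iY iX iT
  kS kY kX kT wS wY wX wT Wv br.
have back u v : iota u = ch_T rW alpha alphav cW idfun 0 w^-1%g * iota v * ch_T rW alpha alphav cW idfun 0 w^-1^-1%g ->
    iota v = ch_T rW alpha alphav cW idfun 0 w * iota u * ch_T rW alpha alphav cW idfun 0 w^-1%g.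
  move=> ->; rewrite invgK; exact: conj_cancel (TW_conjV pbW Ww).
have y1C := conj_central pbK pbW iS iY iX iT Wv e1 z1C.
have /(annihilatorP two_neq0 rootK_ pbK (socle_irr j'))[z2C a2] := z2A.
have act_eq u v : iota u = ch_T rW alpha alphav cW idfun 0 w^-1%g * iota v * ch_T rW alpha alphav cW idfun 0 w^-1^-1%g ->
    actmx (irr_repr j) (ct (sval coK) u) = 0 <-> actmx (irr_repr j') (ct (sval coK) v) = 0.
  move=> /back euv; have := conj_irr_actmx nKW 0 Ww jj'
    (fun x _ => ct_conj pbK pbW iS iY iX iT x Ww euv).
  by rewrite !s0.
have b2 : annK j y2.
  apply/(annihilatorP two_neq0 rootK_ pbK (socle_irr j)); split.
    exact: (conj_central pbK pbW iS iY iX iT Wv e2 z2C).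
  exact: (act_eq _ _ e2).2.
have /(annihilatorP two_neq0 rootK_ pbK (socle_irr j))[yC b] :=
  PK y1 y2 y y1C b2 ((poisson_bracketP kS kY kX kT _ _ _).2 bry).
apply/(annihilatorP two_neq0 rootK_ pbK (socle_irr j')); split; last exact: (act_eq _ _ e).1.
exact: (conj_central pbK pbW iS iY iX iT Ww (back _ _ e) yC).
Qed.

End NormalReflectionSubgroup.

(** * The correspondence of families *)

Section FamilyCorrespondence.
Variables (F : decFieldType) (gT : finGroupType) (W K : {group gT}) (nKW : (K <| W)%g).
Hypothesis ch0 : [pchar F] =i pred0.
Local Notation sKW := (normal_sub nKW).
Variables (RK : rel (Irr F K)) (RW : rel (Irr F W)).
Hypotheses (RK_equiv : equivalence_rel RK) (RW_equiv : equivalence_rel RW).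
Hypothesis R_up : forall w j1 j j2 i1 i2, w \in W -> in_restriction sKW j1 i1 ->
  in_restriction sKW j2 i2 -> RK j1 j -> conj_irr w j j2 -> RW i1 i2.
Hypothesis R_down : forall j1 i1 j2 i2, in_restriction sKW j1 i1 -> in_restriction sKW j2 i2 ->
  RW i1 i2 -> exists w j, [/\ w \in W, RK j1 j & conj_irr w j j2].
Hypothesis R_conj : forall w j1 j2 j1' j2', w \in W -> RK j1 j2 ->
  conj_irr w j1 j1' -> conj_irr w j2 j2' -> RK j1' j2'.

Definition class_set (T : finType) (R : rel T) (i : T) : {set T} := [set k in [set: T] | R i k].

Lemma class_setE (T : finType) (R : rel T) i k : (k \in class_set R i) = R i k.
Proof. by rewrite !inE. Qed.

Lemma class_set_eq (T : finType) (R : rel T) i k : equivalence_rel R -> R i k ->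
  class_set R i = class_set R k.
Proof. by move=> /equivalence_relP[_ Rt] ik; apply/setP => l; rewrite !class_setE (Rt _ _ ik). Qed.

Lemma mem_class_set (T : finType) (R : rel T) i : equivalence_rel R -> i \in class_set R i.
Proof. by move=> /equivalence_relP[Rr _]; rewrite class_setE Rr. Qed.

Lemma equivalence_partition_classP (T : finType) (R : rel T) X :
  reflect (exists i, X = class_set R i) (X \in equivalence_partition R [set: T]).
Proof.
apply: (iffP imsetP) => [[i _ ->]|[i ->]]; by exists i.
Qed.

Lemma class_of_mem (T : finType) (R : rel T) X i : equivalence_rel R ->
  X \in equivalence_partition R [set: T] -> i \in X -> X = class_set R i.
Proof.
by move=> eR /equivalence_partition_classP[k ->]; rewrite class_setE; apply: class_set_eq.
Qed.

Local Notation OmK := (equivalence_partition RK [set: Irr F K]).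
Local Notation OmW := (equivalence_partition RW [set: Irr F W]).
Local Notation b := (beta sKW OmK).

Lemma conj_familyP w (X : {set Irr F K}) j :
  reflect (exists2 i, i \in X & conj_irr w i j) (j \in conj_family w X).
Proof. by rewrite inE; apply: asboolP. Qed.

Lemma conj_familyM v w (X : {set Irr F K}) : v \in W -> w \in W ->
  conj_family v (conj_family w X) = conj_family (v * w)%g X.
Proof.
move=> Wv Ww; apply/setP => l; apply/conj_familyP/conj_familyP; last first.
  case=> i Xi il; have [j ij] := conj_irr_exists nKW ch0 i Ww.
  have [l' jl'] := conj_irr_exists nKW ch0 j Wv.
  exists j; first by apply/conj_familyP; exists i.
  have il' := conj_irrM nKW Wv ij jl'.
  by rewrite (conj_irr_unique nKW ch0 (groupM Wv Ww) il il').
case=> j /conj_familyP[i Xi ij] jl.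
by exists i => //; apply: (conj_irrM nKW Wv ij jl).
Qed.

Lemma conj_family_class w j j' : w \in W -> conj_irr w j j' ->
  conj_family w (class_set RK j) = class_set RK j'.
Proof.
move=> Ww jj'; apply/setP => k; rewrite class_setE; apply/conj_familyP/idP => [[i ji ik]|j'k].
  by apply: R_conj Ww _ jj' ik; rewrite -(class_setE RK).
have Wv : w^-1%g \in W by rewrite groupV.
have [i ki] := conj_irr_exists nKW ch0 k Wv; exists i.
  by rewrite class_setE; apply: R_conj Wv j'k (conj_irrV nKW ch0 Ww jj') ki.
by have := conj_irrV nKW ch0 Wv ki; rewrite invgK.
Qed.

Definition class_orbit j : {set {set Irr F K}} := [set conj_family w (class_set RK j) | w in W].

Lemma class_orbit_eq w j0 j' j : w \in W -> RK j0 j' -> conj_irr w j' j ->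
  class_orbit j0 = class_orbit j.
Proof.
move=> Ww j0j' j'j; rewrite /class_orbit -(conj_family_class Ww j'j) (class_set_eq RK_equiv j0j').
apply/setP => X; apply/imsetP/imsetP => [[v Wv ->]|[v Wv ->]].
  by exists (v * w^-1)%g; rewrite ?groupM ?groupV // conj_familyM ?groupM ?groupV // mulgKV.
by exists (v * w)%g; rewrite ?groupM // conj_familyM.
Qed.

Lemma cover_class_orbitP j k : reflect (exists w j', [/\ w \in W, RK j j' & conj_irr w j' k])
  (k \in cover (class_orbit j)).
Proof.
apply: (iffP bigcupP) => [[X XO kX]|[w [j' [Ww jj' j'k]]]].
  case/imsetP: XO kX => w Ww -> /conj_familyP[j'].
  by rewrite class_setE => jj' j'k; exists w, j'.
exists (conj_family w (class_set RK j)); first exact: imset_f.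
by apply/conj_familyP; exists j'; rewrite ?class_setE.
Qed.

Lemma class_orbit_mem j0 j : j \in cover (class_orbit j0) -> class_orbit j0 = class_orbit j.
Proof. by case/cover_class_orbitP => w [j' [Ww r cj]]; apply: class_orbit_eq Ww r cj. Qed.

Lemma mem_cover_class_orbit j : j \in cover (class_orbit j).
Proof.
apply/cover_class_orbitP; exists 1%g, j; rewrite group1; split=> //; last exact: conj_irr1.
by have /equivalence_relP[Rr _] := RK_equiv; rewrite Rr.
Qed.

(** [R_down] keeps the constituents inside one orbit. Conversely every member of the orbit occurs in
    some restriction by [induction_exists], and [R_up] puts that irreducible of W into the class of
    i. *)
Lemma restriction_constituents_class i j : in_restriction sKW j i ->
  restriction_constituents sKW (class_set RW i) = cover (class_orbit j).
Proof.
move=> ji; apply/setP => k; rewrite inE; apply/asboolP/cover_class_orbitP.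
  by case=> i'; rewrite class_setE => ii' ki'; apply: R_down ji ki' ii'.
case=> w [j' [Ww jj' j'k]]; have [i' ki'] := induction_exists nKW ch0 k.
by exists i'; rewrite // class_setE; apply: R_up Ww ji ki' jj' j'k.
Qed.

Lemma family_orbitP O : reflect (exists j, O = class_orbit j) (O \in family_orbits W OmK).
Proof.
apply: (iffP imsetP) => [[X /equivalence_partition_classP[j ->] ->]|[j ->]]; first by exists j.
by exists (class_set RK j) => //; apply/equivalence_partition_classP; exists j.
Qed.

(** The orbit of j has the required cover, so the default of [beta] does not occur; the choice is
    forced because orbits whose covers share a member coincide. *)
Lemma beta_class i j : in_restriction sKW j i -> b (class_set RW i) = class_orbit j.
Proof.
move=> ji; rewrite /beta (restriction_constituents_class ji); case: pickP => [O|none] /=.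
  case/andP => /family_orbitP[j0 ->] /eqP e; apply: class_orbit_mem.
  by rewrite e mem_cover_class_orbit.
by have /negbT/negP[] := none (class_orbit j); rewrite eqxx andbT; apply/family_orbitP; exists j.
Qed.

Lemma cover_beta X : X \in OmW -> cover (b X) = restriction_constituents sKW X.
Proof.
case/equivalence_partition_classP => i ->; have [j ji] := restriction_exists nKW ch0 i.
by rewrite (beta_class ji) (restriction_constituents_class ji).
Qed.

Lemma beta_inj : {in OmW &, injective b}.
Proof.
move=> _ _ /equivalence_partition_classP[i1 ->] /equivalence_partition_classP[i2 ->].
have [j1 ji1] := restriction_exists nKW ch0 i1; have [j2 ji2] := restriction_exists nKW ch0 i2.
rewrite (beta_class ji1) (beta_class ji2) => e; apply: class_set_eq => //.
have := mem_cover_class_orbit j2; rewrite -e => /cover_class_orbitP[w [j' [Ww r cj]]].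
exact: R_up Ww ji1 ji2 r cj.
Qed.

Lemma beta_bijection : bijection_onto b OmW (family_orbits W OmK).
Proof.
split; first exact: beta_inj.
apply/setP => O; apply/imsetP/family_orbitP => [[X /equivalence_partition_classP[i ->] ->]|[j ->]].
  by have [j ji] := restriction_exists nKW ch0 i; exists j; apply: beta_class.
have [i ji] := induction_exists nKW ch0 j; exists (class_set RW i); last by rewrite (beta_class ji).
by apply/equivalence_partition_classP; exists i.
Qed.

Lemma stable_partition : stable_families W OmK.
Proof.
move=> w X Ww /equivalence_partition_classP[j ->].
have [j' jj'] := conj_irr_exists nKW ch0 j Ww; rewrite (conj_family_class Ww jj').
by apply/equivalence_partition_classP; exists j'.
Qed.

Section Property.
Variables (QK : Irr F K -> Prop) (QW : Irr F W -> Prop).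
Hypothesis QK_conj : forall w j j', w \in W -> conj_irr w j j' -> QK j -> QK j'.
Hypothesis Q_up : forall j i, in_restriction sKW j i -> QK j -> QW i.
Local Notation QOmK := [set X in OmK | `[< exists2 i, i \in X & QK i >]].
Local Notation QOmW := [set X in OmW | `[< exists2 i, i \in X & QW i >]].

Lemma QOmKP X : reflect (exists2 j, X = class_set RK j & QK j) (X \in QOmK).
Proof.
rewrite inE; apply: (iffP andP) => [[OX /asboolP[j Xj Qj]]|[j -> Qj]].
  by exists j; rewrite // (class_of_mem RK_equiv OX Xj).
split; first by apply/equivalence_partition_classP; exists j.
by apply/asboolP; exists j; rewrite // mem_class_set.
Qed.

Lemma QOmWP X : reflect (exists2 i, X = class_set RW i & QW i) (X \in QOmW).
Proof.
rewrite inE; apply: (iffP andP) => [[OX /asboolP[j Xj Qj]]|[j -> Qj]].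
  by exists j; rewrite // (class_of_mem RW_equiv OX Xj).
split; first by apply/equivalence_partition_classP; exists j.
by apply/asboolP; exists j; rewrite // mem_class_set.
Qed.

Lemma stable_property : stable_families W QOmK.
Proof.
move=> w X Ww /QOmKP[j -> Qj]; have [j' jj'] := conj_irr_exists nKW ch0 j Ww.
by rewrite (conj_family_class Ww jj'); apply/QOmKP; exists j' => //; apply: QK_conj jj' Qj.
Qed.

Lemma property_orbitP O : reflect (exists2 j, O = class_orbit j & QK j) (O \in family_orbits W QOmK).
Proof.
apply: (iffP imsetP) => [[X /QOmKP[j -> Qj] ->]|[j -> Qj]]; first by exists j.
by exists (class_set RK j) => //; apply/QOmKP; exists j.
Qed.

Lemma property_beta O : O \in family_orbits W QOmK -> exists2 X, X \in QOmW & b X = O.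
Proof.
case/property_orbitP => j -> Qj; have [i ji] := induction_exists nKW ch0 j.
by exists (class_set RW i); [apply/QOmWP; exists i => //; apply: Q_up ji Qj | apply: beta_class].
Qed.

(** With the property passing from K to W, each orbit has a preimage under [beta]. Choosing one
    gives a section of [beta], which is injective; [set0] is a default outside these orbits. *)
Lemma property_embedding : exists2 b' : {set {set Irr F K}} -> {set Irr F W},
   forall O, O \in family_orbits W QOmK -> b' O \in QOmW /\ b (b' O) = O
 & {in family_orbits W QOmK &, injective b'}.
Proof.
pose b' O := odflt set0 [pick X in QOmW | b X == O].
have b'P O : O \in family_orbits W QOmK -> b' O \in QOmW /\ b (b' O) = O.
  move=> /property_beta[X QX eX]; rewrite /b'; case: pickP => [Y /andP[QY /eqP eY]|/(_ X)] //.
  by rewrite QX eX eqxx.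
by exists b' => // O O' /b'P[_ e] /b'P[_ e'] eO; rewrite -e -e' eO.
Qed.

Lemma property_bijection : (forall j i, in_restriction sKW j i -> QW i -> QK j) ->
  bijection_onto b QOmW (family_orbits W QOmK).
Proof.
move=> Q_down; split=> [X Y|]; first by rewrite !inE => /andP[X1 _] /andP[Y1 _]; apply: beta_inj.
apply/setP => O; apply/imsetP/idP => [[X /QOmWP[i -> Qi] ->]|/property_beta[X QX <-]]; last by exists X.
have [j ji] := restriction_exists nKW ch0 i; rewrite (beta_class ji).
by apply/property_orbitP; exists j => //; apply: Q_down ji Qi.
Qed.

End Property.

End FamilyCorrespondence.

(** * Families, cuspidal families and rigid families *)

Section MainTheorem.
Variables (F : decFieldType) (gT : finGroupType) (W K : {group gT}) (nKW : (K <| W)%g) (n : nat).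
Variable rW : mx_representation F W n.
Variables (alpha : gT -> 'cV[F]_n) (alphav : gT -> 'rV[F]_n) (c : gT -> F).
Local Notation sKW := (normal_sub nKW).
Local Notation rK := (subg_repr rW sKW).
Local Notation cW := (extend_by_zero rK c).
Hypothesis ch0 : [pchar F] =i pred0.
Hypothesis faithW : mx_faithful rW.
Hypothesis rootW : forall s, s \in reflections rW -> root_coroot rW s (alpha s) (alphav s).
Hypothesis cJ : forall s w, s \in reflections rK -> w \in W -> c (s ^ w)%g = c s.
Local Notation OmW := (families rW alpha alphav cW).
Local Notation OmK := (families rK alpha alphav c).
Local Notation b := (beta sKW OmK).

Let two_neq0 : 2 != 0 :> F.
Proof. by rewrite ((pcharf0P F).1 ch0). Qed.

Let up w j1 j j2 i1 i2 : w \in W -> in_restriction sKW j1 i1 -> in_restriction sKW j2 i2 ->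
  `[< same_block (L rK alpha alphav c j1) (L rK alpha alphav c j) >] -> conj_irr w j j2 ->
  `[< same_block (L rW alpha alphav cW i1) (L rW alpha alphav cW i2) >].
Proof.
move=> Ww r1 r2 /asboolP bl cj; apply/asboolP.
exact: (blocks_up two_neq0 ch0 faithW rootW cJ Ww r1 r2 bl cj).
Qed.

Let down j1 i1 j2 i2 : in_restriction sKW j1 i1 -> in_restriction sKW j2 i2 ->
  `[< same_block (L rW alpha alphav cW i1) (L rW alpha alphav cW i2) >] ->
  exists w j, [/\ w \in W, `[< same_block (L rK alpha alphav c j1) (L rK alpha alphav c j) >]
    & conj_irr w j j2].
Proof.
move=> r1 r2 /asboolP bl.
have [w [j [Ww bl' cj]]] := blocks_down two_neq0 ch0 rootW cJ r1 r2 bl.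
by exists w, j; split=> //; apply/asboolP.
Qed.

Let conj w j1 j2 j1' j2' : w \in W ->
  `[< same_block (L rK alpha alphav c j1) (L rK alpha alphav c j2) >] ->
  conj_irr w j1 j1' -> conj_irr w j2 j2' ->
  `[< same_block (L rK alpha alphav c j1') (L rK alpha alphav c j2') >].
Proof.
move=> Ww /asboolP bl c1 c2; apply/asboolP.
exact: (blocks_conj two_neq0 ch0 rootW cJ Ww bl c1 c2).
Qed.

Let eqK := blocksK_equiv two_neq0 ch0 rootW cJ.
Let eqW := blocksW_equiv two_neq0 ch0 rootW cJ.

Lemma families_correspondence :
  [/\ forall X, X \in OmW -> cover (b X) = restriction_constituents sKW X,
      stable_families W OmK & bijection_onto b OmW (family_orbits W OmK)].
Proof.
split.
- exact: (cover_beta ch0 eqK up down conj).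
- exact: (stable_partition nKW ch0 conj).
- exact: (beta_bijection ch0 eqK eqW up down conj).
Qed.

Lemma cuspidal_correspondence :
  stable_families W (cuspidal_families rK alpha alphav c) /\
  exists2 b' : {set {set Irr F K}} -> {set Irr F W},
     forall O, O \in family_orbits W (cuspidal_families rK alpha alphav c) ->
       b' O \in cuspidal_families rW alpha alphav cW /\ b (b' O) = O
   & {in family_orbits W (cuspidal_families rK alpha alphav c) &, injective b'}.
Proof.
split.
  apply: (stable_property nKW ch0 eqK conj) => w j j' Ww jj'.
  exact: (poisson_conj two_neq0 rootW cJ Ww jj').
apply: (property_embedding ch0 eqK eqW up down conj) => j i ji.
exact: (poisson_up two_neq0 ch0 faithW rootW cJ ji).
Qed.

Lemma rigid_correspondence :
  stable_families W (rigid_families rK alpha alphav c) /\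
  bijection_onto b (rigid_families rW alpha alphav cW)
    (family_orbits W (rigid_families rK alpha alphav c)).
Proof.
have rg j i (ji : in_restriction sKW j i) := rigid_restrict two_neq0 rootW cJ ji.
split.
  apply: (stable_property nKW ch0 eqK conj) => w j j' Ww jj' rj.
  have [i ji] := induction_exists nKW ch0 j.
  exact/(rg _ _ (in_restriction_conj Ww ji jj'))/(rg _ _ ji).
apply: (property_bijection ch0 eqK eqW up down conj) => j i ji.
  exact: (rg _ _ ji).2.
exact: (rg _ _ ji).1.
Qed.

End MainTheorem.

Theorem proposition4p22 (R : realType) (gT : finGroupType) (W K : {group gT})
    (nKW : (K <| W)%g) (n : nat) (rW : mx_representation R[i] W n)
    (alpha : gT -> 'cV[R[i]]_n) (alphav : gT -> 'rV[R[i]]_n) (c : gT -> R[i]) :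
  let rK := subg_repr rW (normal_sub nKW) in
  let cW := extend_by_zero rK c in
  let OmW := families rW alpha alphav cW in
  let OmW_cusp := cuspidal_families rW alpha alphav cW in
  let OmW_rigid := rigid_families rW alpha alphav cW in
  let OmK := families rK alpha alphav c in
  let OmK_cusp := cuspidal_families rK alpha alphav c in
  let OmK_rigid := rigid_families rK alpha alphav c in
  let orbits := @family_orbits R[i] gT W K in
  let b := beta (normal_sub nKW) OmK in
  complex_reflection_group rW -> mx_irreducible rW ->
  complex_reflection_group rK ->
  (forall s, s \in reflections rW -> root_coroot rW s (alpha s) (alphav s)) ->
  (forall s w, s \in reflections rK -> w \in W -> c (s ^ w)%g = c s) ->
  [/\ [/\ forall X, X \in OmW ->
            cover (b X) = restriction_constituents (normal_sub nKW) X,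
          stable_families W OmK
        & bijection_onto b OmW (orbits OmK)],
      stable_families W OmK_cusp /\
      (exists2 b' : {set {set Irr R[i] K}} -> {set Irr R[i] W},
         forall O, O \in orbits OmK_cusp -> b' O \in OmW_cusp /\ b (b' O) = O
       & {in orbits OmK_cusp &, injective b'})
    & stable_families W OmK_rigid /\
      bijection_onto b OmW_rigid (orbits OmK_rigid)].
Proof.
move=> rK cW OmW OmW_cusp OmW_rigid OmK OmK_cusp OmK_rigid orbits b [faithW _ _] _ _ rootW cJ.
have ch0 : [pchar R[i]] =i pred0 by exact: Num.Theory.pchar_num.
split.
- exact: (families_correspondence ch0 faithW rootW cJ).
- exact: (cuspidal_correspondence ch0 faithW rootW cJ).
- exact: (rigid_correspondence ch0 faithW rootW cJ).
Qed.
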